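(* Let $k$ be a field and let $G$ be a group of multiplicative type over $k$. If $BG$ is $p$-retract rational for every prime number $p$, then $BG$ is retract rational.
   Context: A $k$-variety $X$ is called retract rational if the identity map of $X$ factors rationally through some affine space, i.e. there exist $n$ and rational maps $X\dashrightarrow \mathbb{A}^n_k\dashrightarrow X$ over $k$ whose composition is defined and equals the identity of $X$ as a rational map. For a prime $p$, $X$ is called $p$-retract rational if there exist an integer $n$, a $k$-variety $X'$, a finite dominant morphism $f:X'\to X$ of degree not divisible by $p$, a morphism $s:X'\to\mathbb{A}^n_k$ and a rational map $\pi:\mathbb{A}^n_k\dashrightarrow X$ forming a commutative triangle, i.e. the composition $\pi\circ s$ is defined and equals $f$ as a rational map. Let $G$ be a linear algebraic group over $k$ and let $V$ be a finite-dimensional generically free linear representation of $G$. There is a dense $G$-invariant open subset $U\subseteq V$ such that the geometric quotient $U/G$ exists and $U\to U/G$ is a $G$-torsor. By the no-name lemma, the retract rationality (resp. $p$-retract rationality) of $U/G$ does not depend on the representation $V$ but only on $G$. One says that $BG$ (the classifying stack of $G$) is retract rational (resp. $p$-retract rational) if $U/G$ is. For $G$ of multiplicative type this can be expressed as follows: embed $G$ in a quasi-split torus $S$ (a torus whose character lattice is a permutation lattice), giving an exact sequence $1\to G\to S\to T\to 1$ with $T$ a torus; then $BG$ is retract rational (resp. $p$-retract rational) if and only if $T$ is. *)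

(* Defs.v *)
From HB Require Import structures.
From mathcomp Require Import all_boot all_order all_algebra all_field.
From mathcomp Require Export mpoly.

Set Implicit Arguments.
Unset Strict Implicit.
Unset Printing Implicit Defensive.

Import GRing.Theory.
Local Open Scope ring_scope.

(* A commutative k-algebra is given by its structure map.  This (rather than   *)
(* comAlgType k) keeps restriction of scalars and fraction fields immediate.   *)
(* Only nonzero algebras occur; the zero algebra carries no information in     *)
(* the functors of points below.                                               *)
Record kalg (k : fieldType) := KAlg {
  ksort :> comNzRingType;
  kmap : {rmorphism k -> ksort}
}.

Record khom (k : fieldType) (A B : kalg k) := KHom {
  khom_fun :> {rmorphism A -> B};
  khomE : forall c, khom_fun (kmap A c) = kmap B c
}.

Definition peval (k : fieldType) (R : kalg k) (n : nat)
    (v : 'I_n -> R) (P : {mpoly k[n]}) : R :=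
  mmap (kmap R) v P.

Definition invertible (R : comNzRingType) (x : R) : Prop :=
  exists y : R, x * y = 1.

(* An integral affine k-scheme of finite type, given by its coordinate ring. *)
Record affine_variety (k : fieldType) := AffineVariety {
  coord :> idomainType;
  cmap : {rmorphism k -> coord};
  coord_fg : exists (m : nat) (x : 'I_m -> coord),
    forall y : coord, exists P : {mpoly k[m]}, y = mmap cmap x P
}.

Definition coord_alg (k : fieldType) (X : affine_variety k) : kalg k :=
  KAlg (@cmap k X).

Definition function_field (k : fieldType) (X : affine_variety k) : kalg k :=
  @KAlg k {fraction X} (@tofrac X \o @cmap k X).

Definition ratfun (k : fieldType) (n : nat) : kalg k :=
  @KAlg k {fraction {mpoly k[n]}} (@tofrac {mpoly k[n]} \o @mpolyC n k).

(* A rational map A^n --> X is a k-point of X over Spec k(x_1, ..., x_n), the  *)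
(* generic point of A^n.                                                       *)
Definition rational_map (k : fieldType) (n : nat) (X : affine_variety k) :=
  khom (coord_alg X) (ratfun k n).

(* phi restricts to a morphism D(g) -> X: it maps k[X] into k[x_1,...,x_n]_g. *)
Definition regular_on (k : fieldType) (n : nat) (X : affine_variety k)
    (g : {mpoly k[n]}) (phi : rational_map n X) : Prop :=
  g != 0 /\
  forall a : X, exists (P : {mpoly k[n]}) (e : nat),
    phi a = (tofrac P / tofrac g ^+ e) :> {fraction {mpoly k[n]}}.

(* For phi regular on D(g) and an R-point v of D(g), the image of v under the  *)
(* morphism D(g) -> X is the R-point y of X: if phi a = P / g^e, then          *)
(* y a = P(v) / g(v)^e.                                                        *)
Definition sends (k : fieldType) (n : nat) (X : affine_variety k)
    (g : {mpoly k[n]}) (phi : rational_map n X)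
    (R : kalg k) (v : 'I_n -> R) (y : X -> R) : Prop :=
  forall (a : X) (P : {mpoly k[n]}) (e : nat),
    phi a = (tofrac P / tofrac g ^+ e) :> {fraction {mpoly k[n]}} ->
    peval v P = y a * peval v g ^+ e.

(* For a rational map s from Z to A^n, i.e. an n-tuple of rational functions   *)
(* on Z: the image of the generic point of Z under s lies in the domain of     *)
(* definition of phi, and the composite is the morphism Z -> X dual to f.      *)
Definition composes_to (k : fieldType) (n : nat) (X Z : affine_variety k)
    (s : 'I_n -> function_field Z) (phi : rational_map n X)
    (f : khom (coord_alg X) (coord_alg Z)) : Prop :=
  exists g : {mpoly k[n]},
    [/\ regular_on g phi, invertible (peval s g)
      & sends g phi s (fun a : X => tofrac (f a : Z) : function_field Z)].

Definition khom_id (k : fieldType) (A : kalg k) : khom A A :=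
  @KHom k A A idfun (fun=> erefl).

Definition retract_rational (k : fieldType) (X : affine_variety k) : Prop :=
  exists (n : nat) (s : 'I_n -> function_field X) (phi : rational_map n X),
    composes_to s phi (khom_id (coord_alg X)).

Definition finite_hom (A B : comNzRingType) (f : {rmorphism A -> B}) : Prop :=
  exists (m : nat) (e : 'I_m -> B),
    forall b, exists c : 'I_m -> A, b = \sum_(i < m) f (c i) * e i.

(* [Frac B : Frac A] = d, by a basis; F is the map induced by f on fractions.  *)
Definition has_degree (A B : idomainType) (f : {rmorphism A -> B}) (d : nat) :
    Prop :=
  exists (F : {rmorphism {fraction A} -> {fraction B}})
         (e : 'I_d -> {fraction B}),
    (forall a, F (tofrac a) = tofrac (f a)) /\
    forall z, exists! c : 'rV[{fraction A}]_d,
      z = \sum_(i < d) F (c 0 i) * e i.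

Definition p_retract_rational (k : fieldType) (p : nat)
    (X : affine_variety k) : Prop :=
  exists (n : nat) (X' : affine_variety k)
         (f : khom (coord_alg X) (coord_alg X'))
         (s : 'I_n -> X') (phi : rational_map n X),
    [/\ finite_hom f,
        injective f (* f is dominant *),
        exists2 d : nat, @has_degree X X' f d & ~~ (p %| d)%N
      & composes_to (fun i => tofrac (s i) : function_field X') phi f].

Definition mx_vanish (k : fieldType) (N : nat) (E : seq {mpoly k[N * N]})
    (R : kalg k) (M : 'M[R]_N) : Prop :=
  forall P, P \in E -> peval (fun i => mxvec M 0 i) P = 0.

(* A closed subgroup scheme of GL_N, possibly non-reduced: the equations E cut *)
(* out a subgroup of GL_N(R) for every k-algebra R.  Equations in              *)
(* k[x_ij, 1/det] may be taken in k[x_ij] by clearing denominators.            *)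
Record lin_alg_group (k : fieldType) := LinAlgGroup {
  gdim : nat;
  geqs : seq {mpoly k[gdim * gdim]};
  geqs1 : forall R : kalg k, mx_vanish geqs (1%:M : 'M[R]_gdim);
  geqsM : forall (R : kalg k) (M M' M1 M1' : 'M[R]_gdim),
    M *m M1 = 1%:M -> M' *m M1' = 1%:M ->
    mx_vanish geqs M -> mx_vanish geqs M' -> mx_vanish geqs (M *m M');
  geqsV : forall (R : kalg k) (M M1 : 'M[R]_gdim),
    M *m M1 = 1%:M -> mx_vanish geqs M -> mx_vanish geqs M1
}.

Definition gpoint (k : fieldType) (G : lin_alg_group k) (R : kalg k)
    (M : 'M[R]_(gdim G)) : Prop :=
  (exists M1 : 'M[R]_(gdim G), M *m M1 = 1%:M) /\ mx_vanish (geqs G) M.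

(* A homomorphism of group functors G -> GL_d, i.e. a linear representation of *)
(* G on k^d.  The values of rho_fun outside G(R) are irrelevant.               *)
Record representation (k : fieldType) (G : lin_alg_group k) (d : nat) := Rep {
  rho_fun :> forall R : kalg k, 'M[R]_(gdim G) -> 'M[R]_d;
  rho1 : forall R : kalg k, rho_fun (1%:M : 'M[R]_(gdim G)) = 1%:M;
  rhoM : forall (R : kalg k) (M M' : 'M[R]_(gdim G)),
    gpoint M -> gpoint M' -> rho_fun (M *m M') = rho_fun M *m rho_fun M';
  rho_nat : forall (R S : kalg k) (h : khom R S) (M : 'M[R]_(gdim G)),
    gpoint M -> rho_fun (map_mx h M : 'M[S]_(gdim G)) = map_mx h (rho_fun M)
}.

Definition restrict_scalars (k : fieldType) (L : fieldExtType k) (R : kalg L) :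
    kalg k :=
  @KAlg k R (kmap R \o in_alg L).

Definition fg_group (M : zmodType) : Prop :=
  exists (r : nat) (x : 'I_r -> M),
    forall m, exists c : 'I_r -> int, m = \sum_(i < r) x i *~ c i.

(* Group homomorphisms M -> R^*. *)
Definition character_point (M : zmodType) (R : comNzRingType) (chi : M -> R) :
    Prop :=
  chi 0 = 1 /\ forall m m', chi (m + m') = chi m * chi m'.

(* G_L is isomorphic to D(M) = Hom(M, G_m), for some finitely generated M. *)
Definition diagonalizable_over (k : fieldType) (G : lin_alg_group k)
    (L : fieldExtType k) : Prop :=
  exists (M : zmodType)
         (theta : forall R : kalg L,
            'M[restrict_scalars R]_(gdim G) -> M -> R),
    [/\ fg_group M,
        forall (R : kalg L) (g : 'M[restrict_scalars R]_(gdim G)),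
          gpoint g -> character_point (theta R g),
        forall (R : kalg L) (g h : 'M[restrict_scalars R]_(gdim G)),
          gpoint g -> gpoint h ->
          forall m, theta R (g *m h) m = theta R g m * theta R h m,
        forall (R S : kalg L) (j : khom R S)
            (g : 'M[restrict_scalars R]_(gdim G)),
          gpoint g ->
          forall m, theta S (map_mx j g : 'M[restrict_scalars S]_(gdim G)) m
                    = j (theta R g m)
      & forall (R : kalg L) (chi : M -> R), character_point chi ->
          exists! g : 'M[restrict_scalars R]_(gdim G),
            gpoint g /\ forall m, theta R g m = chi m].

(* As G is of finite type, becoming diagonalizable over a separable closure    *)
(* amounts to becoming so over some finite separable extension.                *)
Definition multiplicative_type (k : fieldType) (G : lin_alg_group k) : Prop :=
  exists2 L : fieldExtType k,
    separable 1%VS (fullv : {vspace L}) & diagonalizable_over G L.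

(* Equational criterion for flatness: every linear relation in B with          *)
(* coefficients in A comes from relations in A.                                *)
Definition flat_hom (A B : comNzRingType) (f : {rmorphism A -> B}) : Prop :=
  forall (n : nat) (a : 'I_n -> A) (b : 'I_n -> B),
    \sum_(i < n) f (a i) * b i = 0 ->
    exists (m : nat) (c : 'I_n -> 'I_m -> A) (y : 'I_m -> B),
      (forall i, b i = \sum_(j < m) f (c i j) * y j) /\
      (forall j, \sum_(i < n) a i * c i j = 0).

(* The second condition says that I B = B only for I = A. *)
Definition faithfully_flat_hom (A B : comNzRingType)
    (f : {rmorphism A -> B}) : Prop :=
  flat_hom f /\
  forall (n : nat) (a : 'I_n -> A) (b : 'I_n -> B),
    \sum_(i < n) f (a i) * b i = 1 ->
    exists c : 'I_n -> A, \sum_(i < n) a i * c i = 1.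

(* R-points of the principal open subset D(g) of the vector space k^d. *)
Definition open_point (k : fieldType) (d : nat) (g : {mpoly k[d]})
    (R : kalg k) (v : 'cV[R]_d) : Prop :=
  invertible (peval (fun i => v i 0) g).

Definition over (k : fieldType) (d : nat) (X : affine_variety k)
    (g : {mpoly k[d]}) (phi : rational_map d X)
    (R : kalg k) (v : 'cV[R]_d) (y : X -> R) : Prop :=
  sends g phi (fun i => v i 0) y.

(* The open subset U = D(g) of the representation rho is dense and G-invariant *)
(* and phi : U -> X is a G-torsor, so that X = U/G: phi is G-invariant, G(R)   *)
(* acts simply transitively on the R-points of U over each R-point of X, and   *)
(* phi has local sections for the fpqc topology (equivalently for the fppf     *)
(* topology, G being of finite type).  That such a U exists is precisely the   *)
(* generic freeness of rho.  An affine U/G forces U to be affine, hence        *)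
(* principal.                                                                  *)
Definition torsor_quotient (k : fieldType) (G : lin_alg_group k) (d : nat)
    (rho : representation G d) (g : {mpoly k[d]})
    (X : affine_variety k) (phi : rational_map d X) : Prop :=
  [/\ regular_on g phi,
      forall (R : kalg k) (M : 'M[R]_(gdim G)) (v : 'cV[R]_d),
        gpoint M -> open_point g v -> open_point g (rho R M *m v),
      forall (R : kalg k) (M : 'M[R]_(gdim G)) (v : 'cV[R]_d)
          (y : khom (coord_alg X) R),
        gpoint M -> open_point g v ->
        over g phi v y -> over g phi (rho R M *m v) y,
      forall (R : kalg k) (v w : 'cV[R]_d) (y : khom (coord_alg X) R),
        open_point g v -> open_point g w ->
        over g phi v y -> over g phi w y ->
        exists! M : 'M[R]_(gdim G), gpoint M /\ w = rho R M *m v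
    & forall (R : kalg k) (y : khom (coord_alg X) R),
        exists (S : kalg k) (h : khom R S) (v : 'cV[S]_d),
          [/\ faithfully_flat_hom h, open_point g v
            & over g phi v (fun a : X => h (y a))] ].

(* BG has a property P of varieties if U/G does.  By the no-name lemma, for    *)
(* the two properties below this does not depend on the generically free       *)
(* representation nor on U.                                                    *)
Definition BG_has (k : fieldType) (G : lin_alg_group k)
    (P : affine_variety k -> Prop) : Prop :=
  forall (d : nat) (rho : representation G d) (g : {mpoly k[d]})
         (X : affine_variety k) (phi : rational_map d X),
    torsor_quotient rho g phi -> P X.

Definition BG_retract_rational (k : fieldType) (G : lin_alg_group k) : Prop :=
  BG_has G (@retract_rational k).

Definition BG_p_retract_rational (k : fieldType) (p : nat)
    (G : lin_alg_group k) : Prop :=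
  BG_has G (@p_retract_rational k p).

(* Main.v *)
(* Over a finite Galois extension L of k the group G is diagonalizable and V   *)
(* has a Galois-stable spanning family of linear forms l_i on which G acts by  *)
(* characters.  Put K = k(X).  By descent along the torsor U -> X, monomials   *)
(* l^m of weight zero lie in K (x) L = L(X).  The lattice M0 of all exponents  *)
(* m with l^m in L(X) carries a Galois action, and m |-> l^m is a K-point t of *)
(* the k-torus T with character lattice M0, i.e. a rational map X --> T.  The  *)
(* integers D such that t^D : X --> T factors through an affine space form a   *)
(* subgroup of Z.  A p-retraction X' -> A^n --> X over X, of degree d, factors *)
(* t over k(X'); taking norms from k(X') to K puts d in this subgroup.  Hence  *)
(* the subgroup contains 1 and t itself factors as X --> A^n --> T.  A         *)
(* function on X, pulled back to U, is a quotient of two polynomials in the    *)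
(* l_i all of whose exponents lie in one coset of M0; replacing the            *)
(* characters l^m, m in M0, by their pullbacks along A^n --> T turns it into a *)
(* Galois invariant rational function on A^n, and this is the retraction       *)
(* A^n --> X.                                                                  *)

Require Import Defs.
From HB Require Import structures.
From mathcomp Require Import all_boot all_order all_fingroup all_algebra all_field.
From mathcomp Require Import ring_quotient generic_quotient bigenough ssrcomplements.
From Stdlib Require Import Classical ClassicalEpsilon.

Set Implicit Arguments.
Unset Strict Implicit.
Unset Printing Implicit Defensive.

Import GRing.Theory BigEnough.
Local Open Scope ring_scope.

(** * Rings of fractions, quotients and subrings *)

(** Points of a torus, unlike points of a general variety, can be multiplied, inverted and pushed
    down by norms, and this is what allows degrees to be removed from retractions. The question is
    therefore moved from X = U/G to the lattice M0 of exponents m for which the monomial l^m in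
    semi-invariant linear forms lies in L(X). These monomials amount to a point t, over K = k(X), of
    the torus with character lattice M0, and [power_factors] says that t^D factors through an affine
    space.

    Torus side: [power_factors_initial] turns a p-retraction X' -> A^n --> X into a factorization of
    t over k(X'). [power_factors_degree] takes its norm to K and obtains D = [k(X') : K]. By
    [power_factorsN] and [power_factorsD] the admissible D form a subgroup of Z, so
    [power_factors_bezout] reaches D = 1 as soon as no prime divides all of them.

    Group side: [weight_system] supplies linear forms, permuted by the Galois group, on which G acts
    by characters. [weight_zero_descends] shows, by descent along U -> X, that the monomials of
    weight zero lie in L(X). [weight_components] then writes every function on X as a quotient of
    polynomials in the forms whose exponents lie in a single coset of M0. Replacing the monomials by
    the pullbacks of the characters to A^n gives Galois-invariant functions on A^n, and
    [pullback_retract] assembles them into the retraction A^n --> X. *)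

Lemma rmorphism_of_graph (A B : nzRingType) (Rel : A -> B -> Prop) :
  (forall a, exists b, Rel a b) ->
  (forall a b b', Rel a b -> Rel a b' -> b = b') ->
  (forall a a' b b', Rel a b -> Rel a' b' -> Rel (a - a') (b - b')) ->
  (forall a a' b b', Rel a b -> Rel a' b' -> Rel (a * a') (b * b')) ->
  Rel 1 1 -> exists f : {rmorphism A -> B}, forall a, Rel a (f a).
Proof.
move=> tot fct RB RM R1.
pose f a := proj1_sig (constructive_indefinite_description _ (tot a)).
have fP a : Rel a (f a).
  exact: proj2_sig (constructive_indefinite_description _ (tot a)).
have fB : zmod_morphism f.
  by move=> a b; apply: (fct _ _ _ (fP _)); apply: RB.
have fM : monoid_morphism f.
  by split=> [|a b]; apply: (fct _ _ _ (fP _)) => //; apply: RM.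
pose fa := GRing.isZmodMorphism.Build A B f fB.
pose fm := GRing.isMonoidMorphism.Build A B f fM.
pose F : {rmorphism A -> B} := HB.pack f fa fm.
by exists F.
Qed.

Lemma fractionP (A : idomainType) (x : {fraction A}) :
  exists2 nd : A * A, nd.2 != 0 & x = tofrac nd.1 / tofrac nd.2.
Proof.
elim/quotW: x => x; exists (frac x); first exact: denom_ratioP.
have d0 : (frac x).2 != 0 := denom_ratioP _.
apply: (mulIf (_ : tofrac (frac x).2 != 0)); first by rewrite tofrac_eq0.
rewrite mulfVK ?tofrac_eq0 //.
unlock FracField.tofrac; rewrite -[LHS]FracField.pi_mul.
apply/eqmodP; rewrite /= FracField.equivfE /FracField.mulf.
by rewrite !numden_Ratio ?mulf_neq0 ?oner_neq0 ?mulr1 // mulrC.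
Qed.

Lemma fraction_common_denominator (A : idomainType) n (x : 'I_n -> {fraction A}) :
  exists (a : 'I_n -> A) (b : A), b != 0 /\ forall i, x i = tofrac (a i) / tofrac b.
Proof.
have nd_ex i : exists p : A * A, p.2 != 0 /\ x i = tofrac p.1 / tofrac p.2.
  by have [p] := fractionP (x i); exists p.
pose nd i := proj1_sig (constructive_indefinite_description _ (nd_ex i)).
have ndP i : (nd i).2 != 0 /\ x i = tofrac (nd i).1 / tofrac (nd i).2.
  exact: (proj2_sig (constructive_indefinite_description _ (nd_ex i))).
exists (fun i => (nd i).1 * \prod_(j | j != i) (nd j).2), (\prod_j (nd j).2).
have p0 P : \prod_(j < n | P j) (nd j).2 != 0.
  by apply/prodf_neq0 => j _; case: (ndP j).
split=> // i; have [d0 ->] := ndP i.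
have -> : \prod_j (nd j).2 = (nd i).2 * \prod_(j | j != i) (nd j).2 by rewrite (bigD1 i).
rewrite !rmorphM /= invfM mulrACA.
by rewrite divff ?mulr1 // tofrac_eq0.
Qed.

Lemma fraction_lift (A : idomainType) (F : fieldType) (f : {rmorphism A -> F}) :
  (forall a, a != 0 -> f a != 0) ->
  exists f' : {rmorphism {fraction A} -> F}, forall a, f' (tofrac a) = f a.
Proof.
move=> f0.
pose Rel (x : {fraction A}) y := exists a b, [/\ b != 0, x = tofrac a / tofrac b & y = f a / f b].
have t0 (a : A) : a != 0 -> tofrac a != 0 by rewrite tofrac_eq0.
have fct x y y' : Rel x y -> Rel x y' -> y = y'.
  case=> a [b [b0 -> ->]] [a' [b' [b0' e ->]]].
  apply/eqP; rewrite eqr_div ?f0 // -!rmorphM; apply/eqP; congr (f _).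
  apply/eqP; rewrite -tofrac_eq !rmorphM -eqr_div ?t0 //; exact/eqP.
have [|//||||f' f'P] := @rmorphism_of_graph _ _ Rel.
- move=> x; have [[a b] /= b0 ->] := fractionP x.
  by exists (f a / f b), a, b.
- move=> x x' y y' [a [b [b0 -> ->]]] [a' [b' [b0' -> ->]]].
  exists (a * b' - a' * b), (b * b'); rewrite mulf_neq0 //; split=> //.
    by rewrite -mulNr addf_div ?t0 // !rmorphM rmorphB !rmorphM mulNr.
  by rewrite -mulNr addf_div ?f0 // !rmorphM rmorphB !rmorphM mulNr.
- move=> x x' y y' [a [b [b0 -> ->]]] [a' [b' [b0' -> ->]]].
  exists (a * a'), (b * b'); rewrite mulf_neq0 //; split=> //.
    by rewrite mulf_div !rmorphM.
  by rewrite mulf_div !rmorphM.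
- by exists 1, 1; rewrite oner_neq0 !rmorph1 !divr1.
exists f' => a; apply: fct (f'P _) _.
by exists a, 1; rewrite oner_neq0 !rmorph1 !divr1.
Qed.

Lemma divf_eq_cross (F : fieldType) (a b c d : F) : b != 0 -> d != 0 ->
  a / b = c / d -> a * d = c * b.
Proof. by move=> b0 d0 /eqP; rewrite eqr_div // => /eqP. Qed.

Section QuotientRing.
Local Open Scope quotient_scope.
Variables (A : comNzRingType) (I : A -> Prop).
Hypotheses (I0 : I 0) (ID : forall a b, I a -> I b -> I (a + b)).
Hypotheses (IM : forall a b, I b -> I (a * b)) (I1 : ~ I 1).

Let Ib : A -> bool := fun a => if excluded_middle_informative (I a) then true else false.

Let IbP a : reflect (I a) (a \in (Ib : {pred A})).
Proof. by rewrite unfold_in /Ib; case: excluded_middle_informative => h; constructor. Qed.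

(** The ideal is a bare predicate, made boolean by excluded middle; properness is what keeps the
    quotient a nonzero ring. *)
Lemma quotient_ring : exists (C : comNzRingType) (pi : {rmorphism A -> C}),
  (forall a, pi a = 0 <-> I a) /\ forall c, exists a, c = pi a.
Proof.
have Icl : idealr_closed (Ib : {pred A}).
  split; [exact/IbP | exact/IbP |].
  by move=> a x y /IbP xI /IbP yI; apply/IbP/ID => //; apply: IM.
pose J0 := isIdealr.Build A Ib Icl.
pose J : idealr A := HB.pack Ib J0.
exists {ideal_quot J}, \pi_{ideal_quot J}.
split=> [a|c]; last by exists (repr c); exact: (esym (reprK c)).
have e : (\pi_{ideal_quot J} a = \pi_{ideal_quot J} 0) <-> I a.
  split=> [/eqP|Ia]; first by rewrite -Quotient.idealrBE subr0 => /IbP.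
  by apply/eqP; rewrite -Quotient.idealrBE subr0; apply/IbP.
by rewrite -e; have -> : \pi_{ideal_quot J} 0 = 0 by exact: rmorph0.
Qed.

End QuotientRing.

Lemma factor_through (A C B : nzRingType) (pi : {rmorphism A -> C}) (h : {rmorphism A -> B}) :
  (forall c, exists a, c = pi a) -> (forall a, pi a = 0 -> h a = 0) ->
  exists h' : {rmorphism C -> B}, forall a, h' (pi a) = h a.
Proof.
move=> surj ker.
pose Rel c b := exists a, c = pi a /\ b = h a.
have fct c b b' : Rel c b -> Rel c b' -> b = b'.
  move=> [a [-> ->]] [a' [e ->]]; apply/eqP; rewrite -subr_eq0 -rmorphB.
  by apply/eqP/ker; rewrite rmorphB e subrr.
have [|//||||h' h'P] := @rmorphism_of_graph _ _ Rel.
- by move=> c; have [a ->] := surj c; exists (h a), a.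
- move=> c c' b b' [a [-> ->]] [a' [-> ->]].
  by exists (a - a'); rewrite !rmorphB.
- move=> c c' b b' [a [-> ->]] [a' [-> ->]].
  by exists (a * a'); rewrite !rmorphM.
- by exists 1; rewrite !rmorph1.
by exists h' => a; apply: fct (h'P _) _; exists a.
Qed.

Lemma lift_to_subring (E C B : nzRingType) (i : {rmorphism C -> B}) (h : {rmorphism E -> B}) :
  injective i -> (forall x, exists c, h x = i c) ->
  exists h' : {rmorphism E -> C}, forall x, i (h' x) = h x.
Proof.
move=> inj im; pose Rel x c := h x = i c.
have [//|||||h' h'P] := @rmorphism_of_graph _ _ Rel.
- by move=> x c c'; rewrite /Rel => -> /inj.
- by move=> x x' c c' e e'; rewrite /Rel !rmorphB e e'.
- by move=> x x' c c' e e'; rewrite /Rel !rmorphM e e'.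
- by rewrite /Rel !rmorph1.
by exists h' => x; rewrite h'P.
Qed.

(** * Galois closure *)

(** Only what the argument needs of a Galois group: it acts on the right ([s] before [t] in
    [s * t]), its invariants are k, and some element has trace 1, which serves for averaging. *)
Record galois_data (k : fieldType) (L : fieldExtType k) := GaloisData {
  gal_group : finGroupType;
  gal_act : gal_group -> {rmorphism L -> L};
  gal_actM : forall s t x, gal_act (s * t)%g x = gal_act t (gal_act s x);
  gal_act1 : forall x, gal_act 1%g x = x;
  gal_actk : forall s (c : k), gal_act s c%:A = c%:A;
  gal_act_fix : forall x, (forall s, gal_act s x = x) -> exists c : k, x = c%:A;
  gal_act_trace : exists c, \sum_s gal_act s c = 1
}.

Lemma irreducible_divisor (F : fieldType) (p : {poly F}) :
  (1 < size p)%N -> exists2 q, irreducible_poly q & q %| p.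
Proof.
have [n] := ubnP (size p); elim: n p => // n IH p le_pn p1.
have [irr|nirr] := classic (irreducible_poly p); first by exists p.
have [q [q1 qp neq]] : exists q : {poly F}, [/\ size q != 1, q %| p & ~~ (q %= p)].
  apply: NNPP => no; apply: nirr; split=> // q q1 qp.
  by apply/negPn/negP => nq; apply: no; exists q.
have p0 : p != 0 by rewrite -size_poly_gt0 ltnW.
have q0 : q != 0 by apply: contraTneq qp => ->; rewrite dvd0p.
have lt_qp : (size q < size p)%N.
  by rewrite ltn_neqAle dvdp_leq // andbT (dvdp_size_eqp qp).
have [||r irr rq] := IH q; first exact: leq_trans lt_qp _.
  by rewrite ltn_neqAle eq_sym q1 size_poly_gt0.
by exists r => //; apply: dvdp_trans rq qp.
Qed.

(** Induction on the size, over all base fields at once: adjoining a root of an irreducible divisor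
    changes the field, and the remaining cofactor is smaller. *)
Lemma splitting_extension (F : fieldType) (p : {poly F}) : p != 0 ->
  exists (L : fieldExtType F) (zs : seq L),
    map_poly (in_alg L) p %= \prod_(z <- zs) ('X - z%:P).
Proof.
have [n] := ubnP (size p); elim: n F p => // n IH F p le_pn p0.
have [p1|p1] := leqP (size p) 1.
  exists F^o, [::].
  by rewrite big_nil -size_poly_eq1 size_map_poly eqn_leq p1 size_poly_gt0.
have [r irr rp] := irreducible_divisor p1.
have [K _ [x rx _]] := irredp_FAdjoin irr.
have /factor_theorem [q Dp] : root (map_poly (in_alg K) p) x.
  by have /dvdpP [u ->] := rp; rewrite rmorphM rootM rx orbT.
have sz : size p = size (q * ('X - x%:P)) by rewrite -Dp size_map_poly.
have q0 : q != 0.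
  by apply: contraNneq p0 => e; rewrite -size_poly_eq0 sz e mul0r size_poly0.
have [|L [zs Dq]] := IH K q _ q0.
  by move: le_pn; rewrite sz size_mul ?polyXsubC_eq0 // size_XsubC addn2 ltnS.
exists (baseFieldType L), (x%:A :: zs).
have -> : map_poly (in_alg (baseFieldType L)) p
        = map_poly (in_alg L) (map_poly (in_alg K) p).
  rewrite -map_poly_comp; apply: eq_map_poly => c; exact: baseField_scaleE.
rewrite Dp rmorphM /= rmorphB /= map_polyX map_polyC big_cons mulrC.
exact: eqp_mull Dq.
Qed.

Section GaloisClosure.
Variables (k : fieldType) (L : fieldExtType k).
Hypothesis sepL : separable 1%VS (fullv : {vspace L}).

(** In an extension M of L that splits the minimal polynomial of a primitive element [th], the roots
    generate over k a splitting field of a separable polynomial. It contains the image of [th],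
    hence that of L. *)
Lemma galois_closure : exists (L' : splittingFieldType k) (i : {rmorphism L -> L'}),
  galois 1 {:L'} /\ forall c : k, i c%:A = c%:A.
Proof.
pose th := separable_generator 1%AS {:L}%AS.
have gen : (<<1; th>> = fullv :> {vspace L})%VS.
  by rewrite -eq_adjoin_separable_generator ?sub1v.
have sep_th : separable_element 1 th by exact: separable_generatorP.
have /polyOver1P [p Dp] := minPolyOver 1 th.
have p0 : minPoly 1 th != 0 by rewrite monic_neq0 ?monic_minPoly.
have [M [zs Dzs]] := splitting_extension p0.
pose M1 := baseFieldType M; pose E : {subfield M1} := <<1 & (zs : seq M1)>>%AS.
have root_zs : (th%:A : M1) \in (zs : seq M1).
  have : root (map_poly (in_alg M) (minPoly 1 th)) th%:A.
    by rewrite fmorph_root root_minPoly.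
  by rewrite (eqp_root Dzs) root_prod_XsubC.
have imE x : (x%:A : M) \in E.
  have : x \in <<1; th>>%VS by rewrite gen memvf.
  case/Fadjoin_polyP => q /polyOver1P [r ->] ->.
  rewrite -in_algE -horner_map /= -map_poly_comp.
  have -> : map_poly (in_alg M \o in_alg L) r = map_poly (in_alg M1) r.
    by apply: eq_map_poly => c; rewrite /= baseField_scaleE.
  by apply: rpred_horner; [exact: alg_polyOver | exact: seqv_sub_adjoin].
pose N := subvs_of E; pose toM := linfun (vsval : N -> M1).
pose zsN : seq N := map (vsproj E) zs.
have Dzs' : map (vsval : N -> M1) zsN = zs.
  rewrite -map_comp map_id_in // => z zs_z /=.
  by rewrite vsprojK // seqv_sub_adjoin.
have splitN : splittingFieldFor 1 (map_poly (in_alg N) p) {:N}.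
  exists zsN.
    rewrite -(eqp_map (vsval : {rmorphism N -> M1})).
    rewrite rmorph_prod /= -map_poly_comp.
    under eq_bigr do rewrite rmorphB /= map_polyX map_polyC /=.
    rewrite -(big_map (vsval : N -> M1) xpredT (fun z => 'X - z%:P)) Dzs'.
    apply: etrans Dzs; congr (_ %= _); rewrite Dp -map_poly_comp.
    apply: eq_map_poly => c /=; rewrite -baseField_scaleE.
    by rewrite algid1.
  have toM_N : (toM @: <<1 & zsN>>)%VS = E.
    rewrite /toM aimg_adjoin_seq aimg1; congr (<<1 & _>>)%VS.
    by rewrite -[RHS]Dzs'; apply: eq_map => z; rewrite lfunE.
  apply/vspaceP => u; rewrite memvf.
  have : val u \in (toM @: <<1 & zsN>>)%VS by rewrite toM_N (valP u).
  by case/memv_imgP => v vin; rewrite lfunE => /val_inj ->.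
have spl : splitting_field_axiom N.
  by exists (map_poly (in_alg N) p) => //; apply: alg_polyOver.
pose N0 := FieldExt_isSplittingField.Build k N spl.
pose L' : splittingFieldType k := HB.pack N N0.
have galN : galois 1 {:L'}.
  apply/splitting_galoisField; exists (map_poly (in_alg L') p); split=> //.
    exact: alg_polyOver.
  move: sep_th; rewrite /separable_element Dp.
  by rewrite !separable_map.
have [i Di] : exists i : {rmorphism L -> N}, forall x, vsval (i x) = x%:A :> M.
  apply: (@lift_to_subring L N M (vsval : {rmorphism N -> M1}) (in_alg M)).
    exact: val_inj.
  by move=> x; exists (Subvs (imE x)).
exists L', i; split=> // c; apply: val_inj; apply: etrans (Di _) _.
rewrite /= algid1; symmetry; exact: baseField_scaleE.
Qed.

Lemma galois_closure_data : exists (L' : fieldExtType k) (i : {rmorphism L -> L'}),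
  inhabited (galois_data L') /\ forall c : k, i c%:A = c%:A.
Proof.
have [L' [i [gal ik]]] := galois_closure; exists L', i; split=> //; constructor.
pose act (s : gal_of {:L'}) : {rmorphism L' -> L'} := (s : 'AEnd(L')).
have actE s x : act s x = s x by [].
have actZ s a x : act s (a *: x) = a *: act s x by rewrite !actE linearZ.
have fix1 x : (forall s, act s x = x) -> exists c : k, x = c%:A.
  move=> fx; apply/vlineP; rewrite -(galois_fixedField gal).
  by apply/fixedFieldP; rewrite ?memvf // => s _; apply: fx.
have tr : exists c, \sum_s act s c = 1.
  (* Automorphisms are linearly independent, so the trace is not identically zero. A nonzero trace
     lies in k, and dividing by it gives trace 1. *)
  have [c tc] : exists c, \sum_s act s c != 0.
    apply: NNPP => no.
    have := @gal_independent _ _ {:L'}%AS xpredT (fun=> 1).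
    move=> /(_ _ 1%g isT)/eqP; rewrite oner_eq0 => indep; suff: false by [].
    apply: indep => c _; apply/eqP/negPn/negP => c0; apply: no; exists c.
    by move: c0; under eq_bigr do rewrite mul1r.
  have [d Dd] : exists d : k, \sum_s act s c = d%:A.
    apply: fix1 => s; rewrite rmorph_sum /= [RHS](reindex_inj (mulIg s)) /=.
    by apply: eq_bigr => t _; rewrite -galM ?memvf.
  exists (d^-1 *: c); under eq_bigr do rewrite actZ.
  rewrite -scaler_sumr; move: tc; rewrite Dd => d0; rewrite scalerA mulVf ?scale1r //.
  by apply: contraNneq d0 => ->; rewrite scale0r.
exists (gal_of {:L'}) act => //.
- by move=> s t x; rewrite !actE galM ?memvf.
- by move=> x; rewrite actE gal_id.
- by move=> s c; rewrite actZ rmorph1.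
Qed.
End GaloisClosure.

(** * Polynomials and group algebras *)

Section MonomialLinear.
Variables (n : nat) (R S : comNzRingType) (f : {rmorphism R -> S}).
Variable T : 'X_{1..n} -> S.

(** The [f]-semilinear extension of an arbitrary function [T] on monomials. It serves twice: for the
    coefficient maps of the group algebra and for [twist]. *)
Definition mlin (p : {mpoly R[n]}) : S := \sum_(m <- msupp p) f p@_m * T m.

Lemma mlinE p i : (msize p <= i)%N -> mlin p = \sum_(m : 'X_{1..n < i}) f p@_m * T m.
Proof.
move=> le_pi; rewrite /mlin (big_mksub 'X_{1..n < i}) ?msupp_uniq //=; last first.
  by move=> x /msize_mdeg_lt /leq_trans; apply.
rewrite big_rmcond //= => j /memN_msupp_eq0 ->.
by rewrite rmorph0 mul0r.
Qed.

Lemma mlin_is_zmod_morphism : zmod_morphism mlin.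
Proof.
move=> p q; pose_big_enough i.
  rewrite !(@mlinE _ i) // -sumrB; apply: eq_bigr => m _.
  by rewrite mcoeffB rmorphB mulrBl.
by close.
Qed.

HB.instance Definition _ :=
  GRing.isZmodMorphism.Build {mpoly R[n]} S mlin mlin_is_zmod_morphism.

Lemma mlinX m : mlin 'X_[m] = T m.
Proof. by rewrite /mlin msuppX big_seq1 mcoeffX eqxx rmorph1 mul1r. Qed.

Lemma mlinZ c p : mlin (c *: p) = f c * mlin p.
Proof.
pose_big_enough i.
  rewrite !(@mlinE _ i) // mulr_sumr; apply: eq_bigr => m _.
  by rewrite mcoeffZ rmorphM mulrA.
by close.
Qed.

End MonomialLinear.

Lemma mpoly_rmorphism_eq n (R : comNzRingType) (S : nzRingType)
    (f g : {rmorphism {mpoly R[n]} -> S}) :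
  (forall c, f c%:MP = g c%:MP) -> (forall i, f 'X_i = g 'X_i) -> f =1 g.
Proof.
move=> fgC fgX p; rewrite [p]mpolyE !rmorph_sum; apply: eq_bigr => m _.
rewrite -mul_mpolyC !rmorphM fgC mpolyXE_id !rmorph_prod; congr (_ * _).
by apply: eq_bigr => i _; rewrite !rmorphXn fgX.
Qed.

Lemma mmap_comp n (A B C : comNzRingType) (f : {rmorphism A -> B}) (h : {rmorphism B -> C})
    (v : 'I_n -> B) p : h (mmap f v p) = mmap (h \o f) (h \o v) p.
Proof.
have := @mpoly_rmorphism_eq n A C (h \o mmap f v) (mmap (h \o f) (h \o v)).
apply=> [c|i] /=; first by rewrite !mmapC.
by rewrite !mmapX !mmap1U.
Qed.

Lemma mmap_map_mpoly n (A B C : comNzRingType) (f : {rmorphism A -> B})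
    (g : {rmorphism B -> C}) (v : 'I_n -> C) p :
  mmap g v (map_mpoly f p) = mmap (g \o f) v p.
Proof.
have := @mpoly_rmorphism_eq n A C (mmap g v \o map_mpoly f) (mmap (g \o f) v).
apply=> [c|i] /=; first by rewrite map_mpolyC !mmapC.
by rewrite map_mpolyX !mmapX.
Qed.

Lemma eq_mmap n (A B : comNzRingType) (f g : {rmorphism A -> B}) (v w : 'I_n -> B) p :
  f =1 g -> v =1 w -> mmap f v p = mmap g w p.
Proof.
move=> fg vw; rewrite /mmap; apply: eq_bigr => m _.
by rewrite fg (mmap1_eq _ vw).
Qed.

Section GroupAlgebra.
Variables (A : comNzRingType) (M : zmodType).
Hypothesis fgM : fg_group M.

(** The ring A[M] with its basis of group-like elements [e m]. As M need not be free, A[M] is a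
    quotient of a polynomial ring whose variables carry weights in M: two polynomials are identified
    when, in every weight, their coefficients have the same sum. *)
Lemma group_algebra : exists (C : comNzRingType) (inc : {rmorphism A -> C})
    (e : M -> C) (coef : M -> C -> A),
  [/\ character_point e,
      forall m, zmod_morphism (coef m),
      forall m a m', coef m (inc a * e m') = if m == m' then a else 0,
      forall c, exists s : seq M, uniq s /\ c = \sum_(m <- s) inc (coef m c) * e m
    & forall (B : comNzRingType) (h : {rmorphism A -> B}) (chi : M -> B),
        character_point chi ->
        exists h' : {rmorphism C -> B},
          (forall a, h' (inc a) = h a) /\ forall m, h' (e m) = chi m].
Proof.
have [r [x xgen]] := fgM.
(* The opposites of the generators are weights too, so that nonnegative exponents reach all of M. *)
pose w (i : 'I_(r + r)) : M := match split i with inl j => x j | inr j => - x j end.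
pose wt (m : 'X_{1..r + r}) : M := \sum_i w i *+ m i.
have wtD m m' : wt (m + m')%MM = wt m + wt m'.
  by rewrite /wt -big_split; apply: eq_bigr => i _; rewrite mnmDE mulrnDr.
have wt0 : wt 0%MM = 0 by rewrite /wt big1 // => i _; rewrite mnm0E.
have wt_surj m : exists mu, wt mu = m.
  have [c ->] := xgen m.
  pose cn (i : 'I_(r + r)) : nat := match split i with
    | inl j => if c j is Posz a then a else 0%N
    | inr j => if c j is Negz a then a.+1 else 0%N end.
  exists [multinom cn i | i < r + r].
  rewrite /wt big_split_ord /= -big_split; apply: eq_bigr => i _ /=.
  rewrite !mnmE /w /cn !(unsplitK (inl _)) !(unsplitK (inr _)).
  by case: (c i) => a; rewrite ?mulr0n ?addr0 ?add0r // mulNrn.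
pose rep m := proj1_sig (constructive_indefinite_description _ (wt_surj m)).
have repK m : wt (rep m) = m.
  exact: proj2_sig (constructive_indefinite_description _ (wt_surj m)).
pose T m mu : A := (wt mu == m)%:R.
pose co m : {additive {mpoly A[r + r]} -> A} := mlin idfun (T m).
have coE m p : co m p = mlin idfun (T m) p by [].
have shift m mu nu : (wt nu + wt mu == m) = (wt mu == m - wt nu).
  by rewrite (eq_sym (wt mu)) subr_eq eq_sym addrC.
(* Multiplication by a monomial shifts the weights; this makes the common kernel of the [co m] an
   ideal. *)
have coX m nu p : co m ('X_[nu] * p) = co (m - wt nu) p.
  rewrite [p]mpolyE mulr_sumr (raddf_sum (co m)) (raddf_sum (co (m - wt nu))).
  apply: eq_bigr => mu _.
  rewrite !coE -scalerAr !mlinZ -mpolyXD !mlinX /T wtD.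
  by rewrite shift.
have regroup (B : comNzRingType) (h : {rmorphism A -> B}) (chi : M -> B) p :
    \sum_(mu <- msupp p) h p@_mu * chi (wt mu)
    = \sum_(m <- undup (map wt (msupp p))) h (co m p) * chi m.
  transitivity (\sum_(m <- undup (map wt (msupp p)))
                  \sum_(mu <- msupp p | wt mu == m) h p@_mu * chi m).
    rewrite (exchange_big_dep xpredT) //= [LHS]big_seq [RHS]big_seq.
    apply: eq_bigr => mu mup; rewrite -big_filter.
    have -> : [seq i <- undup (map wt (msupp p)) | wt mu == i] = [:: wt mu].
      rewrite (eq_filter (a2 := pred1 (wt mu))); last by move=> y; rewrite /= eq_sym.
      by rewrite filter_pred1_uniq ?undup_uniq // mem_undup map_f.
    by rewrite big_seq1.
  apply: eq_bigr => m _; rewrite -mulr_suml; congr (_ * _).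
  rewrite /= /mlin rmorph_sum big_mkcond /=; apply: eq_bigr => mu _; rewrite /T.
  by case: eqP; rewrite ?mulr1 ?mulr0 ?rmorph0.
pose I p := forall m, co m p = 0.
have [C [pi [piI pi_surj]]] : exists (C : comNzRingType) (pi : {rmorphism {mpoly A[r + r]} -> C}),
    (forall a, pi a = 0 <-> I a) /\ forall c, exists a, c = pi a.
  apply: quotient_ring => [m|p q Ip Iq m|p q Iq m|I1]; first exact: raddf0.
  - by rewrite raddfD Ip Iq addr0.
  - rewrite [p]mpolyE mulr_suml raddf_sum big1 // => mu _.
    by rewrite -scalerAl /= mlinZ -[mlin _ _ _]/(co _ _) coX Iq mulr0.
  - have /eqP := I1 0.
    by rewrite -mpolyX0 /= mlinX /T wt0 eqxx oner_eq0.
pose inc : {rmorphism A -> C} := pi \o @mpolyC _ A.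
pose e m : C := pi 'X_[rep m].
have piX mu : pi 'X_[mu] = e (wt mu).
  apply/eqP; rewrite -subr_eq0 -rmorphB; apply/eqP/piI => m.
  by rewrite raddfB /= !mlinX /T repK subrr.
have inc_e a m : inc a * e m = pi (a *: 'X_[rep m]) by rewrite -mul_mpolyC rmorphM.
have char_e : character_point e.
  split=> [|m m'].
    by rewrite -wt0 -piX mpolyX0 rmorph1.
  by rewrite -{1}(repK m) -{1}(repK m') -wtD -piX mpolyXD rmorphM.
have pi_ex c : exists p, pi p = c by have [p ->] := pi_surj c; exists p.
pose lf c := proj1_sig (constructive_indefinite_description _ (pi_ex c)).
have lfK c : pi (lf c) = c.
  exact: proj2_sig (constructive_indefinite_description _ (pi_ex c)).
pose coef m c := co m (lf c).
have coef_pi m p : coef m (pi p) = co m p.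
  apply/eqP; rewrite -subr_eq0 -raddfB; apply/eqP; move: m.
  by apply/piI; rewrite rmorphB lfK subrr.
exists C, inc, e, coef; split=> //.
- move=> m c c'; rewrite -(lfK c) -(lfK c') -rmorphB !coef_pi; exact: raddfB.
- move=> m a m'; rewrite inc_e coef_pi /= mlinZ mlinX /T repK eq_sym /=.
  by case: eqP; rewrite ?mulr1 ?mulr0.
- move=> c; have [p ->] := pi_surj c.
  pose s := undup (map wt (msupp p)); exists s; split; first exact: undup_uniq.
  transitivity (\sum_(mu <- msupp p) inc p@_mu * e (wt mu)).
    rewrite {1}[p]mpolyE rmorph_sum; apply: eq_bigr => mu _.
    by rewrite -mul_mpolyC rmorphM piX.
  by rewrite regroup; apply: eq_bigr => m _; rewrite coef_pi.
- move=> B h chi [chi0 chiD].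
  have chiMn m k : chi (m *+ k) = chi m ^+ k.
    by elim: k => [|k IH]; rewrite ?mulr0n ?expr0 // mulrS exprS chiD IH.
  pose g : {rmorphism {mpoly A[r + r]} -> B} := mmap h (fun i => chi (w i)).
  have gX mu : g 'X_[mu] = chi (wt mu).
    rewrite /g /= mmapX /mmap1 /wt.
    elim/big_rec2: _ => [|i y1 y2 _ ->] //; by rewrite chiD chiMn.
  have [|h' Dh'] := @factor_through _ _ _ pi g pi_surj.
    move=> p /piI Ip.
    have -> : g p = \sum_(mu <- msupp p) h p@_mu * chi (wt mu).
      rewrite {1}[p]mpolyE rmorph_sum; apply: eq_bigr => mu _.
      by rewrite -mul_mpolyC rmorphM gX /= mmapC.
    by rewrite regroup big1 // => m _; rewrite Ip rmorph0 mul0r.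
  exists h'; split=> [a|m]; first by rewrite Dh' /= mmapC.
  by rewrite Dh' gX repK.
Qed.

End GroupAlgebra.

(** * Weights of a representation *)

Lemma gpoint_ext (k : fieldType) (G : lin_alg_group k) (A : comNzRingType)
    (f g : {rmorphism k -> A}) (M : 'M[A]_(gdim G)) :
  f =1 g -> @gpoint k G (KAlg f) M -> @gpoint k G (KAlg g) M.
Proof.
move=> fg [inv van]; split=> // P /van <-.
by apply: eq_mmap => // c; rewrite /= fg.
Qed.

Lemma gpoint_map (k : fieldType) (G : lin_alg_group k) (R S : kalg k) (h : khom R S)
    (M : 'M[R]_(gdim G)) : gpoint M -> @gpoint k G S (map_mx h M).
Proof.
case=> [[M1 inv] van]; split.
  by exists (map_mx h M1); rewrite -map_mxM inv map_mx1.
move=> P /van e0; rewrite /peval -[RHS](rmorph0 h) -e0 /peval mmap_comp.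
apply: eq_mmap => [c|i]; first by rewrite /= khomE.
by rewrite /= -map_mxvec mxE.
Qed.

Lemma gpoint1 (k : fieldType) (G : lin_alg_group k) (R : kalg k) :
  @gpoint k G R 1%:M.
Proof. by split; [exists 1%:M; rewrite mul1mx | exact: geqs1]. Qed.

Lemma gpointM (k : fieldType) (G : lin_alg_group k) (R : kalg k) (M M' : 'M[R]_(gdim G)) :
  gpoint M -> gpoint M' -> gpoint (M *m M').
Proof.
move=> [[M1 i] v] [[M1' i'] v']; split; last exact: (geqsM i i').
by exists (M1' *m M1); rewrite mulmxA -(mulmxA M) i' mulmx1 i.
Qed.

Lemma rho_ext (k : fieldType) (G : lin_alg_group k) d (rho : representation G d)
    (A : comNzRingType) (f g : {rmorphism k -> A}) (M : 'M[A]_(gdim G)) :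
  f =1 g -> @gpoint k G (KAlg f) M -> rho (KAlg f) M = rho (KAlg g) M.
Proof.
move=> fg gM.
pose h : khom (KAlg f) (KAlg g) := @KHom k (KAlg f) (KAlg g) idfun fg.
have := rho_nat rho h gM; rewrite !map_mx_id_in //.
Qed.

Section Twist.
Variables (k : fieldType) (L L' : fieldExtType k) (i : {rmorphism L -> L'}).
Hypothesis ik : forall c : k, i c%:A = c%:A.

(** Used both for the passage to a larger splitting field and, with [i] a Galois automorphism, for
    conjugation. Over k the structure map agrees with that of [R] only pointwise, hence the
    transport lemmas [gpoint_pull] and [rho_pull]. *)
Definition pull (R : kalg L') : kalg L := @KAlg L R (kmap R \o i).

Lemma pullE (R : kalg L') : kmap (restrict_scalars (pull R)) =1 kmap (restrict_scalars R).
Proof. by move=> c; rewrite /= ik. Qed.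

Lemma gpoint_pull (G : lin_alg_group k) (R : kalg L') (M : 'M[R]_(gdim G)) :
  @gpoint k G (restrict_scalars R) M <-> @gpoint k G (restrict_scalars (pull R)) M.
Proof.
by split; apply: gpoint_ext => c; rewrite /= ik.
Qed.

Lemma rho_pull (G : lin_alg_group k) d (rho : representation G d) (R : kalg L')
    (M : 'M[R]_(gdim G)) : @gpoint k G (restrict_scalars R) M ->
  rho (restrict_scalars (pull R)) M = rho (restrict_scalars R) M.
Proof.
move=> gM; symmetry.
exact: (@rho_ext k G d rho R (kmap (restrict_scalars R)) (kmap (restrict_scalars (pull R)))
         M (fun c => esym (pullE R c)) gM).
Qed.

Definition pull_hom (R S : kalg L') (h : khom R S) : khom (pull R) (pull S) :=
  @KHom L (pull R) (pull S) h (fun c => khomE h (i c)).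

Lemma diagonalizable_over_pull (G : lin_alg_group k) :
  diagonalizable_over G L -> diagonalizable_over G L'.
Proof.
case=> M [theta [fgM ch mul nat uni]].
exists M, (fun R g => theta (pull R) g); split=> //.
- by move=> R g /gpoint_pull; apply: ch.
- by move=> R g h /gpoint_pull gg /gpoint_pull gh; exact: (mul (pull R) g h gg gh).
- by move=> R S j g /gpoint_pull gg; apply: (nat _ _ (pull_hom j)).
- move=> R chi hchi; have [g [[gg gth] gu]] := uni (pull R) chi hchi.
  exists g; split; first by split=> //; apply/gpoint_pull.
  by move=> g' [/gpoint_pull gg' th']; apply: gu.
Qed.

End Twist.

Lemma coef_character_sum (M : zmodType) (A C : comNzRingType) (inc : {rmorphism A -> C})
    (e : M -> C) (coef : M -> C -> A) :
  (forall m, zmod_morphism (coef m)) ->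
  (forall m a m', coef m (inc a * e m') = if m == m' then a else 0) ->
  forall m (r : seq M) (a : M -> A), uniq r ->
    coef m (\sum_(m' <- r) inc (a m') * e m') = if m \in r then a m else 0.
Proof.
move=> coefB coefE m r a ur.
pose cm : {additive C -> A} :=
  HB.pack (coef m) (GRing.isZmodMorphism.Build C A (coef m) (coefB m)).
rewrite -[coef m]/(cm : _ -> _) raddf_sum /= big_seq.
under eq_bigr do rewrite coefE.
case: ifP => mr.
  rewrite -big_seq (bigD1_seq m) //= eqxx big1 ?addr0 // => m' ne.
  by rewrite eq_sym (negbTE ne).
rewrite big1 // => m' m'r; case: eqP => // em; by rewrite em m'r in mr.
Qed.

Section Weights.
Variables (k : fieldType) (L : fieldExtType k) (G : lin_alg_group k).
Variables (M : zmodType)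
  (theta : forall R : kalg L, 'M[restrict_scalars R]_(gdim G) -> M -> R).
Hypothesis fgM : fg_group M.
Hypothesis theta_char : forall (R : kalg L) (g : 'M[restrict_scalars R]_(gdim G)),
  gpoint g -> character_point (theta g).
Hypothesis thetaM : forall (R : kalg L) (g h : 'M[restrict_scalars R]_(gdim G)),
  gpoint g -> gpoint h -> forall m, theta (g *m h) m = theta g m * theta h m.
Hypothesis theta_nat : forall (R S : kalg L) (j : khom R S)
    (g : 'M[restrict_scalars R]_(gdim G)), gpoint g ->
  forall m, theta (R := S) (map_mx j g : 'M[restrict_scalars S]_(gdim G)) m = j (theta g m).
Hypothesis theta_uni : forall (R : kalg L) (chi : M -> R), character_point chi ->
  exists! g : 'M[restrict_scalars R]_(gdim G), gpoint g /\ forall m, theta g m = chi m.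

Definition restrict_hom (R S : kalg L) (h : khom R S) :
    khom (restrict_scalars R) (restrict_scalars S) :=
  @KHom k (restrict_scalars R) (restrict_scalars S) h (fun c => khomE h (c%:A)).

Lemma theta_inj (R : kalg L) (g g' : 'M[restrict_scalars R]_(gdim G)) :
  gpoint g -> gpoint g' -> theta g =1 theta g' -> g = g'.
Proof.
move=> gg gg' e; have [h [_ hu]] := theta_uni (theta_char gg).
by rewrite -(hu g) // -(hu g') //; split=> // m; rewrite e.
Qed.

(** D(M) over R is represented by the group algebra R[M]. The tautological point is [g], and any
    point [g'] comes from it by the map sending [e m] to [theta g' m]. *)
Lemma universal_point (R : kalg L) : exists (C : kalg L) (inc : khom R C)
    (e : M -> C) (coef : M -> C -> R) (g : 'M[restrict_scalars C]_(gdim G)),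
  [/\ gpoint g /\ (forall m, theta g m = e m),
      forall m, zmod_morphism (coef m),
      forall m a m', coef m (inc a * e m') = if m == m' then a else 0,
      forall c, exists s : seq M, uniq s /\ c = \sum_(m <- s) inc (coef m c) * e m
    & forall (S : kalg L) (h : khom R S) (g' : 'M[restrict_scalars S]_(gdim G)),
        gpoint g' -> exists h' : khom C S,
          [/\ forall a, h' (inc a) = h a, forall m, h' (e m) = theta g' m
            & map_mx h' g = g']].
Proof.
have [C [inc [e [coef [ce add coefe gen univ]]]]] := group_algebra R fgM.
pose CL : kalg L := KAlg (inc \o kmap R).
pose incL : khom R CL := @KHom L R CL inc (fun=> erefl).
have [g [[gg gth] _]] := @theta_uni CL e ce.
exists CL, incL, e, coef, g; split=> // S h g' gg'.
have [h' [h'inc h'e]] := univ S h (theta g') (theta_char gg').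
have h'k c : h' (kmap CL c) = kmap S c by rewrite /= h'inc khomE.
pose hL : khom CL S := @KHom L CL S h' h'k; exists hL; split=> //.
apply: theta_inj => //; first exact: (gpoint_map (restrict_hom hL)).
by move=> m; rewrite (theta_nat hL gg) gth /= h'e.
Qed.

Section Rep.
Variables (d : nat) (rho : representation G d).

Lemma rho_hom (R S : kalg L) (h : khom R S) (g : 'M[restrict_scalars R]_(gdim G)) :
  gpoint g -> rho (restrict_scalars S) (map_mx h g) = map_mx h (rho (restrict_scalars R) g).
Proof. exact: (rho_nat rho (restrict_hom h)). Qed.

(** At the universal point over L the entries of [rho] lie in L[M]; [q m] collects their
    coefficients at the character m, and naturality carries the expansion to every point. *)
Lemma rho_expansion : exists (s : seq M) (q : M -> 'M[L]_d), uniq s /\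
  forall (R : kalg L) (g : 'M[restrict_scalars R]_(gdim G)), gpoint g ->
    rho (restrict_scalars R) g = \sum_(m <- s) theta g m *: map_mx (kmap R) (q m).
Proof.
pose L0 : kalg L := @KAlg L L idfun.
have [C [inc [e [coef [g [[gg gth] coefB coefE gen univ]]]]]] := universal_point L0.
pose A : 'M[C]_d := rho (restrict_scalars C) g.
pose sup c := proj1_sig (constructive_indefinite_description _ (gen c)).
have supP c : uniq (sup c) /\ c = \sum_(m <- sup c) inc (coef m c) * e m.
  exact: proj2_sig (constructive_indefinite_description _ (gen c)).
pose s := undup (flatten [seq sup (A x.1 x.2) | x : 'I_d * 'I_d]).
pose q m : 'M[L]_d := @map_mx C L (coef m) d d A.
exists s, q; split; first exact: undup_uniq.
have expA : A = \sum_(m <- s) e m *: @map_mx L C inc d d (q m).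
  apply/matrixP => x y; rewrite summxE.
  have [us es] := supP (A x y).
  have sub : {subset sup (A x y) <= s}.
    move=> m mm; rewrite mem_undup; apply/flattenP; exists (sup (A x y)) => //.
    by apply/mapP; exists (x, y) => //; rewrite mem_enum.
  rewrite {1}es; under [RHS]eq_bigr do rewrite !mxE mulrC.
  rewrite [RHS](bigID (mem (sup (A x y)))) /= [X in _ + X]big1 ?addr0; last first.
    move=> m /negbTE mm; have -> : coef m (A x y) = 0; last by rewrite rmorph0 mul0r.
    by rewrite es (coef_character_sum coefB coefE) // mm.
  rewrite -[RHS]big_filter; apply: perm_big; apply: uniq_perm => //.
    by rewrite filter_uniq // undup_uniq.
  by move=> m; rewrite mem_filter; case: (boolP (m \in sup _)) => // /sub ->.
move=> R g' gg'.
pose h0 : khom L0 R := @KHom L L0 R (kmap R) (fun=> erefl).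
have [h [hinc he hg]] := univ R h0 g' gg'.
rewrite -{1}hg (rho_hom h gg) -/A expA; apply/matrixP => x y.
rewrite mxE !summxE rmorph_sum; apply: eq_bigr => m _.
by rewrite !mxE rmorphM he hinc.
Qed.

(** The value is idempotent, by multiplicativity on G, and invertible, its inverse being the value
    at [- m]. *)
Lemma theta1 (R : kalg L) m : theta (1%:M : 'M[restrict_scalars R]_(gdim G)) m = 1.
Proof.
have g1 : @gpoint k G (restrict_scalars R) 1%:M by exact: gpoint1.
have [th0 thD] := theta_char g1.
have := thetaM g1 g1 m; rewrite mulmx1 => idem.
have := thD m (- m); rewrite subrr th0; set t := theta _ m in idem *.
by move=> inv; rewrite -[t]mulr1 {1}inv mulrA -idem -inv.
Qed.

(** The decomposition of the representation into weight spaces. Orthogonality comes from two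
    independent universal points, the second over the group algebra of the first: the coefficients
    of all pairs of characters are compared in rho(g' g1) = rho(g') rho(g1). *)
Lemma rho_idempotents : exists (s : seq M) (q : M -> 'M[L]_d),
  [/\ uniq s, \sum_(m <- s) q m = 1%:M,
      {in s &, forall m n, q m *m q n = if m == n then q n else 0}
    & forall (R : kalg L) (g : 'M[restrict_scalars R]_(gdim G)), gpoint g ->
        rho (restrict_scalars R) g = \sum_(m <- s) theta g m *: map_mx (kmap R) (q m)].
Proof.
have [s [q [us expand]]] := rho_expansion; exists s, q; split=> //.
  pose L0 : kalg L := @KAlg L L idfun.
  have g1 : @gpoint k G (restrict_scalars L0) 1%:M by exact: gpoint1.
  rewrite -[RHS](rho1 rho (restrict_scalars L0)) (expand L0 _ g1).
  by apply: eq_bigr => m _; rewrite theta1 scale1r map_mx_id_in.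
pose L0 : kalg L := @KAlg L L idfun.
have [C [inc [e [coef [g [[gg gth] coefB coefE _ _]]]]]] := universal_point L0.
have [C1 [inc1 [e1 [coef1 [g1 [[gg1 gth1] coef1B coef1E _ _]]]]]] := universal_point C.
have gg' := gpoint_map (restrict_hom inc1) gg.
set g' : 'M[restrict_scalars C1]_(gdim G) := map_mx _ g in gg'.
have gth' m : theta g' m = inc1 (e m) by rewrite -gth -(theta_nat inc1 gg).
have kC1 c : kmap C1 c = inc1 (kmap C c) by rewrite khomE.
have kC c : kmap C c = inc c by rewrite khomE.
have := rhoM rho gg' gg1; rewrite !expand //; last exact: gpointM.
move=> mat m n ms ns; apply/matrixP => x y.
have /(congr1 (fun A : 'M[C1]_d => coef1 n (A x y))) := mat.
have -> : (\sum_(m <- s) theta (g' *m g1) m *: map_mx (kmap C1) (q m)) x y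
       = \sum_(m <- s) inc1 (e m * inc (q m x y)) * e1 m.
  rewrite summxE; apply: eq_bigr => m' _; rewrite thetaM // gth' gth1 !mxE kC1 kC.
  by rewrite rmorphM mulrAC.
have -> : ((\sum_(m <- s) theta g' m *: map_mx (kmap C1) (q m)) *m
           (\sum_(m <- s) theta g1 m *: map_mx (kmap C1) (q m))) x y
       = \sum_(n <- s) inc1 (\sum_(m <- s) inc ((q m *m q n) x y) * e m) * e1 n.
  rewrite mulmx_sumr summxE; apply: eq_bigr => n' _.
  rewrite gth1 -scalemxAr mxE mulrC; congr (_ * _).
  rewrite mulmx_suml summxE rmorph_sum; apply: eq_bigr => m' _.
  rewrite gth' -scalemxAl mxE -map_mxM mxE kC1 kC rmorphM mulrC //.
rewrite !(coef_character_sum coef1B coef1E) // ns => /(congr1 (coef m)).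
rewrite (coef_character_sum coefB coefE _ (fun m => (q m *m q n) x y) us) ms.
by rewrite mulrC coefE => <-; case: eqP; rewrite ?mxE.
Qed.

Variable gd : galois_data L.
Local Notation act := (@gal_act _ _ gd).
Local Notation pl s R := (pull (act s) R).

Section Idempotents.
Variables (s : seq M) (q : M -> 'M[L]_d).
Hypotheses (us : uniq s) (q1 : \sum_(m <- s) q m = 1%:M).
Hypothesis qM : {in s &, forall m n, q m *m q n = if m == n then q n else 0}.
Hypothesis expand : forall (R : kalg L) (g : 'M[restrict_scalars R]_(gdim G)), gpoint g ->
  rho (restrict_scalars R) g = \sum_(m <- s) theta g m *: map_mx (kmap R) (q m).

Lemma rho_mul_idempotent (R : kalg L) (g : 'M[restrict_scalars R]_(gdim G)) n :
  gpoint g -> n \in s ->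
  rho (restrict_scalars R) g *m map_mx (kmap R) (q n)
    = theta g n *: map_mx (kmap R) (q n) /\
  map_mx (kmap R) (q n) *m rho (restrict_scalars R) g
    = theta g n *: map_mx (kmap R) (q n).
Proof.
move=> gg ns; rewrite expand //; split.
  rewrite mulmx_suml (bigD1_seq n) //= -scalemxAl -map_mxM qM // eqxx.
  rewrite big_seq_cond big1 ?addr0 // => m /andP [ms ne].
  by rewrite -scalemxAl -map_mxM qM // (negbTE ne) map_mx0 scaler0.
rewrite mulmx_sumr (bigD1_seq n) //= -scalemxAr -map_mxM qM // eqxx.
rewrite big_seq_cond big1 ?addr0 // => m /andP [ms ne].
by rewrite -scalemxAr -map_mxM qM // eq_sym (negbTE ne) map_mx0 scaler0.
Qed.

(* For the universal point g, the character n twisted by t must agree with     *)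
(* some e n': compare the two actions on q n' *m (q n)^t, nonzero for some n'. *)
Lemma twisted_weight (t : gal_group gd) n : n \in s -> q n != 0 ->
  exists n', forall (R : kalg L) (g : 'M[restrict_scalars R]_(gdim G)), gpoint g ->
    @theta (pl t R) g n = theta g n'.
Proof.
move=> ns qn0.
pose L0 : kalg L := @KAlg L L idfun.
have [C [inc [e [coef [g [[gg gth] coefB coefE _ univ]]]]]] := universal_point L0.
have kC c : kmap C c = inc c by rewrite khomE.
have ggt : @gpoint k G (restrict_scalars (pl t C)) g.
  exact: (proj1 (gpoint_pull (gal_actk t) _) gg).
have [n' n's ne0] : exists2 n', n' \in s & q n' *m map_mx (act t) (q n) != 0.
  apply: NNPP => no; case/negP: qn0.
  rewrite -(map_mx_eq0 (act t)) -[map_mx _ _]mul1mx -q1 mulmx_suml.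
  rewrite big_seq big1 // => m ms; apply/eqP/negPn/negP => ne; apply: no.
  by exists m.
exists n'.
set c := @theta (pl t C) g n.
have rr : rho (restrict_scalars (pl t C)) g = rho (restrict_scalars C) g.
  exact: (rho_pull (gal_actk t) rho gg).
have [tw _] := rho_mul_idempotent ggt ns.
rewrite rr -/c in tw.
have [_ un] := rho_mul_idempotent gg n's.
have /matrix0Pn [x [y a0]] := ne0.
set a := (_ *m _) x y in a0.
have ce : c * inc a = e n' * inc a.
  have := congr1 (fun A : 'M[C]_d => map_mx (kmap C) (q n') *m A) tw.
  rewrite /= mulmxA un gth -scalemxAl -scalemxAr.
  have -> : map_mx (kmap (pl t C)) (q n) = map_mx (kmap C) (map_mx (act t) (q n)).
    by apply/matrixP => i j; rewrite !mxE.
  rewrite -map_mxM => /(congr1 (fun A : 'M[C]_d => A x y)).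
  have sc (z : C) (B : 'M[C]_d) : (z *: B) x y = z * B x y by rewrite mxE.
  have mp (B : 'M[L]_d) : (map_mx (kmap C) B) x y = inc (B x y) by rewrite mxE kC.
  by rewrite !sc !mp => ->.
(* The entry [a] is a nonzero element of the field L, so its image in C is invertible and
   cancels. *)
have {}ce : c = e n'.
  have inva : inc a * inc a^-1 = 1 by rewrite -rmorphM divff // rmorph1.
  by rewrite -[c]mulr1 -inva mulrA ce -mulrA inva mulr1.
move=> R g' gg'.
pose h0 : khom L0 R := @KHom L L0 R (kmap R) (fun=> erefl).
have [h [hinc he hg]] := univ R h0 g' gg'.
rewrite -{1}hg (theta_nat (pull_hom (act t) h) ggt) -/c ce; exact: he.
Qed.

End Idempotents.

(* The l_i span but need not be independent: taking all conjugates of the rows *)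
(* of the projectors makes the Galois group permute them strictly, and an      *)
(* element of trace 1 provides the u_i with sum u_i l_i = 1.                   *)
Lemma weight_system : exists (N : nat) (a : gal_group gd -> 'I_N -> 'I_N)
    (l : 'I_N -> 'rV[L]_d) (u : 'I_N -> 'cV[L]_d) (wt : 'I_N -> M),
  [/\ forall t, bijective (a t),
      forall t i, l (a t i) = map_mx (act t) (l i) /\ u (a t i) = map_mx (act t) (u i),
      forall i, l i != 0,
      \sum_i u i *m l i = 1%:M
    & forall (R : kalg L) (g : 'M[restrict_scalars R]_(gdim G)) i, gpoint g ->
        map_mx (kmap R) (l i) *m rho (restrict_scalars R) g
          = theta g (wt i) *: map_mx (kmap R) (l i) /\
        rho (restrict_scalars R) g *m map_mx (kmap R) (u i)
          = theta g (wt i) *: map_mx (kmap R) (u i)].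
Proof.
have [s [q [us q1 qM expand]]] := rho_idempotents.
have [c tc] := gal_act_trace gd.
pose w (x : 'I_(size s)) : M := tnth (in_tuple s) x.
have ws x : w x \in s by exact: mem_tnth.
(* Indices will be pairs of a Galois element and a nonzero row of a projector. Galois translates the
   first component, so it acts by permutations even when conjugate rows coincide. *)
pose P : {pred 'I_(size s) * 'I_d} := [pred x | row x.2 (q (w x.1)) != 0].
pose J := {x | x \in P}.
pose I := (gal_group gd * J)%type.
pose lI (i : I) : 'rV[L]_d := map_mx (act i.1) (row (val i.2).2 (q (w (val i.2).1))).
pose uI (i : I) : 'cV[L]_d := map_mx (act i.1) (c *: col (val i.2).2 (q (w (val i.2).1))).
pose aI t (i : I) : I := ((i.1 * t)%g, i.2).
have q0 (j : J) : q (w (val j).1) != 0.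
  by have := valP j; rewrite inE; apply: contraNneq => ->; rewrite row0.
have wtI_ex (i : I) := twisted_weight us q1 qM expand i.1 (ws (val i.2).1) (q0 i.2).
pose wtI i := proj1_sig (constructive_indefinite_description _ (wtI_ex i)).
have wtIP i (R : kalg L) (g : 'M[restrict_scalars R]_(gdim G)) : gpoint g ->
    @theta (pl i.1 R) g (w (val i.2).1) = theta g (wtI i).
  exact: (proj2_sig (constructive_indefinite_description _ (wtI_ex i))).
have wtl (R : kalg L) (g : 'M[restrict_scalars R]_(gdim G)) i : gpoint g ->
    map_mx (kmap R) (lI i) *m rho (restrict_scalars R) g
      = theta g (wtI i) *: map_mx (kmap R) (lI i) /\
    rho (restrict_scalars R) g *m map_mx (kmap R) (uI i)
      = theta g (wtI i) *: map_mx (kmap R) (uI i).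
  move=> gg; have ggt : @gpoint k G (restrict_scalars (pl i.1 R)) g.
    by exact: (proj1 (gpoint_pull (gal_actk i.1) _) gg).
  have rr : rho (restrict_scalars (pl i.1 R)) g = rho (restrict_scalars R) g.
    exact: (rho_pull (gal_actk i.1) rho gg).
  have [] := rho_mul_idempotent us qM expand ggt (ws (val i.2).1).
  rewrite rr wtIP // => e1 e2; split.
    have -> : map_mx (kmap R) (lI i)
            = row (val i.2).2 (map_mx (kmap (pl i.1 R)) (q (w (val i.2).1))).
      by apply/matrixP => x y; rewrite !mxE.
    by rewrite -row_mul e2; apply/matrixP => x y; rewrite !mxE.
  have -> : map_mx (kmap R) (uI i) = kmap R (act i.1 c) *:
      col (val i.2).2 (map_mx (kmap (pl i.1 R)) (q (w (val i.2).1))).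
    by apply/matrixP => x y; rewrite !mxE !rmorphM.
  have colM (A B : 'M[R]_d) j : A *m col j B = col j (A *m B).
    by apply/matrixP => x y; rewrite !mxE; apply: eq_bigr => z _; rewrite mxE.
  rewrite -scalemxAr colM e1; apply/matrixP => x y; rewrite !mxE.
  by rewrite mulrCA.
exists #|{: I}|, (fun t i => enum_rank (aI t (enum_val i))), (fun i => lI (enum_val i)),
  (fun i => uI (enum_val i)), (fun i => wtI (enum_val i)); split.
- move=> t; exists (fun i => enum_rank (aI t^-1%g (enum_val i))) => i.
    by rewrite enum_rankK /aI /= mulgK -surjective_pairing enum_valK.
  by rewrite enum_rankK /aI /= mulgKV -surjective_pairing enum_valK.
- move=> t i; rewrite enum_rankK; split; apply/matrixP => x y; rewrite !mxE gal_actM //.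
- by move=> i; rewrite map_mx_eq0; have := valP (enum_val i).2; rewrite inE.
- rewrite (reindex (@enum_rank I)) /=; last exact: onW_bij (enum_rank_bij _).
  transitivity (\sum_(t : gal_group gd) \sum_(j : J) uI (t, j) *m lI (t, j)).
    by rewrite pair_big /=; apply: eq_bigr => -[t j] _; rewrite enum_rankK.
  transitivity (\sum_(t : gal_group gd) (act t c)%:M : 'M[L]_d); last first.
    by rewrite -raddf_sum tc.
  apply: eq_bigr => t _.
  transitivity (map_mx (act t) (c *: \sum_(j : J)
      col (val j).2 (q (w (val j).1)) *m row (val j).2 (q (w (val j).1)))).
    have map_sum (F : J -> 'M[L]_d) :
        map_mx (act t) (\sum_j F j) = \sum_j map_mx (act t) (F j) by exact: raddf_sum.
    rewrite scaler_sumr map_sum; apply: eq_bigr => j _.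
    by rewrite scalemxAl map_mxM.
  rewrite -map_scalar_mx; congr map_mx.
  transitivity (c *: (1%:M : 'M[L]_d)); last by rewrite scalemx1.
  congr (_ *: _).
  (* For one projector [q], the products of columns by rows add up to [q *m q = q]; the zero rows
     left out of [J] contribute nothing. *)
  pose F x := col x.2 (q (w x.1)) *m row x.2 (q (w x.1)).
  rewrite -[LHS]/(\sum_(j : J) F (val j)).
  rewrite -(big_sub P F) big_mkcond /= (eq_bigr F); last first.
    by move=> x _; rewrite inE; case: eqP => //= r0; rewrite /F r0 mulmx0.
  rewrite -(pair_bigA _ (fun x y => F (x, y))) /= -q1 (big_tnth _ _ s).
  apply: eq_bigr => x _; have := qM _ _ (ws x) (ws x); rewrite eqxx => e.
  rewrite -[RHS]e; apply/matrixP => i j; rewrite summxE [RHS]mxE.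
  by apply: eq_bigr => y _; rewrite /F mxE big_ord1 !mxE.
- by move=> R g i; apply: wtl.
Qed.

End Rep.
End Weights.

(** * Norms and factorizations through affine space *)

Section TensorCoordinates.
Variables (k : fieldType) (L : fieldExtType k) (gd : galois_data L).
Local Notation act := (@gal_act _ _ gd).

Definition ldim := \dim {:L}.
Definition lbasis (j : 'I_ldim) : L := (vbasis {:L})`_j.
Definition lcoord (j : 'I_ldim) (x : L) : k := coord (vbasis {:L}) j x.

Lemma lcoordE x : x = \sum_j lcoord j x *: lbasis j.
Proof. exact: (coord_vbasis (memvf x)). Qed.

Lemma lcoord_unique (c : 'I_ldim -> k) j : lcoord j (\sum_i c i *: lbasis i) = c j.
Proof. by rewrite /lcoord coord_sum_free // (basis_free (vbasisP _)). Qed.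

Variables (K : comNzRingType) (kK : {rmorphism k -> K}).

(* An element of K (x)_k L is given by its coordinates x : 'I_ldim -> K in the *)
(* basis lbasis of L; tensor_value is its image in a common extension R.       *)
Definition tensor_one (l : 'I_ldim) : K := kK (lcoord l 1).
Definition tensor_mul (x y : 'I_ldim -> K) (l : 'I_ldim) : K :=
  \sum_i \sum_j x i * y j * kK (lcoord l (lbasis i * lbasis j)).
Definition tensor_act t (x : 'I_ldim -> K) (l : 'I_ldim) : K :=
  \sum_j x j * kK (lcoord l (act t (lbasis j))).

Section Value.
Variables (R : comNzRingType) (jK : {rmorphism K -> R}) (jL : {rmorphism L -> R}).
Hypothesis compat : forall c : k, jK (kK c) = jL c%:A.

Definition tensor_value (x : 'I_ldim -> K) : R := \sum_j jK (x j) * jL (lbasis j).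

Let expand (x : L) : \sum_l jK (kK (lcoord l x)) * jL (lbasis l) = jL x.
Proof.
rewrite {2}[x]lcoordE rmorph_sum; apply: eq_bigr => l _.
by rewrite -mulr_algl rmorphM compat.
Qed.

Lemma tensor_value1 : tensor_value tensor_one = 1.
Proof. by rewrite /tensor_value expand rmorph1. Qed.

Lemma tensor_valueM x y :
  tensor_value (tensor_mul x y) = tensor_value x * tensor_value y.
Proof.
rewrite /tensor_value big_distrlr /=.
transitivity (\sum_l \sum_i \sum_j jK (x i) * jK (y j) *
   (jK (kK (lcoord l (lbasis i * lbasis j))) * jL (lbasis l))).
  apply: eq_bigr => l _; rewrite rmorph_sum mulr_suml; apply: eq_bigr => i _.
  by rewrite rmorph_sum mulr_suml; apply: eq_bigr => j _; rewrite !rmorphM mulrA.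
rewrite exchange_big; apply: eq_bigr => i _ /=.
rewrite exchange_big; apply: eq_bigr => j _ /=.
by rewrite -mulr_sumr expand rmorphM mulrACA.
Qed.

Lemma tensor_value_act t x :
  tensor_value (tensor_act t x) = \sum_j jK (x j) * jL (act t (lbasis j)).
Proof.
rewrite /tensor_value.
transitivity (\sum_l \sum_j jK (x j) *
   (jK (kK (lcoord l (act t (lbasis j)))) * jL (lbasis l))).
  apply: eq_bigr => l _; rewrite rmorph_sum mulr_suml.
  by apply: eq_bigr => j _; rewrite !rmorphM mulrA.
by rewrite exchange_big; apply: eq_bigr => j _ /=; rewrite -mulr_sumr expand.
Qed.

End Value.
End TensorCoordinates.

(** * Norms of polynomial values as polynomials in matrix entries *)

Section Norm.
Variables (L : comNzRingType) (n e0 w : nat).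
Local Notation e := e0.+1.
Local Notation N := (e * e + n * w)%N.

(* The e * e + n * w variables are the entries of a matrix Z of size e and     *)
(* coefficients q_il (i < n, l < w); norm_poly p is the determinant of p at    *)
(* the commuting matrices sum_l q_il Z^l.  When Z is multiplication by a       *)
(* generator a of an extension of degree e, this is the norm of p at the point *)
(* with coordinates sum_l q_il a^l.                                            *)
Definition var_mx (B : comNzRingType) (v : 'I_N -> B) : 'M[B]_e :=
  \matrix_(x, y) v (lshift _ (mxvec_index x y)).
Definition var_poly (B : comNzRingType) (v : 'I_N -> B) (i : 'I_n) : {poly B} :=
  \sum_(l < w) (v (rshift _ (mxvec_index i l)))%:P * 'X^l.

(** Evaluation passes through the commutative ring B[Z] before Z becomes a matrix, because
    polynomials with several variables need commuting arguments. *)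
Definition eval_mx (B : comNzRingType) (jL : {rmorphism L -> B}) (v : 'I_N -> B) :
    {mpoly L[n]} -> 'M[B]_e :=
  horner_mx (var_mx v) \o mmap (@polyC B \o jL) (var_poly v).

Definition norm_poly (p : {mpoly L[n]}) : {mpoly L[N]} :=
  \det (eval_mx (@mpolyC N L) (fun i => 'X_i) p).

Lemma norm_polyM p q : norm_poly (p * q) = norm_poly p * norm_poly q.
Proof. by rewrite /norm_poly /eval_mx /= !rmorphM -det_mulmx. Qed.

Lemma map_eval_mx (B C : comNzRingType) (jL : {rmorphism L -> B}) (h : {rmorphism B -> C})
    (v : 'I_N -> B) p :
  map_mx h (eval_mx jL v p) = eval_mx (h \o jL) (h \o v) p.
Proof.
rewrite /eval_mx /= map_horner_mx; congr (horner_mx _ _).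
  by apply/matrixP => x y; rewrite !mxE.
rewrite mmap_comp; apply: eq_mmap => [c|i] /=; first by rewrite map_polyC.
rewrite rmorph_sum; apply: eq_bigr => l _.
by rewrite rmorphM /= map_polyC map_polyXn.
Qed.

Lemma mmap_norm_poly (B : comNzRingType) (jL : {rmorphism L -> B}) (v : 'I_N -> B) p :
  mmap jL v (norm_poly p) = \det (eval_mx jL v p).
Proof.
rewrite /norm_poly -det_map_mx map_eval_mx; congr (\det _).
rewrite /eval_mx /=; congr (horner_mx _ _).
  by apply/matrixP => x y; rewrite !mxE /= mmapX mmap1U.
apply: eq_mmap => [c|i] /=; first by rewrite mmapC.
by apply: eq_bigr => l _ /=; rewrite mmapX mmap1U.
Qed.

(** The generic matrix and the generic coefficients are variables, fixed by [s]; only the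
    coefficients of [p] are moved. *)
Lemma norm_poly_map (s : {rmorphism L -> L}) p :
  map_mpoly s (norm_poly p) = norm_poly (map_mpoly s p).
Proof.
rewrite /norm_poly -det_map_mx map_eval_mx.
have e1 : var_mx (map_mpoly s \o (fun i => 'X_i)) = var_mx (fun i => 'X_i : {mpoly L[N]}).
  by apply/matrixP => x y; rewrite !mxE /= map_mpolyX.
have e2 : mmap (@polyC _ \o (map_mpoly s \o @mpolyC N L))
      (var_poly (map_mpoly s \o (fun i => 'X_i))) p
    = mmap (@polyC _ \o @mpolyC N L) (var_poly (fun i => 'X_i)) (map_mpoly s p).
  rewrite mmap_map_mpoly; apply: eq_mmap => [c|i] /=; first by rewrite map_mpolyC.
  by apply: eq_bigr => l _ /=; rewrite map_mpolyX.
by rewrite /eval_mx; apply: congr1; rewrite [LHS]/= e1 e2.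
Qed.

End Norm.

Global Opaque norm_poly.

(** * The subgroup of exponents for which the torus point factors *)

Section PowerFactors.
Variables (k : fieldType) (L : fieldExtType k) (gd : galois_data L).
Local Notation act := (@gal_act _ _ gd).
Variables (K : fieldType) (kK : {rmorphism k -> K}).
Variables (Lam : zmodType) (aL : gal_group gd -> Lam -> Lam) (M0 : Lam -> Prop).
Variable kap : Lam -> 'I_(ldim L) -> K.
Hypothesis aLB : forall t, zmod_morphism (aL t).
Hypothesis M00 : M0 0.
Hypothesis M0B : forall m m', M0 m -> M0 m' -> M0 (m - m').
Hypothesis kap0 : kap 0 =1 tensor_one kK.
Hypothesis kapD : forall m m', M0 m -> M0 m' ->
  kap (m + m') =1 tensor_mul kK (kap m) (kap m').

Let M0N m : M0 m -> M0 (- m).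
Proof. by move=> h; rewrite -[- m]add0r; apply: M0B. Qed.

Let M0D m m' : M0 m -> M0 m' -> M0 (m + m').
Proof. by move=> h h'; rewrite -[m']opprK; apply: M0B => //; apply: M0N. Qed.

Let M0Mz m (z : int) : M0 m -> M0 (m *~ z).
Proof.
have M0n n : M0 m -> M0 (m *+ n).
  by move=> h; elim: n => [|n IH]; rewrite ?mulr0n // mulrS; apply: M0D.
by move=> h; case: z => z; [apply: M0n | apply/M0N/M0n].
Qed.

Definition compatible (A : nzRingType) (kA : {rmorphism k -> A}) (R : nzRingType)
    (jA : {rmorphism A -> R}) (jL : {rmorphism L -> R}) :=
  forall c : k, jA (kA c) = jL c%:A.

Definition character_value (R : comNzRingType) (jK : {rmorphism K -> R})
    (jL : {rmorphism L -> R}) m :=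
  tensor_value jK jL (kap m).

Section CharacterValue.
Variables (R : comNzRingType) (jK : {rmorphism K -> R}) (jL : {rmorphism L -> R}).
Hypothesis compat : compatible kK jK jL.

Lemma character_value0 : character_value jK jL 0 = 1.
Proof.
rewrite -(tensor_value1 compat) /character_value /tensor_value.
by apply: eq_bigr => l _; rewrite kap0.
Qed.

Lemma character_valueD m m' : M0 m -> M0 m' ->
  character_value jK jL (m + m') = character_value jK jL m * character_value jK jL m'.
Proof.
move=> h h'; rewrite -(tensor_valueM compat) /character_value /tensor_value.
by apply: eq_bigr => l _; rewrite kapD.
Qed.

Lemma character_valueMn m e : M0 m -> character_value jK jL (m *+ e) = character_value jK jL m ^+ e.
Proof.
move=> h; elim: e => [|e IH]; first by rewrite mulr0n character_value0 expr0.
rewrite mulrS exprS character_valueD ?IH //.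
exact: (M0Mz e%:Z).
Qed.

End CharacterValue.

(* The characters m of T pull back to P m / Q m on A^n, Galois equivariantly,  *)
(* and take the value t^D(m) at s, where t(m) in K (x) L has coordinates       *)
(* kap m.  Testing the value in all rings R, rather than in one common field   *)
(* extension of E and L, is what allows evaluating in the subring generated    *)
(* by a matrix when taking norms.                                              *)
Definition power_factors (E : fieldType) (iE : {rmorphism K -> E}) (D : int) : Prop :=
  exists (n : nat) (s : 'I_n -> E) (P Q : Lam -> {mpoly L[n]}),
  [/\ forall m m', M0 m -> M0 m' ->
        P (m + m') * (Q m * Q m') = P m * P m' * Q (m + m'),
      forall t m, M0 m ->
        map_mpoly (act t) (P m) * Q (aL t m) = P (aL t m) * map_mpoly (act t) (Q m)
    & forall (R : comNzRingType) (jE : {rmorphism E -> R}) (jL : {rmorphism L -> R}),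
        compatible (iE \o kK) jE jL -> forall m, M0 m ->
        invertible (mmap jL (jE \o s) (Q m)) /\
        mmap jL (jE \o s) (P m) = character_value (jE \o iE) jL (m *~ D) * mmap jL (jE \o s) (Q m)].

Lemma power_factors_ext (E : fieldType) (iE iE' : {rmorphism K -> E}) D :
  iE =1 iE' -> power_factors iE D -> power_factors iE' D.
Proof.
move=> ee [n [s [P [Q [h1 h2 h3]]]]]; exists n, s, P, Q; split=> // R jE jL c m Mm.
have [|q ->] := h3 R jE jL _ m Mm; first by move=> x; rewrite -c /= ee.
split=> //; congr (_ * _); apply: eq_bigr => j _; by rewrite /= ee.
Qed.

(** Inversion in the torus: each character is replaced by its opposite. *)
Lemma power_factorsN (E : fieldType) (iE : {rmorphism K -> E}) D :
  power_factors iE D -> power_factors iE (- D).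
Proof.
move=> [n [s [P [Q [h1 h2 h3]]]]]; exists n, s, (fun m => P (- m)), (fun m => Q (- m)).
split.
- by move=> m m' h h'; rewrite opprD; apply: h1; apply: M0N.
- move=> t m h; have -> : - aL t m = aL t (- m).
    have a0 : aL t 0 = 0 by rewrite -[in LHS](subrr 0) aLB subrr.
    by rewrite -[in RHS](sub0r m) aLB a0 sub0r.
  by apply: h2; apply: M0N.
- move=> R jE jL c m h; have := h3 R jE jL c (- m) (M0N h).
  by rewrite mulNrz -mulrNz.
Qed.

(** The two factorizations are put on disjoint sets of variables, by [wl] and [wr], and multiplied
    in the torus; the point of A^(n1 + n2) is the pair of the given points. *)
Lemma power_factorsD (E : fieldType) (iE : {rmorphism K -> E}) D1 D2 :
  power_factors iE D1 -> power_factors iE D2 -> power_factors iE (D1 + D2).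
Proof.
move=> [n1 [s1 [P1 [Q1 [h11 h12 h13]]]]] [n2 [s2 [P2 [Q2 [h21 h22 h23]]]]].
have perm6 (A : comNzRingType) (x x' y y' z z' : A) :
  x * x' * (y * y' * (z * z')) = x * (y * z) * (x' * (y' * z')).
  by rewrite (mulrACA y) [LHS]mulrACA.
pose s i := match split i with inl j => s1 j | inr j => s2 j end.
have [wl [wl_map evl]] : exists wl : {rmorphism {mpoly L[n1]} -> {mpoly L[n1 + n2]}},
    (forall t p, map_mpoly (act t) (wl p) = wl (map_mpoly (act t) p)) /\
    forall (R : comNzRingType) (jE : {rmorphism E -> R}) (jL : {rmorphism L -> R}) p,
      mmap jL (jE \o s) (wl p) = mmap jL (jE \o s1) p.
  exists (mmap (@mpolyC _ L) (fun i => 'X_(lshift n2 i))); split=> [t p|R jE jL p] /=.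
    rewrite mmap_comp mmap_map_mpoly; apply: eq_mmap => [c|i] /=; first exact: map_mpolyC.
    by rewrite map_mpolyX.
  rewrite mmap_comp; apply: eq_mmap => [x|i] /=; first by rewrite mmapC.
  by rewrite mmapX mmap1U /= /s (unsplitK (inl _)).
have [wr [wr_map evr]] : exists wr : {rmorphism {mpoly L[n2]} -> {mpoly L[n1 + n2]}},
    (forall t p, map_mpoly (act t) (wr p) = wr (map_mpoly (act t) p)) /\
    forall (R : comNzRingType) (jE : {rmorphism E -> R}) (jL : {rmorphism L -> R}) p,
      mmap jL (jE \o s) (wr p) = mmap jL (jE \o s2) p.
  exists (mmap (@mpolyC _ L) (fun i => 'X_(rshift n1 i))); split=> [t p|R jE jL p] /=.
    rewrite mmap_comp mmap_map_mpoly; apply: eq_mmap => [c|i] /=; first exact: map_mpolyC.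
    by rewrite map_mpolyX.
  rewrite mmap_comp; apply: eq_mmap => [x|i] /=; first by rewrite mmapC.
  by rewrite mmapX mmap1U /= /s (unsplitK (inr _)).
have w_map t p q : map_mpoly (act t) (wl p * wr q)
    = wl (map_mpoly (act t) p) * wr (map_mpoly (act t) q).
  by rewrite -wl_map -wr_map; exact: rmorphM.
exists (n1 + n2)%N, s, (fun m => wl (P1 m) * wr (P2 m)), (fun m => wl (Q1 m) * wr (Q2 m)).
split.
- move=> m m' h h'.
  have := congr1 wl (h11 m m' h h'); have := congr1 wr (h21 m m' h h').
  rewrite !(rmorphM wr) !(rmorphM wl) => e2 e1.
  apply: etrans (perm6 _ _ _ _ _ _ _) _; rewrite e1 e2.
  by apply: etrans (mulrACA _ _ _ _) _; congr (_ * _); apply: mulrACA.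
- move=> t m h.
  have := congr1 wl (h12 t m h); have := congr1 wr (h22 t m h).
  rewrite !(rmorphM wr) !(rmorphM wl) !w_map => e2 e1.
  apply: etrans (mulrACA _ _ _ _) _; rewrite e1 e2; exact: mulrACA.
- move=> R jE jL c m h.
  have [[r1 e1] q1] := h13 R jE jL c m h; have [[r2 e2] q2] := h23 R jE jL c m h.
  have evM p q : mmap jL (jE \o s) (wl p * wr q)
      = mmap jL (jE \o s1) p * mmap jL (jE \o s2) q.
    by rewrite -evl -evr; exact: rmorphM.
  rewrite !evM; split.
    by exists (r1 * r2); apply: etrans (mulrACA _ _ _ _) _; rewrite e1 e2 mulr1.
  have tD : character_value (jE \o iE) jL (m *~ (D1 + D2))
          = character_value (jE \o iE) jL (m *~ D1) * character_value (jE \o iE) jL (m *~ D2).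
    by rewrite mulrzDr character_valueD //; exact: M0Mz.
  by rewrite q1 q2 tD; apply: mulrACA.
Qed.

(** A subgroup of Z is generated by its least positive element [d0]. A prime factor of [d0] would
    divide all admissible exponents, against the hypothesis; hence [d0] is 1. *)
Lemma power_factors_bezout (E : fieldType) (iE : {rmorphism K -> E}) :
  (forall p, prime p -> exists D : nat, power_factors iE D /\ ~~ (p %| D)%N) -> power_factors iE 1.
Proof.
move=> hp.
have factorsMn D e : power_factors iE D -> power_factors iE (D * e.+1%:Z).
  move=> h; elim: e => [|e IH]; first by rewrite mulr1.
  by rewrite -addn1 PoszD mulrDr mulr1; apply: power_factorsD.
pose S (d : nat) :=
  (0 < d)%N && (if excluded_middle_informative (power_factors iE d) then true else false).
have SP d : reflect ((0 < d)%N /\ power_factors iE d) (S d).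
  rewrite /S; case: excluded_middle_informative => h; rewrite ?andbT ?andbF.
    by apply: (iffP idP) => [|[]].
  by constructor; case.
(* The prime 2 only serves to produce a positive element: an exponent not divisible by 2 is
   nonzero. *)
have exS : exists d, S d.
  have [D [gD nD]] := hp 2%N isT; exists D; apply/SP; split=> //.
  by rewrite lt0n; apply: contraNneq nD => ->.
case: (ex_minnP exS) => d0 /SP [d0_gt0 gd0] dmin.
have [d01|d01] := leqP d0 1.
  have e : d0 = 1%N by apply/eqP; rewrite eqn_leq d01 d0_gt0.
  by rewrite e in gd0.
have [D [gD nD]] := hp _ (pdiv_prime d01).
have nd : ~~ (d0 %| D)%N by apply: contra nD; apply: dvdn_trans; apply: pdiv_dvd.
have : S (D %% d0)%N.
  apply/SP; split; first by rewrite lt0n.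
  have -> : (D %% d0)%N%:Z = D%:Z - d0%:Z * (D %/ d0)%N%:Z.
    by rewrite {2}(divn_eq D d0) PoszD PoszM mulrC addrAC subrr add0r.
  case: (D %/ d0)%N => [|q]; first by rewrite mulr0 subr0.
  by apply: power_factorsD => //; apply/power_factorsN/factorsMn.
by move/dmin; rewrite leqNgt ltn_mod d0_gt0.
Qed.

Section Step.
Variables (E' E : fieldType) (iE' : {rmorphism K -> E'}) (j : {rmorphism E' -> E}) (e0 : nat).
Local Notation e := e0.+1.
Variables (mu : {rmorphism E -> 'M[E']_e}) (a : E).
Hypothesis mu_scalar : forall c, mu (j c) = c%:M.
Hypothesis gen : forall x, exists q, x = (map_poly j q).[a].

(** The norm of a torus point. Writing [s i] as a polynomial [q i] in [a], the determinant of [P m]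
    at [s] is the value of [norm_poly] at the E'-point [s'], made of the entries of [mu a] and the
    coefficients of the [q i]. The characters of t^D are already defined before the extension, so
    the norm raises them to the power e. *)
Lemma power_factors_step D : power_factors (j \o iE') D -> power_factors iE' (D * e).
Proof.
move=> [n [s [P [Q [h1 h2 h3]]]]].
pose q i := proj1_sig (constructive_indefinite_description _ (gen (s i))).
have qP i : s i = (map_poly j (q i)).[a].
  exact: proj2_sig (constructive_indefinite_description _ (gen (s i))).
pose w := \max_i size (q i).
have szq i : (size (q i) <= w)%N by exact: leq_bigmax.
pose N := (e * e + n * w)%N.
pose vmx (z : 'I_(e * e)) : E' := mxvec (mu a) 0 z.
pose vq (z : 'I_(n * w)) : E' := mxvec (\matrix_(i < n, l < w) (q i)`_l) 0 z.
pose s' (z : 'I_N) : E' := match split z with inl x => vmx x | inr y => vq y end.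
exists N, s', (fun m => norm_poly e0 w (P m)), (fun m => norm_poly e0 w (Q m)).
split.
- move=> m m' h h'; have := congr1 (norm_poly e0 w) (h1 m m' h h').
  by rewrite !norm_polyM.
- move=> t m h; have := congr1 (norm_poly e0 w) (h2 t m h).
  by rewrite !norm_polyM -!norm_poly_map.
- move=> R jE' jL c m h.
  have evN p : mmap jL (jE' \o s') (norm_poly e0 w p) = \det (eval_mx jL (jE' \o s') p).
    exact: mmap_norm_poly.
  rewrite /invertible.
  suff: (exists y, \det (eval_mx jL (jE' \o s') (Q m)) * y = 1) /\
     \det (eval_mx jL (jE' \o s') (P m)) =
      character_value (jE' \o iE') jL (m *~ (D * e)) * \det (eval_mx jL (jE' \o s') (Q m)).
    by rewrite -!evN.
  pose Z : 'M[R]_e := map_mx jE' (mu a).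
  pose hZ : {rmorphism {poly R} -> 'M[R]_e} := horner_mx Z.
  (* C = R[Z] is commutative although M_e(R) is not, and receives E. *)
  pose I (f : {poly R}) := hZ f = 0.
  have [C [pi [piI pi_surj]]] : exists (C : comNzRingType) (pi : {rmorphism {poly R} -> C}),
      (forall f, pi f = 0 <-> I f) /\ forall c, exists f, c = pi f.
    apply: quotient_ring => [|f g If Ig|f g Ig|].
    - exact: rmorph0.
    - by rewrite /I rmorphD If Ig addr0.
    - by rewrite /I rmorphM Ig mulr0.
    - by rewrite /I rmorph1 => /eqP; rewrite oner_eq0.
  have [i ipi] := factor_through pi_surj (fun f => proj1 (piI f)).
  have i_inj : injective i.
    move=> x y; have [f ->] := pi_surj x; have [g ->] := pi_surj y.
    rewrite !ipi => e; apply/eqP; rewrite -subr_eq0 -rmorphB.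
    by apply/eqP/piI; rewrite /I rmorphB e subrr.
  pose mE : {rmorphism E -> 'M[R]_e} := map_mx jE' \o mu.
  have mE_gen (g : {poly E'}) : mE (map_poly j g).[a] = hZ (map_poly jE' g).
    rewrite /mE /hZ /Z /= -map_horner_mx; congr map_mx.
    elim/poly_ind: g => [|g b IH]; first by rewrite !rmorph0 horner0 rmorph0.
    rewrite rmorphD rmorphM /= map_polyX map_polyC hornerMXaddC rmorphD rmorphM /=.
    rewrite IH mu_scalar (rmorphD (horner_mx _)) (rmorphM (horner_mx _)) /= horner_mx_X.
    by congr (_ + _); symmetry; exact: horner_mx_C.
  have [x|jE jEP] := lift_to_subring (h := mE) i_inj.
    by have [g ->] := gen x; exists (pi (map_poly jE' g)); rewrite ipi mE_gen.
  pose jC : {rmorphism L -> C} := pi \o @polyC R \o jL.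
  have i_jC x : i (jC x) = (jL x)%:M by rewrite /jC /= ipi; exact: horner_mx_C.
  have i_jE x : i (jE (j x)) = (jE' x)%:M by rewrite jEP /mE /= mu_scalar map_scalar_mx.
  have compC : compatible ((j \o iE') \o kK) jE jC.
    by move=> x; apply: i_inj; rewrite i_jC /= i_jE (c x).
  have [[r Qr] PQ] := h3 C jE jC compC m h.
  have ev p : i (mmap jC (jE \o s) p) = eval_mx jL (jE' \o s') p.
    have := @mpoly_rmorphism_eq n L _ (i \o mmap jC (jE \o s)) (eval_mx jL (jE' \o s')).
    apply=> [x|z].
      by rewrite /eval_mx /= !mmapC i_jC /= horner_mx_C.
    rewrite /eval_mx /= !mmapX !mmap1U /= jEP qP mE_gen /hZ; congr (horner_mx _ _).
      by apply/matrixP => x y; rewrite !mxE /= /s' (unsplitK (inl _)) /vmx mxvecE.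
    apply/polyP => l; rewrite coef_map /var_poly coef_sum.
    have [lw|wl] := ltnP l w; last first.
      have q0 : (q z)`_l = 0 by apply: nth_default; apply: leq_trans (szq z) wl.
      rewrite q0 raddf0 big1 // => l' _.
      by rewrite coefCM coefXn gtn_eqF ?mulr0 // (leq_trans (ltn_ord l')).
    rewrite (bigD1 (Ordinal lw)) //= big1 ?addr0 => [|l' /negbTE ne].
      rewrite coefCM coefXn eqxx mulr1 /= /s' (unsplitK (inr _)) /vq mxvecE.
      by rewrite mxE.
    by rewrite coefCM coefXn -[l]/(val (Ordinal lw)) val_eqE eq_sym ne mulr0.
  split.
    exists (\det (i r)); rewrite -ev -det_mulmx.
    by rewrite -[_ *m _]/(i _ * i _) -rmorphM Qr rmorph1 det1.
  rewrite -!ev PQ rmorphM.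
  (* This value involves only K and L, so it is a scalar matrix, with determinant an e-th power. *)
  have -> : i (character_value (jE \o (j \o iE')) jC (m *~ D))
      = (character_value (jE' \o iE') jL (m *~ D))%:M.
    rewrite /character_value /tensor_value !rmorph_sum; apply: eq_bigr => l _.
    rewrite (rmorphM i) i_jC.
    by apply: etrans (congr1 (fun A => A *m _) (i_jE _)) _; rewrite -scalar_mxM.
  rewrite -[_ * _]/(_ *m _) mul_scalar_mx detZ; congr (_ * _).
  have c' : compatible kK (jE' \o iE') jL by exact: c.
  by rewrite mulrzA -(character_valueMn c') //; exact: M0Mz.
Qed.

End Step.
End PowerFactors.

Lemma regular_representation (F : fieldType) (E : fieldExtType F) :
  exists (e0 : nat) (mu : {rmorphism E -> 'M[F]_e0.+1}),
    \dim {:E} = e0.+1 /\ forall c : F, mu c%:A = c%:M.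
Proof.
have [e0 De] : exists e0, \dim {:E} = e0.+1.
  by exists (\dim {:E}).-1; rewrite prednK // adim_gt0.
have [b bP] : exists b : e0.+1.-tuple E, basis_of fullv b.
  by have := vbasisP {:E}; move: (vbasis _); rewrite De => b bP; exists b.
pose m (x : E) : 'M[F]_e0.+1 := \matrix_(i, j) coord b j (x * b`_i).
have mB : zmod_morphism m.
  by move=> x y; apply/matrixP => i j; rewrite !mxE mulrBl linearB.
have mZ (c : F) x : m (c *: x) = c *: m x.
  by apply/matrixP => i j; rewrite !mxE -scalerAl linearZ.
have m1 : m 1 = 1%:M.
  by apply/matrixP => i j; rewrite !mxE mul1r coord_free ?(basis_free bP).
have mM : monoid_morphism m.
  split=> // x y; rewrite [x * y]mulrC; apply/matrixP => i j; rewrite !mxE.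
  rewrite -mulrA {1}(coord_basis bP (memvf (x * b`_i))) mulr_sumr linear_sum.
  by apply: eq_bigr => l _; rewrite !mxE -scalerAr linearZ.
pose mu : {rmorphism E -> 'M[F]_e0.+1} :=
  HB.pack m (GRing.isZmodMorphism.Build E _ m mB) (GRing.isMonoidMorphism.Build E _ m mM).
by exists e0, mu; split=> // c; rewrite -[LHS]/(m _) mZ m1 scalemx1.
Qed.

(** * Norms along finite field extensions *)

Section Descend.
Variables (k : fieldType) (L : fieldExtType k) (gd : galois_data L).
Local Notation act := (@gal_act _ _ gd).
Variables (K : fieldType) (kK : {rmorphism k -> K}).
Variables (Lam : zmodType) (aL : gal_group gd -> Lam -> Lam) (M0 : Lam -> Prop).
Variable kap : Lam -> 'I_(ldim L) -> K.
Hypothesis M00 : M0 0.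
Hypothesis M0B : forall m m', M0 m -> M0 m' -> M0 (m - m').
Hypothesis kap0 : kap 0 =1 tensor_one kK.
Hypothesis kapD : forall m m', M0 m -> M0 m' ->
  kap (m + m') =1 tensor_mul kK (kap m) (kap m').

Local Notation power_factors := (power_factors kK aL M0 kap).

Lemma power_factors_simple_extension (E' : fieldType) (iE' : {rmorphism K -> E'})
    (E : fieldExtType E') (a : E) D :
  <<1; a>>%VS = fullv -> power_factors (in_alg E \o iE') D -> power_factors iE' (D * \dim {:E}).
Proof.
move=> gen; have [e0 [mu [-> muk]]] := regular_representation E.
apply: (power_factors_step M00 M0B kap0 kapD (mu := mu) (a := a)) => // x.
have : x \in <<1; a>>%VS by rewrite gen memvf.
by case/Fadjoin_polyP => p /polyOver1P [q ->] ->; exists q.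
Qed.

(** An inseparable extension need not have a primitive element, so the norm goes through a tower:
    for [a] outside E' not generating E, both E over E'(a) and E'(a) over E' have smaller
    dimension. *)
Lemma power_factors_extension (E' : fieldType) (iE' : {rmorphism K -> E'})
    (E : fieldExtType E') D :
  power_factors (in_alg E \o iE') D -> power_factors iE' (D * \dim {:E}).
Proof.
have [n] := ubnP (\dim {:E}); elim: n E' iE' E D => // n IH E' iE' E D le_n gE.
have [[a a1]|no] := classic (exists a, a \notin (1%VS : {vspace E})); last first.
  apply: (@power_factors_simple_extension _ _ _ 1) => //.
  apply/vspaceP => x; rewrite memvf; have : x \in (1%VS : {vspace E}).
    by apply/negPn/negP => nx; apply: no; exists x.
  by apply: subvP; exact: subv_adjoin.
have [/eqP full|nfull] := boolP (<<1; a>>%VS == fullv :> {vspace E}).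
  exact: (power_factors_simple_extension full gE).
pose E1 : {subfield E} := <<1; a>>%AS.
have dimE1 : (1 < \dim E1)%N.
  rewrite ltn_neqAle adim_gt0 andbT eq_sym; apply: contra a1 => dim1.
  have /eqP <- : <<1; a>>%VS == 1%VS by rewrite eq_sym eqEdim sub1v dimv1 (eqP dim1).
  exact: memv_adjoin.
have dimE1' : (\dim E1 < \dim {:E})%N.
  by rewrite ltnNge; apply: contra nfull => le; rewrite eqEdim subvf.
have towr : \dim {:E} = (\dim_E1 {:E} * \dim E1)%N by apply: dim_sup_field; apply: subvf.
have dF : \dim {:subvs_of E1} = \dim E1 by rewrite dimvf.
have dEE : \dim {:fieldOver E1} = \dim_E1 {:E}.
  rewrite -(dim_aspaceOver (subvf E1)); congr (\dim _).
  apply/vspaceP => x; rewrite memvf; symmetry.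
  by apply: etrans (mem_aspaceOver (subvf E1) x) _; exact: memvf.
have g1 : power_factors (in_alg (fieldOver E1) \o (in_alg (subvs_of E1) \o iE')) D.
  apply: power_factors_ext gE => x /=.
  rewrite fieldOver_scaleE /= algid1; symmetry; exact: mulr1.
have g2 := IH _ _ (fieldOver E1) D _ g1.
rewrite towr PoszM mulrA -dEE -dF.
apply: IH; last apply: g2.
- by rewrite dF; move: le_n; rewrite ltnS; apply: leq_trans.
- rewrite dEE; move: le_n; rewrite ltnS; apply: leq_trans.
  by rewrite [X in (_ < X)%N]towr ltn_Pmulr // divn_gt0 ?adim_gt0 // dimvS ?subvf.
Qed.

End Descend.

(** * Field extensions given by a basis *)

Section ExtensionOfBasis.
Variables (K E : fieldType) (F : {rmorphism K -> E}) (d : nat) (e : 'I_d -> E).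
Definition extension_basis : Prop :=
  forall z, exists! c : 'rV[K]_d, z = \sum_(i < d) F (c 0 i) * e i.
Hypothesis basis : extension_basis.

(** A copy of E carrying the K-vector space structure that comes from [F]; with the proof as a
    parameter, the instances below read [F], [e] and [d] off the type. *)
Definition extension_of of extension_basis : Type := E.
Local Notation EF := (extension_of basis).

HB.instance Definition _ := GRing.Field.on EF.

Definition extension_scale (c : K) (x : EF) : EF := F c * x.

Fact extension_scaleA a b u :
  extension_scale a (extension_scale b u) = extension_scale (a * b) u.
Proof. by rewrite /extension_scale rmorphM mulrA. Qed.
Fact extension_scale1 u : extension_scale 1 u = u.
Proof. by rewrite /extension_scale rmorph1; exact: mul1r. Qed.
Fact extension_scaleDr a u v :
  extension_scale a (u + v) = extension_scale a u + extension_scale a v.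
Proof. exact: mulrDr. Qed.
Fact extension_scaleDl v a b :
  extension_scale (a + b) v = extension_scale a v + extension_scale b v.
Proof. by rewrite /extension_scale rmorphD; exact: mulrDl. Qed.
HB.instance Definition _ := GRing.Zmodule_isLmodule.Build K EF
  extension_scaleA extension_scale1 extension_scaleDr extension_scaleDl.
Fact extension_scaleAl a (u v : EF) : extension_scale a (u * v) = extension_scale a u * v.
Proof. exact: mulrA. Qed.
HB.instance Definition _ := GRing.Lmodule_isLalgebra.Build K EF extension_scaleAl.
Fact extension_scaleAr a (u v : EF) : extension_scale a (u * v) = u * extension_scale a v.
Proof. exact: mulrCA. Qed.
HB.instance Definition _ := GRing.Lalgebra_isAlgebra.Build K EF extension_scaleAr.

Fact extension_vector : Vector.axiom d EF.
Proof.
have ex z : {c : 'rV[K]_d | z = \sum_(i < d) F (c 0 i) * e i}.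
  apply: constructive_indefinite_description.
  by have [c [h _]] := basis z; exists c.
pose v2r (z : EF) : 'rV[K]_d := sval (ex z).
have v2rP z : z = \sum_(i < d) F (v2r z 0 i) * e i := svalP (ex z).
have uni z (c : 'rV[K]_d) : z = \sum_(i < d) F (c 0 i) * e i -> v2r z = c.
  by move=> zc; have [c0 [_ u]] := basis z; rewrite -(u _ zc) -(u _ (v2rP z)).
exists v2r.
  move=> a x y; apply: uni.
  rewrite [in LHS](v2rP x) [in LHS](v2rP y) -[a *: _]/(F a * _) mulr_sumr -big_split.
  by apply: eq_bigr => i _; rewrite !mxE rmorphD rmorphM mulrDl mulrA.
exists (fun c : 'rV[K]_d => \sum_(i < d) F (c 0 i) * e i) => [z|c]; first by rewrite -v2rP.
exact: uni.
Qed.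
HB.instance Definition _ := Lmodule_hasFinDim.Build K EF extension_vector.

(** Translates a degree given by a basis into the dimension of a field extension, the form in which
    the norm argument is stated. *)
Lemma fieldExt_of_basis : exists (E1 : fieldExtType K),
  exists2 h : {rmorphism E1 -> E}, \dim {:E1} = d & bijective h /\ forall c, h c%:A = F c.
Proof.
exists (EF : fieldExtType K).
have hz : zmod_morphism (id : EF -> E) by [].
have hm : monoid_morphism (id : EF -> E) by [].
pose h : {rmorphism EF -> E} := HB.pack (id : EF -> E)
  (GRing.isZmodMorphism.Build EF E _ hz) (GRing.isMonoidMorphism.Build EF E _ hm).
exists h; first by rewrite dimvf.
split; first by exists id.
by move=> c; exact: mulr1.
Qed.

End ExtensionOfBasis.

Section Degree.
Variables (k : fieldType) (L : fieldExtType k) (gd : galois_data L).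
Variables (K : fieldType) (kK : {rmorphism k -> K}).
Variables (Lam : zmodType) (aL : gal_group gd -> Lam -> Lam) (M0 : Lam -> Prop).
Variable kap : Lam -> 'I_(ldim L) -> K.
Hypothesis M00 : M0 0.
Hypothesis M0B : forall m m', M0 m -> M0 m' -> M0 (m - m').
Hypothesis kap0 : kap 0 =1 tensor_one kK.
Hypothesis kapD : forall m m', M0 m -> M0 m' ->
  kap (m + m') =1 tensor_mul kK (kap m) (kap m').

Local Notation power_factors := (power_factors kK aL M0 kap).

Lemma power_factors_isomorphism (E E1 : fieldType) (iE : {rmorphism K -> E})
    (iE1 : {rmorphism K -> E1}) (h : {rmorphism E1 -> E}) D :
  bijective h -> (forall c, h (iE1 c) = iE c) -> power_factors iE D -> power_factors iE1 D.
Proof.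
move=> [g gh hg] hi [n [s [P [Q [h1 h2 h3]]]]].
exists n, (g \o s), P, Q; split=> // R jE1 jL c m Mm.
have [x|x /(congr1 g)|jE jEh] := @factor_through E1 E R h jE1.
- by exists (g x); rewrite hg.
- by rewrite gh -[in g 0](rmorph0 h) gh => ->; rewrite rmorph0.
have js : (jE1 \o (g \o s)) =1 jE \o s by move=> i; rewrite /= -jEh hg.
have cE : compatible (iE \o kK) jE jL by move=> x; rewrite -c /= -hi jEh.
have ev p : mmap jL (jE1 \o (g \o s)) p = mmap jL (jE \o s) p by apply: eq_mmap.
have ti : character_value kap (jE1 \o iE1) jL (m *~ D) = character_value kap (jE \o iE) jL (m *~ D).
  by apply: eq_bigr => l _; rewrite /= -hi jEh.
by rewrite !ev ti; apply: h3.
Qed.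

Lemma power_factors_degree (E : fieldType) (F : {rmorphism K -> E}) d (e : 'I_d -> E) D :
  extension_basis F e -> power_factors F D -> power_factors idfun (D * d).
Proof.
move=> basis gF; have [E1 [h <- [bij hc]]] := fieldExt_of_basis basis.
apply: (power_factors_extension M00 M0B kap0 kapD).
by apply: power_factors_isomorphism gF; last exact: hc.
Qed.

End Degree.

(** * Descent along the torsor *)

Section SubfieldType.
Variables (Om : fieldType) (P : divringClosed Om).

Definition subfield_of := {x : Om | x \in P}.
HB.instance Definition _ := [isSub of subfield_of for @sval _ _].
HB.instance Definition _ := [Choice of subfield_of by <:].
HB.instance Definition _ := [SubChoice_isSubUnitRing of subfield_of by <:].
HB.instance Definition _ := [SubNzRing_isSubComNzRing of subfield_of by <:].
HB.instance Definition _ := [SubComUnitRing_isSubIntegralDomain of subfield_of by <:].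
HB.instance Definition _ := [SubIntegralDomain_isSubField of subfield_of by <:].

End SubfieldType.

Lemma subfield_type (Om : fieldType) (F : Om -> Prop) :
  F 1 -> (forall x y, F x -> F y -> F (x - y)) ->
  (forall x y, F x -> F y -> F (x * y)) -> (forall x, F x -> F x^-1) ->
  exists (Fd : fieldType) (j : {rmorphism Fd -> Om}),
    forall x, F x <-> exists y, x = j y.
Proof.
move=> F1 FB FM FV.
pose Fb : Om -> bool := fun a => if excluded_middle_informative (F a) then true else false.
have FbP a : reflect (F a) (a \in (Fb : {pred Om})).
  by rewrite unfold_in /Fb; case: excluded_middle_informative => h; constructor.
have cl : divring_closed (Fb : {pred Om}).
  split; first exact/FbP.
    by move=> x y /FbP Fx /FbP Fy; apply/FbP/FB.
  by move=> x y /FbP Fx /FbP Fy; apply/FbP/FM => //; apply: FV.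
pose P : divringClosed Om := HB.pack Fb (GRing.isDivringClosed.Build Om Fb cl).
exists (subfield_of P : fieldType), (val : {rmorphism subfield_of P -> Om}) => x.
split=> [Fx|[y ->]].
  have Px : x \in P by exact/FbP.
  by exists (Sub x Px : subfield_of P).
exact/FbP/(valP y).
Qed.

(** * Linear algebra over a subfield and the descent ring *)

Section LinearAlgebra.
Variables (Fd Om : fieldType) (j : {rmorphism Fd -> Om}).

(** Induction on the family: a new vector either lies in the span found so far or enlarges its
    basis. *)
Lemma independent_span N (r : 'I_N -> Om) :
  exists (M : nat) (rho : 'I_M -> Om) (f : 'I_N -> 'I_M -> Fd),
    (forall a, r a = \sum_b j (f a b) * rho b) /\
    forall c : 'I_M -> Fd, \sum_b j (c b) * rho b = 0 -> forall b, c b = 0.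
Proof.
elim: N r => [|N IH] r.
  exists 0%N, (fun=> 0), (fun _ _ => 0); split; first by case.
  by move=> c _; case.
have [M [rho [f [rf ind]]]] := IH (fun a => r (lift ord0 a)).
have [[g gE]|no] := classic (exists g, r ord0 = \sum_b j (g b) * rho b).
  exists M, rho, (fun a => if unlift ord0 a is Some a' then f a' else g); split=> // a.
  by case: unliftP => [a' ->|->].
exists M.+1, (fun b => if unlift ord0 b is Some b' then rho b' else r ord0).
exists (fun a b => match unlift ord0 a, unlift ord0 b with
  | Some a', Some b' => f a' b' | None, None => 1 | _, _ => 0 end); split.
  move=> a; rewrite big_ord_recl unlift_none; case: unliftP => [a' ->|->].
    by rewrite rmorph0 mul0r add0r rf; apply: eq_bigr => b _; rewrite liftK.
  rewrite rmorph1 mul1r big1 ?addr0 // => b _; by rewrite liftK rmorph0 mul0r.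
move=> c; rewrite big_ord_recl unlift_none.
under eq_bigr do rewrite liftK.
have [c0|c0 e] := eqVneq (c ord0) 0.
  rewrite c0 rmorph0 mul0r add0r => /ind h b.
  by case: (unliftP ord0 b) => [b' ->|->].
case: no; exists (fun b => - c (lift ord0 b) / c ord0).
apply: (mulfI (_ : j (c ord0) != 0)); first by rewrite fmorph_eq0.
move/eqP: e; rewrite addr_eq0 => /eqP ->; rewrite -sumrN mulr_sumr; apply: eq_bigr => b _.
by rewrite mulrA -rmorphM mulrCA divff // mulr1 rmorphN mulNr.
Qed.

Variables (n : nat) (om : 'I_n -> Om).

(** Along a basis of the Fd-span of the coefficients [r], a relation over Om between polynomials
    over Fd breaks up into relations over Fd, which may then be evaluated at [om]. *)
Lemma span_relation N (r : 'I_N -> Om) (Q : 'I_N -> {mpoly Fd[n]}) :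
  \sum_a r a *: map_mpoly j (Q a) = 0 ->
  exists (M : nat) (rho : 'I_M -> Om) (f : 'I_N -> 'I_M -> Fd),
    (forall a, r a = \sum_b j (f a b) * rho b) /\
    forall b, \sum_a j (f a b) * mmap j om (Q a) = 0.
Proof.
move=> rel; have [M [rho [f [rf ind]]]] := independent_span r.
exists M, rho, f; split=> // b.
have : \sum_a f a b *: Q a = 0.
  apply/mpolyP => m; rewrite mcoeff0 raddf_sum /=.
  under eq_bigr do rewrite mcoeffZ.
  apply: (ind (fun b => \sum_a f a b * (Q a)@_m) _ b).
  have := congr1 (mcoeff m) rel; rewrite mcoeff0 raddf_sum /= => e0; apply: etrans _ e0.
  under [RHS]eq_bigr do rewrite mcoeffZ mcoeff_map_mpoly rf mulr_suml.
  rewrite [RHS]exchange_big; apply: eq_bigr => b' _ /=.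
  rewrite rmorph_sum mulr_suml; apply: eq_bigr => a _.
  by rewrite rmorphM mulrAC.
move/(congr1 (mmap j om)); rewrite rmorph0 rmorph_sum /= => e0; apply: etrans _ e0.
by apply: eq_bigr => a _; rewrite mmapZ.
Qed.

(* R is Om (x)_Fd Fd[om], with om embedded by w in the second factor; an       *)
(* element of Om whose images from both factors agree lies in Fd.              *)
Lemma descent_ring : exists (R : comNzRingType) (pi : {rmorphism Om -> R}) (w : 'I_n -> R),
  (forall Q : {mpoly Fd[n]}, mmap j om Q = 0 -> mmap (pi \o j) w Q = 0) /\
  forall (A B : {mpoly Fd[n]}) (c : Om),
    mmap (pi \o j) w A = pi c * mmap (pi \o j) w B ->
    mmap j om A = c * mmap j om B -> mmap j om B != 0 -> exists y, c = j y.
Proof.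
(* The Om-span of the polynomials over Fd that vanish at [om]. It is an ideal, and the polynomial
   ring over Om modulo it is the tensor product. *)
pose J (P : {mpoly Om[n]}) := exists N (r : 'I_N -> Om) (Q : 'I_N -> {mpoly Fd[n]}),
  (forall a, mmap j om (Q a) = 0) /\ P = \sum_a r a *: map_mpoly j (Q a).
have J1 r Q : mmap j om Q = 0 -> J (r *: map_mpoly j Q).
  by move=> Q0; exists 1%N, (fun=> r), (fun=> Q); split=> //; rewrite big_ord1.
have J0 : J 0.
  by exists 0%N, (fun=> 0), (fun=> 0); split; [move=> [] | rewrite big_ord0].
have JD P P' : J P -> J P' -> J (P + P').
  move=> [N [r [Q [Q0 ->]]]] [N' [r' [Q' [Q0' ->]]]].
  exists (N + N')%N, (fun a => match split a with inl x => r x | inr y => r' y end),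
    (fun a => match split a with inl x => Q x | inr y => Q' y end); split.
    by move=> a; case: (split a).
  have split_sum (F : 'I_(N + N') -> {mpoly Om[n]}) :
      \sum_a F a = \sum_a F (lshift N' a) + \sum_a F (rshift N a) by exact: big_split_ord.
  rewrite split_sum.
  congr (_ + _); apply: eq_bigr => a _; first by rewrite !(unsplitK (inl _)).
  by rewrite !(unsplitK (inr _)).
have JM T P : J P -> J (T * P).
  move=> [N [r [Q [Q0 ->]]]]; rewrite mulr_sumr.
  elim/big_ind: _ => // a _; rewrite {1}[T]mpolyE mulr_suml.
  elim/big_ind: _ => // m _; rewrite -scalerAl -scalerAr scalerA.
  rewrite -(map_mpolyX j m) -(rmorphM (map_mpoly j)); apply: J1.
  by rewrite rmorphM /= Q0 mulr0.
(* The relation is split along a basis of the span of 1, [- c] and the [- r x]. Some basis vector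
   has a nonzero coefficient in 1; there, evaluation at [om] expresses c as a quotient of elements
   of Fd. *)
have core (A B : {mpoly Fd[n]}) c : J (map_mpoly j A - c *: map_mpoly j B) ->
    mmap j om A = c * mmap j om B -> mmap j om A != 0 -> exists y, c = j y.
  move=> [N [r [Q [Q0 e]]]] AB A0.
  pose r' (a : 'I_(1 + (1 + N))) := match split a with
    | inl _ => 1 | inr a' => match split a' with inl _ => - c | inr x => - r x end end.
  pose Q' (a : 'I_(1 + (1 + N))) := match split a with
    | inl _ => A | inr a' => match split a' with inl _ => B | inr x => Q x end end.
  have [|M [rho [f [rf fQ]]]] := @span_relation _ r' Q'.
    rewrite !big_split_ord /= !big_ord1 /r' /Q' !(unsplitK (inl _)) !(unsplitK (inr _)).
    rewrite !(unsplitK (inl _)) scale1r scaleNr addrA e.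
    rewrite -big_split big1 // => a _ /=.
    by rewrite !(unsplitK (inr _)) scaleNr subrr.
  have r0 : r' (lshift _ ord0) = 1 by rewrite /r' (unsplitK (inl _)).
  have [b fb] : exists b, f (lshift _ ord0) b != 0.
    apply: NNPP => no; have := rf (lshift _ ord0).
    rewrite r0 big1 => [/eqP|b _]; first by rewrite oner_eq0.
    have [->|h] := eqVneq (f (lshift (1 + N) ord0) b) 0; first by rewrite rmorph0 mul0r.
    by case: no; exists b.
  have := fQ b; rewrite !big_split_ord /= !big_ord1 /Q' !(unsplitK (inl _)) !(unsplitK (inr _)).
  rewrite !(unsplitK (inl _)) [X in _ + (_ + X)]big1 => [|a _]; last first.
    by rewrite !(unsplitK (inr _)) Q0 mulr0.
  rewrite addr0 AB mulrA -mulrDl => /eqP; rewrite mulf_eq0.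
  have B0 : mmap j om B != 0 by apply: contraNneq A0 => B0; rewrite AB B0 mulr0.
  rewrite (negbTE B0) orbF addr_eq0 => /eqP fc.
  exists (- f (rshift 1 (lshift N ord0)) b / f (lshift (1 + N) ord0) b).
  by rewrite rmorphM fmorphV rmorphN -fc mulrAC divff ?mul1r // fmorph_eq0.
have Jev P : J P -> mmap idfun om P = 0.
  move=> [N [r [Q [Q0 ->]]]]; rewrite rmorph_sum big1 // => a _.
  have e : mmap (idfun \o j) om (Q a) = mmap j om (Q a) by exact: eq_mmap.
  by rewrite /= mmapZ mmap_map_mpoly e Q0 mulr0.
have J1' : ~ J 1 by move/Jev/eqP; rewrite rmorph1 oner_eq0.
have [R [q [qJ _]]] := quotient_ring J0 JD JM J1'.
pose pi : {rmorphism Om -> R} := q \o @mpolyC n Om.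
pose w i : R := q 'X_i.
have qmap Q : mmap (pi \o j) w Q = q (map_mpoly j Q).
  have := @mpoly_rmorphism_eq n Fd R (mmap (pi \o j) w) (q \o map_mpoly j).
  apply=> [c|i] /=; first by rewrite mmapC map_mpolyC.
  by rewrite mmapX mmap1U map_mpolyX.
exists R, pi, w; split=> [Q Q0|A B c e AB B0].
  by rewrite qmap; apply/qJ; rewrite -[map_mpoly _ _]scale1r; apply: J1.
have [c0|c0] := eqVneq c 0; first by exists 0; rewrite rmorph0.
apply: (core A B) => //; last by rewrite AB mulf_neq0.
by apply/qJ; rewrite rmorphB /= -mul_mpolyC rmorphM -!qmap e subrr.
Qed.

End LinearAlgebra.

Section Compositum.
Variables (k : fieldType) (L : fieldExtType k) (gd : galois_data L).
Local Notation act := (@gal_act _ _ gd).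
Variables (K : fieldType) (kK : {rmorphism k -> K}).
Variables (Om : fieldType) (jK : {rmorphism K -> Om}) (jL : {rmorphism L -> Om}).
Hypothesis compat : forall c : k, jK (kK c) = jL c%:A.
Hypothesis inj : forall x : 'I_(ldim L) -> K, tensor_value jK jL x = 0 -> x =1 fun=> 0.
Variable S : gal_group gd -> {rmorphism Om -> Om}.
Hypothesis S_K : forall t x, S t (jK x) = jK x.
Hypothesis S_L : forall t x, S t (jL x) = jL (act t x).

Definition compositum (z : Om) : Prop := exists x, z = tensor_value jK jL x.

Local Notation tens := (tensor_value jK jL).

Lemma tensor_value_inj x y : tens x = tens y -> x =1 y.
Proof.
move=> e l; apply/eqP; rewrite -subr_eq0; apply/eqP.
apply: (inj (x := fun l => x l - y l)).
rewrite -[RHS](subrr (tens x)) {2}e /tensor_value -sumrB.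
by apply: eq_bigr => i _; rewrite rmorphB mulrBl.
Qed.

Lemma S_tensor t x : S t (tens x) = tens (tensor_act kK t x).
Proof.
rewrite (tensor_value_act compat) rmorph_sum; apply: eq_bigr => i _.
by rewrite rmorphM S_K S_L.
Qed.

Lemma compositum1 : compositum 1.
Proof. by exists (tensor_one kK); rewrite (tensor_value1 compat). Qed.

Lemma compositumB y z : compositum y -> compositum z -> compositum (y - z).
Proof.
move=> [x ->] [x' ->]; exists (fun l => x l - x' l).
by rewrite /tensor_value -sumrB; apply: eq_bigr => l _; rewrite rmorphB mulrBl.
Qed.

Lemma compositumM y z : compositum y -> compositum z -> compositum (y * z).
Proof.
by move=> [x ->] [x' ->]; exists (tensor_mul kK x x'); rewrite (tensor_valueM compat).
Qed.

Lemma compositumK x : compositum (jK x).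
Proof.
exists (fun l => x * tensor_one kK l); rewrite -[LHS]mulr1 -(tensor_value1 compat).
by rewrite mulr_sumr; apply: eq_bigr => l _; rewrite rmorphM mulrA.
Qed.

Lemma compositumL x : compositum (jL x).
Proof.
exists (fun l => kK (lcoord l x)); rewrite {1}[x]lcoordE rmorph_sum.
by apply: eq_bigr => l _; rewrite compat -rmorphM mulr_algl.
Qed.

Lemma compositum_S t z : compositum z -> compositum (S t z).
Proof. by move=> [x ->]; rewrite S_tensor; exists (tensor_act kK t x). Qed.

(** With c of trace 1, z is the sum of the conjugates of z c. In coordinates this sum involves L
    only through traces of basis elements, which lie in k. *)
Lemma compositum_fixed z : compositum z -> (forall t, S t z = z) -> exists x, z = jK x.
Proof.
move=> Cz fz; have [c tc] := gal_act_trace gd.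
have [x zc] := compositumM Cz (compositumL c).
have tr l : exists e : k, \sum_t act t (lbasis l) = e%:A.
  apply: (gal_act_fix (g := gd)) => s; rewrite rmorph_sum [RHS](reindex_inj (mulIg s)) /=.
  by apply: eq_bigr => t _; rewrite gal_actM.
pose e l := proj1_sig (constructive_indefinite_description _ (tr l)).
have eP l : \sum_t act t (lbasis l) = (e l)%:A.
  exact: (proj2_sig (constructive_indefinite_description _ (tr l))).
exists (\sum_l x l * kK (e l)).
transitivity (\sum_t S t (z * jL c)).
  under eq_bigr do rewrite rmorphM fz S_L.
  by rewrite -mulr_sumr -rmorph_sum tc rmorph1 mulr1.
rewrite zc; under eq_bigr do rewrite rmorph_sum.
rewrite exchange_big rmorph_sum; apply: eq_bigr => l _ /=.
under eq_bigr do rewrite rmorphM S_K S_L.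
by rewrite -mulr_sumr -rmorph_sum eP -compat rmorphM.
Qed.

Lemma S1 z : compositum z -> S 1%g z = z.
Proof.
move=> [x ->]; rewrite rmorph_sum; apply: eq_bigr => l _.
by rewrite rmorphM S_K S_L gal_act1.
Qed.

Lemma SM s t z : compositum z -> S (s * t)%g z = S t (S s z).
Proof.
move=> [x ->]; rewrite !rmorph_sum; apply: eq_bigr => l _.
by rewrite !rmorphM !S_K !S_L gal_actM.
Qed.

(** The product of z with its other conjugates is Galois-invariant, hence a nonzero element of K;
    this makes the image of K (x) L a field, namely L(X). *)
Lemma compositumV z : compositum z -> compositum z^-1.
Proof.
move=> Cz; have [->|z0] := eqVneq z 0.
  by rewrite invr0 -(subrr 1); apply: compositumB; apply: compositum1.
pose y := \prod_(t | t != 1%g) S t z.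
have Cy : compositum y.
  rewrite /y; elim/big_ind: _ => [||t _]; first exact: compositum1.
    exact: compositumM.
  exact: compositum_S.
have zy : z * y = \prod_t S t z by rewrite [RHS](bigD1 1%g) //= S1.
have [n en] : exists n, z * y = jK n.
  apply: compositum_fixed; first exact: compositumM.
  move=> s; rewrite zy rmorph_prod [RHS](reindex_inj (mulIg s)) /=.
  by apply: eq_bigr => t _; rewrite SM.
have n0 : jK n != 0.
  rewrite -en zy; apply/prodf_neq0 => t _; by rewrite fmorph_eq0.
have -> : z^-1 = y * jK n^-1.
  by apply: (mulfI z0); rewrite mulfV // mulrA en fmorphV divff.
by apply: compositumM => //; apply: compositumK.
Qed.

Variables (N : nat) (a : gal_group gd -> {perm 'I_N}) (lam : 'I_N -> Om).
Hypothesis lam0 : forall i, lam i != 0.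
Hypothesis S_lam : forall t i, S t (lam i) = lam (a t i).

Definition lattice := {ffun 'I_N -> int}.

Definition lattice_act t (m : lattice) : lattice := [ffun i => m ((a t)^-1 i)%g].

Definition monomial_value (m : lattice) : Om := \prod_i lam i ^ m i.

Lemma monomial_value_neq0 m : monomial_value m != 0.
Proof. by apply/prodf_neq0 => i _; rewrite expfz_neq0. Qed.

Lemma monomial_value0 : monomial_value 0 = 1.
Proof. by rewrite /monomial_value big1 // => i _; rewrite ffunE expr0z. Qed.

Lemma monomial_valueD m m' :
  monomial_value (m + m') = monomial_value m * monomial_value m'.
Proof.
rewrite /monomial_value -big_split; apply: eq_bigr => i _.
by rewrite ffunE expfzDr.
Qed.

Lemma monomial_valueN m : monomial_value (- m) = (monomial_value m)^-1.
Proof.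
apply: (mulfI (monomial_value_neq0 m)); rewrite -monomial_valueD subrr.
by rewrite monomial_value0 divff // monomial_value_neq0.
Qed.

Lemma S_monomial t m : S t (monomial_value m) = monomial_value (lattice_act t m).
Proof.
rewrite /monomial_value rmorph_prod [RHS](reindex_inj (@perm_inj _ (a t))).
by apply: eq_bigr => i _; rewrite /= ffunE permK -S_lam fmorphXz.
Qed.

Lemma lattice_actB t : zmod_morphism (lattice_act t).
Proof. by move=> m m'; apply/ffunP => i; rewrite !ffunE. Qed.

(** The lattice M0. Membership in the compositum, rather than weight zero, makes its stability under
    Galois immediate. *)
Definition descends (m : lattice) : Prop := compositum (monomial_value m).

Lemma descends0 : descends 0.
Proof. by rewrite /descends monomial_value0; exact: compositum1. Qed.

Lemma descendsB m m' : descends m -> descends m' -> descends (m - m').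
Proof.
rewrite /descends monomial_valueD monomial_valueN => h h'.
by apply: compositumM => //; apply: compositumV.
Qed.

Lemma descends_act t m : descends m -> descends (lattice_act t m).
Proof. by rewrite /descends -S_monomial; apply: compositum_S. Qed.

(** The torus point t in coordinates. These are picked by [epsilon]; the identities follow from the
    uniqueness of coordinates in K (x) L. *)
Lemma monomial_coordinates : exists kap : lattice -> 'I_(ldim L) -> K,
  [/\ forall m, descends m -> monomial_value m = tens (kap m),
      kap 0 =1 tensor_one kK,
      forall m m', descends m -> descends m' ->
        kap (m + m') =1 tensor_mul kK (kap m) (kap m')
    & forall t m, descends m -> kap (lattice_act t m) =1 tensor_act kK t (kap m)].
Proof.
pose kap m := epsilon (inhabits (fun=> 0 : K))
   (fun x : 'I_(ldim L) -> K => monomial_value m = tens x).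
have kapP m : descends m -> monomial_value m = tens (kap m).
  by move=> h; exact: (epsilon_spec _ _ h).
exists kap; split=> //.
- apply: tensor_value_inj; rewrite -(kapP _ descends0) monomial_value0.
  by rewrite (tensor_value1 compat).
- move=> m m' h h'; apply: tensor_value_inj.
  have hD : descends (m + m').
    rewrite -[m']opprK; apply: descendsB => //.
    by rewrite -[- m']add0r; apply: descendsB => //; exact: descends0.
  by rewrite (tensor_valueM compat) -!kapP // monomial_valueD.
- move=> t m h; apply: tensor_value_inj.
  by rewrite -S_tensor -!kapP ?S_monomial //; apply: descends_act.
Qed.

End Compositum.

(** * Galois action on the rational functions on V *)

Section RationalFunctions.
Variables (k : fieldType) (L : fieldExtType k) (gd : galois_data L) (d : nat).
Local Notation act := (@gal_act _ _ gd).
Local Notation Om := {fraction {mpoly L[d]}}.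

Lemma map_mpoly_neq0 (A B : comNzRingType) (f : {rmorphism A -> B}) (p : {mpoly A[d]}) :
  injective f -> p != 0 -> map_mpoly f p != 0.
Proof.
move=> inj; apply: contraNneq => e; apply/eqP/mpolyP => m; apply: inj.
by rewrite -mcoeff_map_mpoly e !mcoeff0 rmorph0.
Qed.

Definition scalar_fun : {rmorphism L -> Om} := @tofrac {mpoly L[d]} \o @mpolyC d L.

Lemma extend_scalars : exists jV : {rmorphism {fraction {mpoly k[d]}} -> Om},
  forall p, jV (tofrac p) = tofrac (map_mpoly (in_alg L) p).
Proof.
apply: (@fraction_lift _ _ (@tofrac {mpoly L[d]} \o map_mpoly (in_alg L))) => p p0.
by rewrite /= tofrac_eq0 map_mpoly_neq0 //; apply: fmorph_inj.
Qed.

Lemma galois_action : exists S : gal_group gd -> {rmorphism Om -> Om},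
  forall t p, S t (tofrac p) = tofrac (map_mpoly (act t) p).
Proof.
have ex t : exists s : {rmorphism Om -> Om}, forall p, s (tofrac p) = tofrac (map_mpoly (act t) p).
  apply: (@fraction_lift _ _ (@tofrac {mpoly L[d]} \o map_mpoly (act t))) => p p0.
  by rewrite /= tofrac_eq0 map_mpoly_neq0 //; apply: fmorph_inj.
exists (fun t => proj1_sig (constructive_indefinite_description _ (ex t))) => t.
exact: (proj2_sig (constructive_indefinite_description _ (ex t))).
Qed.

Variable jV : {rmorphism {fraction {mpoly k[d]}} -> Om}.
Hypothesis jVE : forall p, jV (tofrac p) = tofrac (map_mpoly (in_alg L) p).
Variable S : gal_group gd -> {rmorphism Om -> Om}.
Hypothesis SE : forall t p, S t (tofrac p) = tofrac (map_mpoly (act t) p).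

Lemma jV_scalar c : jV (tofrac (@mpolyC d k c)) = scalar_fun c%:A.
Proof. by rewrite jVE map_mpolyC. Qed.

Lemma S_extend t x : S t (jV x) = jV x.
Proof.
have [[p q] /= q0 ->] := fractionP x.
have fixp r : map_mpoly (act t) (map_mpoly (in_alg L) r) = map_mpoly (in_alg L) r.
  by apply/mpolyP => m; rewrite !mcoeff_map_mpoly /= gal_actk.
by rewrite rmorphM fmorphV !jVE rmorphM fmorphV !SE !fixp.
Qed.

Lemma S_scalar t x : S t (scalar_fun x) = scalar_fun (act t x).
Proof. by rewrite /scalar_fun /= SE map_mpolyC. Qed.

(** Once denominators are cleared, each monomial gives a relation over k between the basis elements
    of L. *)
Lemma extend_independent (x : 'I_(ldim L) -> {fraction {mpoly k[d]}}) :
  tensor_value jV scalar_fun x = 0 -> x =1 fun=> 0.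
Proof.
have [a [b [b0 xE]]] := fraction_common_denominator x.
move=> e j; rewrite xE; suff -> : a j = 0 by rewrite rmorph0 mul0r.
apply/mpolyP => m; rewrite mcoeff0.
have e1 : \sum_i map_mpoly (in_alg L) (a i) * (lbasis i)%:MP = 0.
  apply/eqP; rewrite -tofrac_eq0 -(mulIr_eq0 _ (mulIf (_ : jV (tofrac b)^-1 != 0))).
    rewrite rmorph_sum mulr_suml -[X in _ == X]e; apply/eqP; apply: eq_bigr => i _.
    by rewrite xE rmorphM mulrAC [jV (_ / _)]rmorphM jVE.
  by rewrite fmorph_eq0 invr_eq0 tofrac_eq0.
have := congr1 (mcoeff m) e1; rewrite mcoeff0 raddf_sum /=.
under eq_bigr do rewrite mulrC mcoeffCM mcoeff_map_mpoly mulrC mulr_algl.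
by rewrite -(lcoord_unique (fun i => (a i)@_m) j) => ->; rewrite /lcoord linear0.
Qed.

End RationalFunctions.

(** Dominance of U -> X. The generic point of X lifts to U over some nonzero ring S, where a nonzero
    function on X becomes invertible, whereas [phi a = 0] would make it vanish. *)
Lemma torsor_injective (k : fieldType) (G : lin_alg_group k) (d : nat)
    (rho : representation G d) (g : {mpoly k[d]}) (X : affine_variety k)
    (phi : rational_map d X) :
  torsor_quotient rho g phi -> forall a, phi a = 0 -> a = 0.
Proof.
case=> _ _ _ _ loc a pa.
pose y : khom (coord_alg X) (function_field X) :=
  @KHom k (coord_alg X) (function_field X) (@tofrac X) (fun=> erefl).
have [S [h [v [_ _ ov]]]] := loc (function_field X) y.
have e : phi a = (tofrac 0 / tofrac g ^+ 0) :> {fraction {mpoly k[d]}}.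
  by rewrite expr0 divr1 rmorph0.
have := ov a 0 0%N e; rewrite expr0 mulr1 /peval rmorph0 => /esym h0.
apply/eqP; rewrite -(tofrac_eq0 a); apply/negPn/negP => a0.
have : h (tofrac a) * h (tofrac a)^-1 = 1 by rewrite -rmorphM divff // rmorph1.
by move/eqP; rewrite h0 mul0r eq_sym oner_eq0.
Qed.

Lemma exprz_pos_neg (F : fieldType) (x : F) (z : int) : x != 0 ->
  x ^+ (if z is Posz a then a else 0%N) = x ^ z * x ^+ (if z is Negz a then a.+1 else 0%N).
Proof.
by move=> x0; case: z => a; rewrite ?expr0 ?mulr1 // NegzE -exprnN mulVf // expf_neq0.
Qed.

(** * Monomials of weight zero descend to the quotient *)

Section Torsor.
Variables (k : fieldType) (L : fieldExtType k) (G : lin_alg_group k).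
Variables (M : zmodType)
  (theta : forall R : kalg L, 'M[restrict_scalars R]_(gdim G) -> M -> R).
Hypothesis theta_char : forall (R : kalg L) (g : 'M[restrict_scalars R]_(gdim G)),
  gpoint g -> character_point (theta g).
Variables (d : nat) (rho : representation G d) (g : {mpoly k[d]}) (X : affine_variety k)
  (phi : rational_map d X).
Hypothesis tq : torsor_quotient rho g phi.
Variables (N : nat) (l : 'I_N -> 'rV[L]_d) (wt : 'I_N -> M).
Hypothesis l0 : forall i, l i != 0.
Hypothesis wt_l : forall (R : kalg L) (h : 'M[restrict_scalars R]_(gdim G)) i, gpoint h ->
  map_mx (kmap R) (l i) *m rho (restrict_scalars R) h
    = theta h (wt i) *: map_mx (kmap R) (l i).

Local Notation Om := {fraction {mpoly L[d]}}.
Variable jV : {rmorphism {fraction {mpoly k[d]}} -> Om}.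
Hypothesis jVE : forall p, jV (tofrac p) = tofrac (map_mpoly (in_alg L) p).
Variable gd : galois_data L.
Variable S : gal_group gd -> {rmorphism Om -> Om}.
Hypothesis SE : forall t p, S t (tofrac p) = tofrac (map_mpoly (@gal_act _ _ gd t) p).
Variable phiK : {rmorphism {fraction X} -> {fraction {mpoly k[d]}}}.
Hypothesis phiKE : forall a, phiK (tofrac a) = phi a.

Local Notation jL := (scalar_fun L d).
Let jK : {rmorphism {fraction X} -> Om} := jV \o phiK.
Let kK : {rmorphism k -> {fraction X}} := @tofrac X \o @cmap k X.

Definition linear_form (r : 'rV[L]_d) : {mpoly L[d]} := \sum_b r 0 b *: 'X_b.

Lemma linear_form_neq0 r : r != 0 -> linear_form r != 0.
Proof.
apply: contraNneq => e; apply/eqP/rowP => b; rewrite mxE.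
have := congr1 (mcoeff U_(b)) e; rewrite mcoeff0 raddf_sum /= (bigD1 b) //= => <-.
rewrite big1 ?addr0 => [|c /negbTE ne]; rewrite mcoeffZ mcoeffXU ?ne ?mulr0 //.
by rewrite eqxx mulr1.
Qed.

Let lam i : Om := tofrac (linear_form (l i)).

Lemma compat_K c : jK (kK c) = jL c%:A.
Proof. by rewrite /jK /kK /= phiKE (khomE phi); exact: (jV_scalar jVE). Qed.

Lemma tensor_K_inj (x : 'I_(ldim L) -> {fraction X}) :
  tensor_value jK jL x = 0 -> x =1 fun=> 0.
Proof.
move=> e j; have := extend_independent jVE e j.
by move/eqP; rewrite fmorph_eq0 => /eqP.
Qed.

Let S_K t x : S t (jK x) = jK x.
Proof. exact: (S_extend jVE SE). Qed.

Let S_L t x : S t (jL x) = jL (@gal_act _ _ gd t x).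
Proof. exact: (S_scalar SE). Qed.

(** Descent along the torsor. With Fd = L(X), the ring R = Om (x) Fd[om] receives the generic point
    of V in two ways. Both images lie over the same point of X, so they differ by an element h of
    G(R). A monomial of weight zero does not see h, hence its two images in R agree and
    [descent_ring] places it in Fd. *)
Lemma weight_zero_descends (m : lattice N) :
  \sum_i wt i *~ m i = 0 -> compositum jK jL (monomial_value lam m).
Proof.
move=> wt0.
have [Fd [jF jFE]] := subfield_type (compositum1 compat_K) (@compositumB _ _ _ _ jK jL)
  (@compositumM _ _ _ _ _ _ _ compat_K) (@compositumV _ _ gd _ _ _ _ _ compat_K _ S_K S_L).
have [LF LFE] : exists LF : {rmorphism L -> Fd}, forall x, jF (LF x) = jL x.
  apply: lift_to_subring => [|x]; first exact: fmorph_inj.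
  by apply/jFE; exact: (compositumL compat_K x).
have [XF XFE] : exists XF : {rmorphism {fraction X} -> Fd}, forall x, jF (XF x) = jK x.
  apply: lift_to_subring => [|x]; first exact: fmorph_inj.
  by apply/jFE; exact: (compositumK compat_K x).
have [[g0 reg] _ _ trans _] := tq.
pose v b : Om := tofrac 'X_b.
pose gv : Om := jV (tofrac g).
have gv0 : gv != 0 by rewrite fmorph_eq0 tofrac_eq0.
(* The extra coordinate, an inverse of g, ensures that the second point lies in U as well. *)
pose om (z : 'I_(d + 1)) : Om := match split z with inl b => v b | inr _ => gv^-1 end.
have [R [pi [w [wrel wdesc]]]] := @descent_ring Fd Om jF _ om.
pose RL : kalg L := KAlg (pi \o jL).
pose Rk := restrict_scalars RL.
pose vp : 'cV[Rk]_d := \col_b pi (v b).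
pose wp : 'cV[Rk]_d := \col_b w (lshift 1 b).
pose emb : {rmorphism {mpoly k[d]} -> {mpoly Fd[d + 1]}} :=
  mmap (@mpolyC _ Fd \o (LF \o in_alg L)) (fun b => 'X_(lshift 1 b)).
have embw p : mmap (pi \o jF) w (emb p) = peval (fun b => wp b 0) p.
  rewrite /emb /= mmap_comp /peval; apply: eq_mmap => [c|b] /=.
    by rewrite mmapC; congr (pi _); exact: LFE.
  by rewrite mmapX mmap1U mxE.
have embo p : mmap jF om (emb p) = jV (tofrac p).
  rewrite /emb /= mmap_comp.
  have := @mpoly_rmorphism_eq d k Om
    (mmap (mmap jF om \o (@mpolyC _ Fd \o (LF \o in_alg L)))
      (mmap jF om \o (fun b => 'X_(lshift 1 b)))) (jV \o @tofrac _).
  apply=> [c|b] /=.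
    rewrite !mmapC; apply: etrans (mmapC _ _ _) _.
    by rewrite (jV_scalar jVE); exact: LFE.
  rewrite jVE map_mpolyX mmapX mmap1U /= mmapX mmap1U.
  by rewrite /om (unsplitK (inl _)).
have pv p : peval (fun b => vp b 0) p = pi (jV (tofrac p)).
  rewrite /peval; have := @mpoly_rmorphism_eq d k R
    (mmap (kmap Rk) (fun b => vp b 0)) (pi \o (jV \o @tofrac _)).
  apply=> [c|b] /=; first by rewrite mmapC (jV_scalar jVE).
  by rewrite jVE map_mpolyX mmapX mmap1U mxE.
pose yf : {rmorphism X -> R} := pi \o (jK \o @tofrac X).
have yk c : yf (kmap (coord_alg X) c) = kmap Rk c by apply: (congr1 pi); exact: compat_K.
pose y : khom (coord_alg X) Rk := @KHom k (coord_alg X) Rk yf yk.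
have jKphi a P e : phi a = (tofrac P / tofrac g ^+ e) :> {fraction {mpoly k[d]}} ->
    jV (tofrac P) = jK (tofrac a) * gv ^+ e.
  move=> pa; rewrite /jK /= phiKE pa rmorphM fmorphV rmorphXn; symmetry.
  by apply: mulfVK; apply: expf_neq0.
have ov : Defs.over g phi vp y.
  by move=> a P e pa; rewrite !pv (jKphi _ _ _ pa) rmorphM rmorphXn.
have op : open_point g vp.
  exists (pi gv^-1); rewrite [peval _ _]pv.
  by rewrite -[RHS](rmorph1 pi) -[in RHS](divff gv0) rmorphM.
have opw : open_point g wp.
  exists (w (rshift d ord0)).
  have := wrel (emb g * 'X_(rshift d ord0) - 1).
  rewrite !rmorphB !rmorphM !rmorph1 /= !mmapX !mmap1U embo embw.
  rewrite /om (unsplitK (inr _)) divff // subrr => /(_ erefl)/eqP.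
  by rewrite subr_eq0 => /eqP.
have ow : Defs.over g phi wp y.
  move=> a P e pa.
  have := wrel (emb P - (XF (tofrac a))%:MP * emb g ^+ e).
  rewrite !rmorphB !rmorphM !rmorphXn /= !mmapC !embo !embw /= XFE.
  by rewrite (jKphi _ _ _ pa) subrr => /(_ erefl)/eqP; rewrite subr_eq0 => /eqP.
(* Simple transitivity of G(R) on the points of U over [y]. *)
have [h [[gh wph] _]] := trans Rk vp wp y op opw ov ow.
have [th0 thD] := theta_char (R := RL) gh.
have thMn x n : theta (R := RL) h (x *+ n) = theta (R := RL) h x ^+ n.
  by elim: n => [|n IH]; rewrite ?mulr0n ?expr0 // mulrS exprS thD IH.
have thP (F : 'I_N -> nat) :
    theta (R := RL) h (\sum_i wt i *+ F i) = \prod_i theta (R := RL) h (wt i) ^+ F i.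
  by elim/big_rec2: _ => // i a b _ <-; rewrite thD thMn.
have lamE i : lam i = \sum_b jL (l i 0 b) * v b.
  rewrite /lam /linear_form rmorph_sum; apply: eq_bigr => b _.
  by rewrite -mul_mpolyC rmorphM.
have lw i : \sum_b pi (jL (l i 0 b)) * wp b 0 = theta (R := RL) h (wt i) * pi (lam i).
  have := congr1 (fun A : 'M[R]_1 => A 0 0) (congr1 (fun A => A *m vp) (wt_l (R := RL) i gh)).
  rewrite /= -mulmxA -wph -scalemxAl [in RHS]mxE !mxE => e.
  transitivity (\sum_j (map_mx (kmap RL) (l i)) 0 j * wp j 0).
    by apply: eq_bigr => b _; rewrite !mxE.
  rewrite e lamE rmorph_sum; congr (_ * _); apply: eq_bigr => b _.
  by rewrite !mxE rmorphM.
pose Lp i : {mpoly Fd[d + 1]} := \sum_b (LF (l i 0 b))%:MP * 'X_(lshift 1 b).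
have Lpw i : mmap (pi \o jF) w (Lp i) = theta (R := RL) h (wt i) * pi (lam i).
  rewrite -lw rmorph_sum; apply: eq_bigr => b _.
  rewrite rmorphM /= mmapC mmapX mmap1U mxE; congr (_ * _).
  by congr (pi _); exact: LFE.
have Lpo i : mmap jF om (Lp i) = lam i.
  rewrite lamE rmorph_sum; apply: eq_bigr => b _.
  rewrite rmorphM /= mmapC mmapX mmap1U /om (unsplitK (inl _)); congr (_ * _).
  exact: LFE.
(* Exponents may be negative, so the monomial is handled as a quotient of two honest products;
   [Negz x] stands for - (x + 1). *)
pose pp i : nat := if m i is Posz x then x else 0%N.
pose nn i : nat := if m i is Negz x then x.+1 else 0%N.
pose A := \prod_i Lp i ^+ pp i; pose B := \prod_i Lp i ^+ nn i.
have Aw (F : 'I_N -> nat) : mmap (pi \o jF) w (\prod_i Lp i ^+ F i)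
    = theta (R := RL) h (\sum_i wt i *+ F i) * pi (\prod_i lam i ^+ F i).
  rewrite !rmorph_prod thP -big_split; apply: eq_bigr => i _ /=.
  by rewrite !rmorphXn /= Lpw exprMn.
have Ao (F : 'I_N -> nat) : mmap jF om (\prod_i Lp i ^+ F i) = \prod_i lam i ^+ F i.
  by rewrite rmorph_prod; apply: eq_bigr => i _; rewrite rmorphXn /= Lpo.
have lam0 i : lam i != 0 by rewrite tofrac_eq0 linear_form_neq0.
have AB : \prod_i lam i ^+ pp i = monomial_value lam m * \prod_i lam i ^+ nn i.
  rewrite -big_split; apply: eq_bigr => i _.
  exact: (exprz_pos_neg (m i) (lam0 i)).
have wtpn : \sum_i wt i *+ pp i = \sum_i wt i *+ nn i.
  apply/eqP; rewrite -subr_eq0 -sumrB -[X in _ == X]wt0; apply/eqP.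
  apply: eq_bigr => i _; rewrite /pp /nn.
  by case: (m i) => x; rewrite ?mulr0n ?subr0 // sub0r NegzE mulrNz.
apply/jFE; apply: (wdesc A B).
- by rewrite !Aw wtpn AB rmorphM mulrCA.
- by rewrite !Ao AB.
- rewrite (Ao nn); apply/prodf_neq0 => i _; apply: expf_neq0; exact: lam0.
Qed.

End Torsor.

(** * The factorization given by a retraction *)

Lemma regular_common (k : fieldType) (n : nat) (X : affine_variety k) (g : {mpoly k[n]})
    (phi : rational_map n X) r (a : 'I_r -> X) : regular_on g phi ->
  exists (A : 'I_r -> {mpoly k[n]}) (e : nat),
    forall i, phi (a i) = (tofrac (A i) / tofrac g ^+ e) :> {fraction {mpoly k[n]}}.
Proof.
move=> [g0 reg].
have gX0 e : tofrac g ^+ e != 0 by rewrite expf_neq0 // tofrac_eq0.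
elim: r a => [|r IH] a; first by exists (fun=> 0), 0%N; case.
have [A [e Ae]] := IH (fun i => a (lift ord0 i)).
have [P [e' Pe]] := reg (a ord0).
exists (fun i => if unlift ord0 i is Some i' then A i' * g ^+ e' else P * g ^+ e), (e + e')%N.
move=> i; case: unliftP => [i' ->|->].
  rewrite Ae rmorphM rmorphXn exprD invfM mulrACA; symmetry.
  by rewrite divff ?mulr1.
rewrite Pe rmorphM rmorphXn exprD [_ ^+ e * _]mulrC invfM mulrACA; symmetry.
by rewrite divff ?mulr1.
Qed.

Section Initial.
Variables (k : fieldType) (L : fieldExtType k) (gd : galois_data L).
Local Notation act := (@gal_act _ _ gd).
Variables (X : affine_variety k).
Local Notation K := {fraction X}.
Let kK : {rmorphism k -> K} := @tofrac X \o @cmap k X.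
Variables (Lam : zmodType) (aL : gal_group gd -> Lam -> Lam) (M0 : Lam -> Prop).
Variable kap : Lam -> 'I_(ldim L) -> K.
Hypothesis kapD : forall m m', M0 m -> M0 m' ->
  kap (m + m') =1 tensor_mul kK (kap m) (kap m').
Hypothesis kap_act : forall t m, M0 m -> kap (aL t m) =1 tensor_act kK t (kap m).

Variables (n : nat) (X' : affine_variety k) (f : khom (coord_alg X) (coord_alg X'))
  (s : 'I_n -> X') (phi : rational_map n X).
Hypothesis f_inj : injective f.
Hypothesis comp : composes_to (fun i => tofrac (s i) : function_field X') phi f.
Variable F : {rmorphism K -> {fraction X'}}.
Hypothesis FE : forall a, F (tofrac a) = tofrac (f a).

Let s' i : function_field X' := tofrac (s i).

Lemma composes_injective a : phi a = 0 -> a = 0.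
Proof.
have [g [reg inv snd]] := comp; move=> pa.
have e : phi a = (tofrac 0 / tofrac g ^+ 0) :> {fraction {mpoly k[n]}}.
  by rewrite expr0 divr1 rmorph0.
have := snd a 0 0%N e; rewrite expr0 mulr1 /peval rmorph0 => /esym/eqP.
by rewrite tofrac_eq0 -(rmorph0 f) => /eqP/f_inj.
Qed.

(** The coordinates of t(m) are rational functions on X and pull back along [phi] to A^n. [Q m] is a
    common denominator, and [P m] combines the numerators with the basis of L. As [phi] composed
    with [s] is [f], evaluation at [s] gives back t over k(X'). *)
Lemma power_factors_initial : power_factors kK aL M0 kap F 1.
Proof.
have [g [reg [gi ginv] snd]] := comp; have [g0 _] := reg.
have [Phi PhiE] : exists Phi : {rmorphism K -> {fraction {mpoly k[n]}}},
    forall a, Phi (tofrac a) = phi a.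
  apply: fraction_lift => a a0; apply: contra a0 => /eqP pa.
  by apply/eqP/composes_injective.
have [jn jnE] := extend_scalars L n.
pose Psi : {rmorphism K -> {fraction {mpoly L[n]}}} := jn \o Phi.
pose jL := scalar_fun L n.
have compP c : Psi (kK c) = jL c%:A.
  by rewrite /Psi /= PhiE (khomE phi); exact: (jV_scalar jnE).
have [ev evE] : exists ev : {rmorphism {mpoly k[n]} -> {fraction X'}},
    forall p, ev p = peval s' p.
  by exists (mmap (kmap (function_field X')) s').
have gs0 : ev g != 0.
  by rewrite evE; apply/eqP => e; move/eqP: ginv; rewrite [peval _ _]e mul0r eq_sym oner_eq0.
have [tx txE] : exists tx : {rmorphism {mpoly k[n]} -> {fraction {mpoly k[n]}}},
    forall p, tx p = tofrac p by exists (@tofrac _).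
have tg0 : tx g != 0 by rewrite txE tofrac_eq0.
(* If [kap m j] is a_j / b, with phi a_j = A_j / g^e and phi b = B / g^e', the numerators are A_j
   g^e' and the denominator is B g^e. The latter is nonzero at [s] because [f] is injective. *)
have ex m : exists PQ : ('I_(ldim L) -> {mpoly k[n]}) * {mpoly k[n]},
    [/\ forall j, tx (PQ.1 j) = Phi (kap m j) * tx PQ.2,
        ev PQ.2 != 0
      & forall j, ev (PQ.1 j) = F (kap m j) * ev PQ.2].
  have [a [b [b0 ab]]] := fraction_common_denominator (kap m).
  have [A [e Ae]] := regular_common a reg.
  have [B [e' Be]] := reg.2 b.
  have [x [y [y0 PhiK]]] : exists (x : 'I_(ldim L) -> {fraction {mpoly k[n]}}) y,
      [/\ y != 0, forall j, Phi (kap m j) = x j / y &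
          (forall j, tx (A j) = x j * tx g ^+ e) /\ tx B = y * tx g ^+ e'].
    exists (fun j => phi (a j)), (phi b); split.
    - by apply: contra b0 => /eqP pb; apply/eqP/composes_injective.
    - by move=> j; rewrite ab rmorphM fmorphV !PhiE.
    - have tgX r : tx g ^+ r != 0 by apply: expf_neq0.
      split=> [j|].
        by rewrite Ae -(txE (A j)) -(txE g); symmetry; apply: mulfVK; exact: tgX.
      by rewrite Be -(txE B) -(txE g); symmetry; apply: mulfVK; exact: tgX.
  have [x' [y' [y0' FK [evA evB]]]] : exists (x : 'I_(ldim L) -> {fraction X'}) y,
      [/\ y != 0, forall j, F (kap m j) = x j / y &
          (forall j, ev (A j) = x j * ev g ^+ e) /\ ev B = y * ev g ^+ e'].
    exists (fun j => tofrac (f (a j))), (tofrac (f b)); split.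
    - by rewrite tofrac_eq0 -(rmorph0 f) (inj_eq f_inj).
    - by move=> j; rewrite ab rmorphM fmorphV !FE.
    - by split=> [j|]; rewrite !evE; apply: snd.
  move=> [txA txB]; exists (fun j => A j * g ^+ e', B * g ^+ e); split=> /=.
  - by move=> j; rewrite !rmorphM !rmorphXn txA txB PhiK !mulrA mulfVK // mulrAC.
  - rewrite rmorphM rmorphXn evB; apply: mulf_neq0; last exact: expf_neq0.
    exact: (mulf_neq0 y0' (expf_neq0 e' gs0)).
  - by move=> j; rewrite !rmorphM !rmorphXn evA evB FK !mulrA mulfVK // mulrAC.
pose PQ m := proj1_sig (constructive_indefinite_description _ (ex m)).
have PQP m : [/\ forall j, tx ((PQ m).1 j) = Phi (kap m j) * tx (PQ m).2,
    ev (PQ m).2 != 0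
  & forall j, ev ((PQ m).1 j) = F (kap m j) * ev (PQ m).2].
  exact: proj2_sig (constructive_indefinite_description _ (ex m)).
move: PQ PQP => PQ PQP.
have [sc scE] : exists sc : {rmorphism {mpoly k[n]} -> {mpoly L[n]}},
    forall p, sc p = map_mpoly (in_alg L) p by exists (map_mpoly (in_alg L)).
pose P m := \sum_j sc ((PQ m).1 j) * (lbasis j)%:MP.
pose Q m := sc (PQ m).2.
have [tL tLE] : exists tL : {rmorphism {mpoly L[n]} -> {fraction {mpoly L[n]}}},
    forall p, tL p = tofrac p by exists (@tofrac _).
have tL_inj p q : tL p = tL q -> p = q.
  by rewrite !tLE => /eqP; rewrite tofrac_eq => /eqP.
have tL_sc p : tL (sc p) = jn (tx p) by rewrite tLE txE jnE scE.
have tL_C c : tL c%:MP = jL c by rewrite tLE.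
pose T m := tensor_value Psi jL (kap m).
have tP m : tL (P m) = T m * tL (Q m).
  rewrite /P rmorph_sum /T /tensor_value mulr_suml; apply: eq_bigr => j _.
  have [e _ _] := PQP m.
  by rewrite rmorphM tL_sc e tL_C rmorphM /Q tL_sc mulrAC.
have [st stE] : exists st : gal_group gd -> {rmorphism {mpoly L[n]} -> {mpoly L[n]}},
    forall t p, map_mpoly (act t) p = st t p by exists (fun t => map_mpoly (act t)).
have scQ t p : st t (sc p) = sc p.
  by apply/mpolyP => m; rewrite -stE scE !mcoeff_map_mpoly /= gal_actk.
have stC t c : st t c%:MP = (act t c)%:MP by rewrite -stE map_mpolyC.
have tPt t m : M0 m -> tL (st t (P m)) = T (aL t m) * tL (Q m).
  move=> Mm; rewrite /P rmorph_sum.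
  have -> : T (aL t m) = \sum_j Psi (kap m j) * jL (act t (lbasis j)).
    rewrite -(tensor_value_act compP); apply: eq_bigr => j _.
    by rewrite kap_act.
  rewrite rmorph_sum mulr_suml; apply: eq_bigr => j _.
  have [e _ _] := PQP m.
  by rewrite rmorphM scQ stC rmorphM tL_sc e tL_C rmorphM /Q tL_sc mulrAC.
exists n, (fun i => tofrac (s i)), P, Q; split.
- move=> m m' Mm Mm'; apply: tL_inj; rewrite !rmorphM !tP.
  have -> : T (m + m') = T m * T m'.
    rewrite -(tensor_valueM compP); apply: eq_bigr => j _.
    by rewrite kapD.
  move: (T m) (T m') (tL (Q m)) (tL (Q m')) (tL (Q (m + m'))) => x x' z z' w.
  by rewrite (mulrACA x z) [LHS]mulrAC.
- move=> t m Mm; rewrite !stE scQ; apply: tL_inj.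
  by rewrite !rmorphM tPt // tP mulrAC.
- move=> R jE jR c m Mm.
  have evR p : mmap jR (jE \o (fun i => tofrac (s i))) (sc p) = jE (ev p).
    rewrite evE scE mmap_map_mpoly /peval.
    apply: etrans _ (esym (mmap_comp _ _ _ _)); apply: eq_mmap => [x|i] //=.
    by have := c x; rewrite /= FE (khomE f) => <-.
  have [_ Q0 evP] := PQP m; rewrite mulr1z; split.
    exists (jE (ev (PQ m).2)^-1); rewrite /Q evR -rmorphM divff //; exact: rmorph1.
  rewrite /P rmorph_sum /character_value /tensor_value mulr_suml; apply: eq_bigr => j _.
  by rewrite rmorphM /= mmapC evR evP rmorphM /Q evR mulrAC.
Qed.

End Initial.

(** * From a factorization to a retraction *)

Section TwistedEvaluation.
Variables (L : fieldType) (n N : nat) (Om : fieldType) (jL : {rmorphism L -> Om}).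
Variable ev : {rmorphism {mpoly L[n]} -> Om}.
Hypothesis evC : forall c, ev c%:MP = jL c.
Variable Fx : fieldType.
Variable tx : {rmorphism {mpoly L[n]} -> Fx}.
Hypothesis tx_inj : injective tx.

(* z is defined at the point s of A^n at which ev evaluates, with value c. *)
Definition specializes (z : Fx) (c : Om) : Prop :=
  exists A B : {mpoly L[n]}, [/\ ev B != 0, z * tx B = tx A & ev A = c * ev B].

Let tx0 B : ev B != 0 -> tx B != 0.
Proof.
by apply: contraNneq => e; rewrite (tx_inj (x1 := B) (x2 := 0)) ?rmorph0.
Qed.

Lemma specializes_tx A : specializes (tx A) (ev A).
Proof. by exists A, 1; rewrite !rmorph1 oner_neq0 !mulr1. Qed.

Lemma specializesD z c z' c' :
  specializes z c -> specializes z' c' -> specializes (z + z') (c + c').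
Proof.
move=> [A [B [B0 zE cE]]] [A' [B' [B0' zE' cE']]].
exists (A * B' + A' * B), (B * B'); split.
- by rewrite rmorphM mulf_neq0.
- by rewrite rmorphD !rmorphM -zE -zE' mulrDl mulrA; congr (_ + _); rewrite mulrCA mulrC.
- by rewrite rmorphD !rmorphM cE cE' mulrDl mulrA; congr (_ + _); rewrite [RHS]mulrCA [RHS]mulrC.
Qed.

Lemma specializesM z c z' c' :
  specializes z c -> specializes z' c' -> specializes (z * z') (c * c').
Proof.
move=> [A [B [B0 zE cE]]] [A' [B' [B0' zE' cE']]].
exists (A * A'), (B * B'); split.
- by rewrite rmorphM mulf_neq0.
- by rewrite !rmorphM -zE -zE' mulrACA.
- by rewrite !rmorphM cE cE' mulrACA.
Qed.

Lemma specializes_neq0 z c : specializes z c -> c != 0 -> z != 0.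
Proof.
move=> [A [B [B0 zE cE]]] c0; apply: contraNneq (mulf_neq0 c0 B0) => z0.
by rewrite -cE (tx_inj (x1 := A) (x2 := 0)) ?rmorph0 // -zE z0 mul0r.
Qed.

Lemma specializes_div z c z' c' :
  specializes z c -> specializes z' c' -> c' != 0 -> specializes (z / z') (c / c').
Proof.
move=> [A [B [B0 zE cE]]] [A' [B' [B0' zE' cE']]] c0.
have A0' : ev A' != 0 by rewrite cE' mulf_neq0.
have z0 : z' != 0 by apply: (specializes_neq0 (c := c')) => //; exists A', B'.
exists (A * B'), (B * A'); split.
- by rewrite rmorphM mulf_neq0.
- rewrite !rmorphM -zE -zE' mulrA -!mulrA; congr (_ * _).
  by rewrite mulrCA; congr (_ * _); rewrite mulrA mulVf // mul1r.
- rewrite !rmorphM cE cE' -!mulrA; congr (_ * _).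
  by rewrite [RHS]mulrCA; congr (_ * _); rewrite mulrA mulVf // mul1r.
Qed.

Variables (lam : 'I_N -> Om) (M0 : lattice N -> Prop).
Hypothesis lam0 : forall i, lam i != 0.
Hypothesis M00 : M0 0.
Hypothesis M0D : forall m m', M0 m -> M0 m' -> M0 (m + m').
Variables (P Q : lattice N -> {mpoly L[n]}).
Hypothesis PQ_hom : forall m m', M0 m -> M0 m' ->
  P (m + m') * (Q m * Q m') = P m * P m' * Q (m + m').
Hypothesis PQ_ev : forall m, M0 m ->
  ev (Q m) != 0 /\ ev (P m) = monomial_value lam m * ev (Q m).

(** The pullback to A^n of the character m of the torus. *)
Definition character_fun (m : lattice N) : Fx := tx (P m) / tx (Q m).

Lemma specializes_character m : M0 m -> specializes (character_fun m) (monomial_value lam m).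
Proof.
move=> Mm; have [Q0 PE] := PQ_ev Mm; exists (P m), (Q m); split=> //.
by rewrite /character_fun mulfVK // tx0.
Qed.

Lemma character_funD m m' : M0 m -> M0 m' ->
  character_fun (m + m') = character_fun m * character_fun m'.
Proof.
move=> Mm Mm'; have [q _] := PQ_ev Mm; have [q' _] := PQ_ev Mm'.
have [q'' _] := PQ_ev (M0D Mm Mm').
rewrite /character_fun mulf_div; apply/eqP; rewrite eqr_div ?mulf_neq0 ?tx0 //.
by rewrite -!rmorphM PQ_hom.
Qed.

Lemma character_fun0 : character_fun 0 = 1.
Proof.
have c0 : character_fun 0 != 0.
  by apply: specializes_neq0 (specializes_character M00) (monomial_value_neq0 lam0 0).
by apply: (mulfI c0); rewrite -character_funD // addr0 mulr1.
Qed.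

Definition mdiff (m m0 : 'X_{1..N}) : lattice N := [ffun i => (m i)%:Z - (m0 i)%:Z].

Lemma mdiffD m m' m0 m0' :
  mdiff (m + m')%MM (m0 + m0')%MM = mdiff m m0 + mdiff m' m0'.
Proof.
apply/ffunP => i; rewrite !ffunE !mnmDE !PoszD opprD.
by rewrite addrACA.
Qed.

Definition concentrated m0 (p : {mpoly L[N]}) : Prop :=
  forall m, m \in msupp p -> M0 (mdiff m m0).

(* p / y^m0 is a combination of characters of T when p is concentrated; twist  *)
(* pulls it back to A^n.                                                       *)
Definition twist m0 : {mpoly L[N]} -> Fx :=
  mlin (tx \o @mpolyC n L) (fun m => character_fun (mdiff m m0)).

Lemma concentratedM m0 m0' p p' : concentrated m0 p -> concentrated m0' p' ->
  concentrated (m0 + m0')%MM (p * p').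
Proof.
move=> cp cp' m /msuppM_le /allpairsP [[x y] /= [xp yp ->]].
by rewrite mdiffD; apply: M0D; [apply: cp | apply: cp'].
Qed.

Lemma concentratedB m0 p p' : concentrated m0 p -> concentrated m0 p' ->
  concentrated m0 (p - p').
Proof.
move=> cp cp' m; rewrite mcoeff_msupp mcoeffB => ne.
have [e|] := eqVneq p@_m 0; last by rewrite -mcoeff_msupp; apply: cp.
by apply: cp'; rewrite mcoeff_msupp; apply: contraNneq ne => ->; rewrite e subrr.
Qed.

Lemma twistB m0 p p' : twist m0 (p - p') = twist m0 p - twist m0 p'.
Proof. exact: raddfB. Qed.

(** Characters multiply on M0, and relative to their base exponents concentrated polynomials involve
    exponents of M0 only. *)
Lemma twistM m0 m0' p p' : concentrated m0 p -> concentrated m0' p' ->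
  twist (m0 + m0')%MM (p * p') = twist m0 p * twist m0' p'.
Proof.
move=> cp cp'; rewrite {2 3}/twist /mlin big_distrlr /=.
rewrite {1}[p]mpolyE {1}[p']mpolyE big_distrlr /= /twist raddf_sum /=.
rewrite big_seq [RHS]big_seq; apply: eq_bigr => m mp.
rewrite raddf_sum /= big_seq [RHS]big_seq; apply: eq_bigr => m' mp'.
rewrite -scalerAl -scalerAr scalerA -mpolyXD mlinZ mlinX mdiffD.
rewrite character_funD; [|exact: cp|exact: cp'].
by rewrite /= mpolyCM rmorphM mulrACA.
Qed.

(** At the point s the pulled back character m takes the value of the monomial it replaced, so
    evaluation undoes the twist up to the factor lam^m0. *)
Lemma specializes_twist m0 p : concentrated m0 p ->
  specializes (twist m0 p) (mmap jL lam p / mmap1 lam m0).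
Proof.
move=> cp; rewrite /twist /mlin /mmap mulr_suml.
rewrite big_seq [X in specializes _ X]big_seq.
elim/big_rec2: _ => [|m c z mp spz].
  by rewrite -(rmorph0 tx) -(rmorph0 ev); apply: specializes_tx.
apply: specializesD => //; rewrite -mulrA; apply: specializesM.
  by rewrite -evC; apply: specializes_tx.
have -> : mmap1 lam m / mmap1 lam m0 = monomial_value lam (mdiff m m0).
  rewrite /mmap1 /monomial_value -prodf_div; apply: eq_bigr => i _.
  by rewrite ffunE expfzDr // exprnN.
exact: specializes_character (cp _ mp).
Qed.

Lemma mmap1_neq0 m : mmap1 lam m != 0.
Proof. by apply/prodf_neq0 => i _; apply: expf_neq0. Qed.

End TwistedEvaluation.

Lemma mpoly_galois_fixed (k : fieldType) (L : fieldExtType k) (gd : galois_data L) n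
    (p : {mpoly L[n]}) :
  (forall t, map_mpoly (@gal_act _ _ gd t) p = p) ->
  exists p0 : {mpoly k[n]}, p = map_mpoly (in_alg L) p0.
Proof.
move=> fp; have fc m : exists c : k, p@_m = c%:A.
  by apply: (gal_act_fix (g := gd)) => t; rewrite -mcoeff_map_mpoly fp.
pose c m := proj1_sig (constructive_indefinite_description _ (fc m)).
have cP m : p@_m = (c m)%:A.
  exact: (proj2_sig (constructive_indefinite_description _ (fc m))).
exists (\sum_(m <- msupp p) c m *: 'X_[m]).
rewrite [LHS]mpolyE rmorph_sum; apply: eq_bigr => m _.
by rewrite /= map_mpolyZ map_mpolyX cP.
Qed.

(** * Construction of the retraction from the twisted quotients *)

Section Retraction.
Variables (k : fieldType) (L : fieldExtType k) (gd : galois_data L).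
Local Notation act := (@gal_act _ _ gd).
Variables (X : affine_variety k).
Local Notation K := {fraction X}.
Variables (Om : fieldType) (jK : {rmorphism K -> Om}) (jL : {rmorphism L -> Om}).
Variable S : gal_group gd -> {rmorphism Om -> Om}.
Hypothesis S_K : forall t x, S t (jK x) = jK x.
Hypothesis S_L : forall t x, S t (jL x) = jL (act t x).
Variables (N : nat) (a : gal_group gd -> {perm 'I_N}) (lam : 'I_N -> Om).
Hypothesis lam0 : forall i, lam i != 0.
Hypothesis S_lam : forall t i, S t (lam i) = lam (a t i).
Variable M0 : lattice N -> Prop.
Hypothesis M00 : M0 0.
Hypothesis M0D : forall m m', M0 m -> M0 m' -> M0 (m + m').
Hypothesis M0a : forall t m, M0 m -> M0 (lattice_act a t m).

Variables (n : nat) (s : 'I_n -> K).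
Variables (P Q : lattice N -> {mpoly L[n]}).
Hypothesis PQ_hom : forall m m', M0 m -> M0 m' ->
  P (m + m') * (Q m * Q m') = P m * P m' * Q (m + m').
Hypothesis PQ_act : forall t m, M0 m ->
  map_mpoly (act t) (P m) * Q (lattice_act a t m)
  = P (lattice_act a t m) * map_mpoly (act t) (Q m).
Variable ev : {rmorphism {mpoly L[n]} -> Om}.
Hypothesis evC : forall c, ev c%:MP = jL c.
Hypothesis evX : forall i, ev 'X_i = jK (s i).
Hypothesis PQ_ev : forall m, M0 m ->
  ev (Q m) != 0 /\ ev (P m) = monomial_value lam m * ev (Q m).

Variables (Fx : fieldType) (tx : {rmorphism {mpoly L[n]} -> Fx}).
Hypothesis tx_inj : injective tx.
Variable Sx : gal_group gd -> {rmorphism Fx -> Fx}.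
Hypothesis Sx_tx : forall t p, Sx t (tx p) = tx (map_mpoly (act t) p).

Local Notation T := (character_fun tx P Q).
Local Notation twist := (twist tx P Q).
Local Notation specializes := (specializes ev tx).
Local Notation concentrated := (concentrated M0).

Lemma ev_map t p : ev (map_mpoly (act t) p) = S t (ev p).
Proof.
have := @mpoly_rmorphism_eq n L Om (ev \o map_mpoly (act t)) (S t \o ev).
apply=> [c|i] /=; first by rewrite map_mpolyC !evC S_L.
by rewrite map_mpolyX !evX S_K.
Qed.

Lemma tx_neq0 B : ev B != 0 -> tx B != 0.
Proof. by apply: contraNneq => e; rewrite (tx_inj (x1 := B) (x2 := 0)) ?rmorph0. Qed.

Lemma Sx_character t m : M0 m -> Sx t (T m) = T (lattice_act a t m).
Proof.
move=> Mm; rewrite /character_fun rmorphM fmorphV !Sx_tx.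
have [q0 _] := PQ_ev Mm; have [q1 _] := PQ_ev (M0a t Mm).
apply/eqP; rewrite eqr_div -?rmorphM ?PQ_act // tx_neq0 //.
by rewrite ev_map fmorph_eq0.
Qed.

Definition act_mnm t (m : 'X_{1..N}) : 'X_{1..N} := [multinom m ((a t)^-1 i)%g | i < N].

Definition act_mpoly t : {rmorphism {mpoly L[N]} -> {mpoly L[N]}} :=
  mmap (@mpolyC N L \o act t) (fun i => 'X_(a t i)).

Lemma act_mpolyX t m : act_mpoly t 'X_[m] = 'X_[act_mnm t m].
Proof.
rewrite /act_mpoly /= mmapX /mmap1 [RHS]mpolyXE_id.
rewrite [RHS](reindex_inj (@perm_inj _ (a t))); apply: eq_bigr => i _.
by rewrite mnmE permK.
Qed.

Lemma act_mpolyE t p :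
  act_mpoly t p = \sum_(m <- msupp p) act t p@_m *: 'X_[act_mnm t m].
Proof.
rewrite {1}[p]mpolyE rmorph_sum; apply: eq_bigr => m _.
rewrite -mul_mpolyC rmorphM act_mpolyX /act_mpoly /= mmapC.
by rewrite mul_mpolyC.
Qed.

Lemma mdiff_act t m m0 : mdiff (act_mnm t m) (act_mnm t m0) = lattice_act a t (mdiff m m0).
Proof. by apply/ffunP => i; rewrite !ffunE !mnmE. Qed.

Lemma concentrated_act t m0 p :
  concentrated m0 p -> concentrated (act_mnm t m0) (act_mpoly t p).
Proof.
move=> cp; rewrite act_mpolyE big_seq.
elim/big_rec: _ => [|m q mp cq]; first by move=> m; rewrite msupp0.
move=> m'; rewrite mcoeff_msupp mcoeffD mcoeffZ mcoeffX.
have [<- _|ne] := eqVneq (act_mnm t m) m'; first by rewrite mdiff_act; apply/M0a/cp.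
by rewrite mulr0 add0r -mcoeff_msupp; apply: cq.
Qed.

Lemma twist_act t m0 p : concentrated m0 p ->
  twist (act_mnm t m0) (act_mpoly t p) = Sx t (twist m0 p).
Proof.
move=> cp; rewrite act_mpolyE /twist raddf_sum [in RHS]/mlin rmorph_sum.
rewrite big_seq [RHS]big_seq; apply: eq_bigr => m mp.
rewrite /= mlinZ mlinX rmorphM /= Sx_tx map_mpolyC mdiff_act Sx_character //.
exact: cp.
Qed.

Variables (kx : {rmorphism {mpoly k[n]} -> Fx}).
Hypothesis kxE : forall p, kx p = tx (map_mpoly (in_alg L) p).
Variable evk : {rmorphism {mpoly k[n]} -> K}.
Hypothesis evkE : forall p, jK (evk p) = ev (map_mpoly (in_alg L) p).

(** Multiplying by the other conjugates of B makes the denominator invariant, and then the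
    numerator, z being invariant. The new denominator is still nonzero at s, because the conjugates
    of B are. *)
Lemma galois_descent z x : (forall t, Sx t z = z) -> specializes z (jK x) ->
  exists A B : {mpoly k[n]}, [/\ evk B != 0, z * kx B = kx A & evk A = x * evk B].
Proof.
move=> fz [A [B [B0 zE cE]]].
pose C := \prod_(t | t != 1%g) map_mpoly (act t) B.
have act1 : map_mpoly (act 1%g) B = B.
  by apply/mpolyP => m; rewrite mcoeff_map_mpoly; exact: gal_act1.
have BC : B * C = \prod_t map_mpoly (act t) B by rewrite [RHS](bigD1 1%g) //= act1.
have zC : z * tx (B * C) = tx (A * C) by rewrite !rmorphM mulrA zE.
have eC : ev (A * C) = jK x * ev (B * C) by rewrite !rmorphM cE mulrA.
have BC0 : ev (B * C) != 0.
  rewrite BC rmorph_prod; apply/prodf_neq0 => t _; by rewrite ev_map fmorph_eq0.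
have fB t : map_mpoly (act t) (B * C) = B * C.
  rewrite BC rmorph_prod [RHS](reindex_inj (mulIg t)) /=; apply: eq_bigr => r _.
  by apply/mpolyP => m; rewrite !mcoeff_map_mpoly; symmetry; exact: gal_actM.
have fA t : map_mpoly (act t) (A * C) = A * C.
  by apply: tx_inj; rewrite -Sx_tx -zC rmorphM fz Sx_tx fB.
have [B1 B1E] := mpoly_galois_fixed fB; have [A1 A1E] := mpoly_galois_fixed fA.
exists A1, B1; split.
- by rewrite -(fmorph_eq0 jK) evkE -B1E.
- by rewrite !kxE -B1E -A1E.
- by apply: (fmorph_inj jK); rewrite rmorphM !evkE -A1E -B1E.
Qed.

Variables (d : nat) (g : {mpoly k[d]}) (phi : rational_map d X).
Hypothesis reg : regular_on g phi.
Variable PR : {rmorphism {mpoly k[d]} -> {mpoly L[N]}}.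
Hypothesis PR_act : forall t p, act_mpoly t (PR p) = PR p.
Let evlam : {rmorphism {mpoly L[N]} -> Om} := mmap jL lam.
Hypothesis PR_g : evlam (PR g) != 0.
Definition represents (b : X) (p : {mpoly k[d]}) (e : nat) : Prop :=
  phi b = (tofrac p / tofrac g ^+ e) :> {fraction {mpoly k[d]}}.
Hypothesis PR_ev : forall b p e, represents b p e ->
  evlam (PR p) = jK (tofrac b) * evlam (PR g) ^+ e.
Hypothesis components : forall b p e, represents b p e ->
  exists m0 U V, [/\ PR p * V = U * PR g ^+ e, concentrated m0 U, concentrated m0 V
                   & evlam V != 0].

(* The graph of k[X] -> k(A^n): pulled back to the torsor, b is the quotient   *)
(* U / V of polynomials in the l_i, and z is the quotient of their twists.     *)
Definition pullback (b : X) (z : Fx) : Prop := exists p e m0 U V,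
  represents b p e /\
  [/\ PR p * V = U * PR g ^+ e, concentrated m0 U, concentrated m0 V, evlam V != 0
    & z * twist m0 V = twist m0 U].

Lemma represents_mul b b' p p' e e' : represents b p e -> represents b' p' e' ->
  [/\ represents (b * b') (p * p') (e + e'),
      represents (b - b') (p * g ^+ e' - p' * g ^+ e) (e + e')
    & b = b' -> p * g ^+ e' = p' * g ^+ e].
Proof.
rewrite /represents => h h'; have [g0 _] := reg.
have [x [y [hx hy]]] : exists x y : {fraction {mpoly k[d]}}, phi b = x /\ phi b' = y.
  by exists (phi b), (phi b').
have [tf [tfE tf_inj]] : exists tf : {rmorphism {mpoly k[d]} -> {fraction {mpoly k[d]}}},
    (forall p, tofrac p = tf p) /\ injective tf.
  exists (@tofrac _); split=> // u v /eqP; by rewrite tofrac_eq => /eqP.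
have tg0 r : tf g ^+ r != 0 by rewrite expf_neq0 // -tfE tofrac_eq0.
rewrite !tfE in h h' *; split.
- by rewrite rmorphM h h' rmorphM mulf_div exprD.
- by rewrite rmorphB h h' rmorphB !rmorphM !rmorphXn -!mulNr addf_div // exprD.
- move=> e0; apply: tf_inj; rewrite !rmorphM !rmorphXn; apply/eqP.
  by rewrite -eqr_div // -h -h' e0.
Qed.

Let twV0 m0 V : concentrated m0 V -> evlam V != 0 -> twist m0 V != 0.
Proof.
move=> cV V0; have sp := specializes_twist evC tx_inj lam0 PQ_ev cV.
by apply: (specializes_neq0 tx_inj sp); rewrite mulf_neq0 ?invr_eq0 ?mmap1_neq0.
Qed.

(** The source of the retraction identity: at s, z takes the value of U / V at [lam], which is b,
    the two factors lam^m0 cancelling. *)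
Lemma pullback_specializes b z : pullback b z -> specializes z (jK (tofrac b)).
Proof.
move=> [p [e [m0 [U [V [rep [UV cU cV V0 zE]]]]]]].
have sU := specializes_twist evC tx_inj lam0 PQ_ev cU.
have sV := specializes_twist evC tx_inj lam0 PQ_ev cV.
have m00 := mmap1_neq0 lam0 m0.
have -> : z = twist m0 U / twist m0 V by rewrite -zE mulfK // twV0.
have -> : jK (tofrac b) = (mmap jL lam U / mmap1 lam m0) / (mmap jL lam V / mmap1 lam m0).
  rewrite invfM invrK mulrACA mulVf // mulr1; apply: (mulIf V0).
  rewrite -[mmap jL lam U]/(evlam U) -[mmap jL lam V]/(evlam V) mulfVK //.
  apply: (mulIf (expf_neq0 e PR_g)).
  by rewrite mulrAC -(PR_ev rep) -rmorphXn -!rmorphM UV.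
by apply: specializes_div => //; rewrite mulf_neq0 ?invr_eq0.
Qed.

(** Two presentations of b satisfy [U * V' = U' * V] already as polynomials in the y_i, and the
    twist is multiplicative, so the quotients of twists agree. *)
Lemma pullback_unique b z z' : pullback b z -> pullback b z' -> z = z'.
Proof.
move=> [p [e [m0 [U [V [rep [UV cU cV V0 zE]]]]]]].
move=> [p' [e' [m0' [U' [V' [rep' [UV' cU' cV' V0' zE']]]]]]].
have [_ _ /(_ erefl) /(congr1 PR)] := represents_mul rep rep'.
rewrite !rmorphM !rmorphXn => pp.
have PRg0 r : PR g ^+ r != 0.
  by apply: expf_neq0; apply: contraNneq PR_g => ->; rewrite rmorph0.
have cross : U * V' = U' * V.
  apply: (mulIf (PRg0 e)); apply: (mulIf (PRg0 e')).
  transitivity ((PR p * V) * V' * PR g ^+ e'); first by rewrite UV (mulrAC U).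
  transitivity ((PR p' * V') * V * PR g ^+ e); last first.
    by rewrite UV' (mulrAC U') -!mulrA [_ * PR g ^+ e]mulrC.
  by rewrite (mulrAC _ V') (mulrAC _ V) pp -!mulrA; congr (_ * _); rewrite [RHS]mulrCA
     mulrCA; congr (_ * _); rewrite mulrC.
have t0 := twV0 cV V0; have t0' := twV0 cV' V0'.
apply: (mulIf t0); apply: (mulIf t0').
rewrite zE -mulrA [twist m0 V * _]mulrC mulrA zE'.
rewrite -(twistM tx_inj M0D PQ_hom PQ_ev cU cV') cross addmC.
rewrite (twistM tx_inj M0D PQ_hom PQ_ev cU' cV) -zE'.
by rewrite mulrAC -!mulrA; congr (_ * _); rewrite mulrC.
Qed.

Lemma pullback_exists b : exists z, pullback b z.
Proof.
have [p [e rep]] := reg.2 b; have [m0 [U [V [UV cU cV V0]]]] := components rep.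
exists (twist m0 U / twist m0 V), p, e, m0, U, V; split=> //.
by split=> //; rewrite mulfVK // twV0.
Qed.

Lemma pullback_ring b z b' z' : pullback b z -> pullback b' z' ->
  pullback (b * b') (z * z') /\ pullback (b - b') (z - z').
Proof.
move=> [p [e [m0 [U [V [rep [UV cU cV V0 zE]]]]]]].
move=> [p' [e' [m0' [U' [V' [rep' [UV' cU' cV' V0' zE']]]]]]].
have [repM repB _] := represents_mul rep rep'.
have twM := twistM tx_inj M0D PQ_hom PQ_ev.
have cM := concentratedM M0D.
have VV0 : evlam (V * V') != 0 by rewrite rmorphM mulf_neq0.
have cU'V : concentrated (m0 + m0')%MM (U' * V) by rewrite addmC; apply: cM.
split.
  exists (p * p'), (e + e')%N, (m0 + m0')%MM, (U * U'), (V * V'); split=> //.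
  split=> //; [|exact: cM|exact: cM|].
    by rewrite rmorphM mulrACA UV UV' mulrACA exprD.
  by rewrite (twM _ _ _ _ cV cV') (twM _ _ _ _ cU cU') mulrACA zE zE'.
exists (p * g ^+ e' - p' * g ^+ e), (e + e')%N, (m0 + m0')%MM, (U * V' - U' * V), (V * V').
split=> //; split=> //; [| |exact: cM|].
- rewrite rmorphB !rmorphM !rmorphXn !mulrBl exprD; congr (_ - _).
    by rewrite mulrACA UV [RHS]mulrACA [PR g ^+ e' * V']mulrC.
  by rewrite [V * V']mulrC mulrACA UV' mulrACA [RHS]mulrACA [PR g ^+ e' * V]mulrC.
- by apply: concentratedB => //; exact: cM.
- rewrite twistB (twM _ _ _ _ cV cV') (twM _ _ _ _ cU cV') mulrBl mulrA zE; congr (_ - _).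
  rewrite [(m0 + m0')%MM]addmC (twM _ _ _ _ cU' cV) -zE'.
  by rewrite -[RHS]mulrA; congr (_ * _); exact: mulrC.
Qed.

Hypothesis PRC : forall c, PR c%:MP = (c%:A)%:MP.

Lemma pullback_scalar c : pullback (@cmap k X c) (kx c%:MP).
Proof.
exists c%:MP, 0%N, 0%MM, (c%:A)%:MP, 1; split.
  by rewrite /represents (khomE phi) expr0 divr1.
have md : mdiff 0%MM 0%MM = 0 :> lattice N by apply/ffunP => i; rewrite !ffunE subrr.
have T0 := character_fun0 tx_inj lam0 M00 M0D PQ_hom PQ_ev.
have tC x : twist 0%MM x%:MP = tx x%:MP.
  by rewrite -[x%:MP]mulr1 -mpolyX0 mul_mpolyC /twist mlinZ mlinX md T0 mulr1.
have cC x : concentrated 0%MM x%:MP.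
  move=> m; rewrite msuppC; case: ifP => // _; rewrite inE => /eqP ->.
  by rewrite md.
split.
- by rewrite PRC expr0 mulr1.
- exact: cC.
- by rewrite -mpolyC1; exact: cC.
- by rewrite rmorph1 oner_neq0.
- by rewrite -mpolyC1 !tC mpolyC1 rmorph1 mulr1 kxE map_mpolyC.
Qed.

(** The polynomials [PR p] are Galois-invariant, so the conjugate of a presentation of b presents b
    again. Together with uniqueness this makes z invariant. *)
Lemma pullback_galois t b z : pullback b z -> pullback b (Sx t z).
Proof.
move=> [p [e [m0 [U [V [rep [UV cU cV V0 zE]]]]]]].
exists p, e, (act_mnm t m0), (act_mpoly t U), (act_mpoly t V); split=> //; split.
- by have := congr1 (act_mpoly t) UV; rewrite !rmorphM !rmorphXn !PR_act.
- exact: concentrated_act.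
- exact: concentrated_act.
- suff -> : evlam (act_mpoly t V) = S t (evlam V) by rewrite fmorph_eq0.
  have := @mpoly_rmorphism_eq N L Om (evlam \o act_mpoly t) (S t \o evlam).
  apply=> [c|i] /=; first by rewrite /act_mpoly /= !mmapC /= ?mmapC S_L.
  by rewrite /act_mpoly /= !mmapX !mmap1U /= ?mmapX ?mmap1U S_lam.
- by rewrite !twist_act // -rmorphM zE.
Qed.

Variable jn : {rmorphism {fraction {mpoly k[n]}} -> Fx}.
Hypothesis jnE : forall p, jn (tofrac p) = kx p.

Lemma pullback_descends b : exists (A B : {mpoly k[n]}),
  [/\ evk B != 0, pullback b (jn (tofrac A / tofrac B)) & evk A = tofrac b * evk B].
Proof.
have [z zb] := pullback_exists b.
have fz t : Sx t z = z by apply: pullback_unique (pullback_galois t zb) zb.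
have [A [B [B0 zE cE]]] := galois_descent fz (pullback_specializes zb).
exists A, B; split=> //.
have kB0 : kx B != 0.
  rewrite -jnE fmorph_eq0 tofrac_eq0; apply: contraNneq B0 => ->; by rewrite rmorph0.
by rewrite rmorphM fmorphV !jnE -zE mulfK.
Qed.

Hypothesis evk_peval : forall p, evk p = @peval k (function_field X) n s p.

(** The relation [pullback] is the graph of a ring morphism from k[X] to k(A^n). As k[X] is finitely
    generated, the product [h] of the denominators of the generators' images makes it regular on
    D(h), and [h] is nonzero at s. *)
Lemma pullback_retract : retract_rational X.
Proof.
have [|||||psi psiP] := @rmorphism_of_graph X {fraction {mpoly k[n]}}
    (fun b y => pullback b (jn y)).
- by move=> b; have [A [B [_ h _]]] := pullback_descends b; exists (tofrac A / tofrac B).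
- by move=> b y y' h h'; apply: (fmorph_inj jn); apply: pullback_unique h h'.
- by move=> b b' y y' h h'; rewrite rmorphB; have [] := pullback_ring h h'.
- by move=> b b' y y' h h'; rewrite rmorphM; have [] := pullback_ring h h'.
- by have := pullback_scalar 1; rewrite -jnE mpolyC1 !rmorph1.
have psi_uniq b y : pullback b (jn y) -> psi b = y.
  by move=> h; apply: (fmorph_inj jn); apply: pullback_unique (psiP b) h.
have psik c : psi (kmap (coord_alg X) c) = kmap (ratfun k n) c.
  by apply: psi_uniq; rewrite jnE; exact: pullback_scalar.
pose psih : rational_map n X := @KHom k (coord_alg X) (ratfun k n) psi psik.
have spec b : exists AB : {mpoly k[n]} * {mpoly k[n]},
    [/\ evk AB.2 != 0, psi b = tofrac AB.1 / tofrac AB.2 & evk AB.1 = tofrac b * evk AB.2].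
  by have [A [B [B0 h e]]] := pullback_descends b; exists (A, B); split=> //; apply: psi_uniq.
have [m [x gen]] := coord_fg X.
pose AB i := proj1_sig (constructive_indefinite_description _ (spec (x i))).
have ABP i : [/\ evk (AB i).2 != 0, psi (x i) = tofrac (AB i).1 / tofrac (AB i).2
    & evk (AB i).1 = tofrac (x i) * evk (AB i).2].
  exact: proj2_sig (constructive_indefinite_description _ (spec (x i))).
pose h := \prod_i (AB i).2.
have eh0 : evk h != 0.
  by rewrite rmorph_prod; apply/prodf_neq0 => i _; case: (ABP i).
have h0 : h != 0 by apply: contraNneq eh0 => ->; rewrite rmorph0.
have [tf [tfE tf_inj]] : exists tf : {rmorphism {mpoly k[n]} -> {fraction {mpoly k[n]}}},
    (forall p, tofrac p = tf p) /\ injective tf.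
  exists (@tofrac _); split=> // u v /eqP; by rewrite tofrac_eq => /eqP.
have th0 r : tf h ^+ r != 0 by rewrite expf_neq0 // -tfE tofrac_eq0.
pose Reg (y : {fraction {mpoly k[n]}}) := exists A e, y = tf A / tf h ^+ e.
have RegD y y' : Reg y -> Reg y' -> Reg (y + y').
  move=> [A [e ->]] [A' [e' ->]]; exists (A * h ^+ e' + A' * h ^+ e), (e + e')%N.
  by rewrite addf_div // rmorphD !rmorphM !rmorphXn exprD.
have RegM y y' : Reg y -> Reg y' -> Reg (y * y').
  move=> [A [e ->]] [A' [e' ->]]; exists (A * A'), (e + e')%N.
  by rewrite mulf_div rmorphM exprD.
have RegC c : Reg (kmap (ratfun k n) c).
  by exists c%:MP, 0%N; rewrite expr0 divr1 -tfE.
have Reg1 : Reg 1 by exists 1, 0%N; rewrite expr0 divr1 rmorph1.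
have Reg0 : Reg 0 by exists 0, 0%N; rewrite rmorph0 mul0r.
have Regx i : Reg (psi (x i)).
  have [B0 -> _] := ABP i.
  exists ((AB i).1 * \prod_(j | j != i) (AB j).2), 1%N.
  have hE : h = (AB i).2 * \prod_(j | j != i) (AB j).2 by rewrite /h (bigD1 i).
  have C0 : \prod_(j | j != i) (AB j).2 != 0.
    by apply: contraNneq h0; rewrite hE => ->; rewrite mulr0.
  rewrite expr1 hE !rmorphM invfM mulrACA !tfE divff ?mulr1 //.
  by rewrite -tfE tofrac_eq0.
have RegX y r : Reg y -> Reg (y ^+ r).
  by move=> hy; elim: r => [|r IH]; rewrite ?expr0 // exprS; apply: RegM.
have RegP (F : 'I_m -> {fraction {mpoly k[n]}}) : (forall i, Reg (F i)) -> Reg (\prod_i F i).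
  by move=> hF; apply: (big_ind Reg).
have Reg_all b : Reg (psi b).
  have [p ->] := gen b; rewrite mmap_comp /mmap /mmap1.
  apply: (big_ind Reg) => // u _; apply: RegM; first by rewrite /= psik; exact: RegC.
  by apply: RegP => i; apply: RegX; exact: Regx.
exists n, s, psih, h; split.
- split; first exact: h0.
  move=> b; have [A [e e1]] := Reg_all b; exists A, e.
  by rewrite (tfE A) (tfE h); exact: e1.
- by exists (evk h)^-1; rewrite -evk_peval divff.
(* The presentation p / h^e is arbitrary; it is compared with the presentation A / B whose value at
   s is known, and B is cancelled at s. *)
- move=> b p e pe; rewrite -!evk_peval.
  have [[A B] /= [B0 psiE eA]] := spec b.
  have tB0 : tf B != 0.
    by rewrite -tfE tofrac_eq0; apply: contraNneq B0 => ->; rewrite rmorph0.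
  have cross : p * B = A * h ^+ e.
    apply: tf_inj; rewrite !rmorphM rmorphXn.
    have e2 : tf p / tf h ^+ e = tf A / tf B.
      by rewrite -(tfE p) -(tfE h) -(tfE A) -(tfE B) -psiE; exact: esym pe.
    exact: (divf_eq_cross (th0 e) tB0 e2).
  apply: (mulIf B0); rewrite -rmorphM cross rmorphM rmorphXn eA.
  by rewrite mulrAC.
Qed.

End Retraction.

(** * Functions on the quotient as quotients of weight components *)

Section Components.
Variables (k : fieldType) (L : fieldExtType k) (G : lin_alg_group k).
Variables (M : zmodType)
  (theta : forall R : kalg L, 'M[restrict_scalars R]_(gdim G) -> M -> R).
Hypothesis fgM : fg_group M.
Hypothesis theta_char : forall (R : kalg L) (g : 'M[restrict_scalars R]_(gdim G)),
  gpoint g -> character_point (theta g).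
Hypothesis theta_nat : forall (R S : kalg L) (j : khom R S)
    (g : 'M[restrict_scalars R]_(gdim G)), gpoint g ->
  forall m, theta (R := S) (map_mx j g : 'M[restrict_scalars S]_(gdim G)) m = j (theta g m).
Hypothesis theta_uni : forall (R : kalg L) (chi : M -> R), character_point chi ->
  exists! g : 'M[restrict_scalars R]_(gdim G), gpoint g /\ forall m, theta g m = chi m.
Variables (d : nat) (rho : representation G d) (g : {mpoly k[d]}) (X : affine_variety k)
  (phi : rational_map d X).
Hypothesis tq : torsor_quotient rho g phi.
Variables (N : nat) (u : 'I_N -> 'cV[L]_d) (wt : 'I_N -> M).
Hypothesis wt_u : forall (R : kalg L) (h : 'M[restrict_scalars R]_(gdim G)) i, gpoint h ->
  rho (restrict_scalars R) h *m map_mx (kmap R) (u i)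
    = theta h (wt i) *: map_mx (kmap R) (u i).

(* k[V] -> L[y], where y_i stands for the linear form l_i. *)
Definition projection : {rmorphism {mpoly k[d]} -> {mpoly L[N]}} :=
  mmap (@mpolyC N L \o in_alg L) (fun b => \sum_i (u i b 0)%:MP * 'X_i).

Local Notation PR := projection.

Lemma projectionC c : PR c%:MP = (c%:A)%:MP.
Proof. by rewrite /PR /= mmapC. Qed.

Lemma projectionX b : PR 'X_b = \sum_i (u i b 0)%:MP * 'X_i.
Proof. by rewrite /PR /= mmapX mmap1U. Qed.

Variables (Om : fieldType) (jL : {rmorphism L -> Om}) (lam : 'I_N -> Om).
Variable M0 : lattice N -> Prop.
Hypothesis M0_wt : forall m : lattice N, \sum_i wt i *~ m i = 0 -> M0 m.
Hypothesis PR_inj : forall p, p != 0 -> mmap jL lam (PR p) != 0.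

Definition mnm_weight (m : 'X_{1..N}) : M := \sum_i wt i *+ m i.

Definition component (w : M) (q : {mpoly L[N]}) : {mpoly L[N]} :=
  \sum_(m <- msupp q | mnm_weight m == w) q@_m *: 'X_[m].

Lemma msupp_component w q m : m \in msupp (component w q) -> mnm_weight m = w.
Proof.
rewrite mcoeff_msupp /component raddf_sum /= => ne; apply/eqP/negPn/negP => mw.
case/negP: ne; apply/eqP; apply: big1 => m' /eqP m'w; rewrite mcoeffZ mcoeffX.
by case: eqP => [em|]; rewrite ?mulr0 //; rewrite -em m'w eqxx in mw.
Qed.

Lemma component_sum q : q = \sum_(w <- undup (map mnm_weight (msupp q))) component w q.
Proof.
rewrite {1}[q]mpolyE /component (exchange_big_dep xpredT) //= [LHS]big_seq [RHS]big_seq.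
apply: eq_bigr => m mq; rewrite -big_filter.
have -> : [seq i <- undup (map mnm_weight (msupp q)) | mnm_weight m == i] = [:: mnm_weight m].
  rewrite (eq_filter (a2 := pred1 (mnm_weight m))); last by move=> x; rewrite /= eq_sym.
  by rewrite filter_pred1_uniq ?undup_uniq // mem_undup map_f.
by rewrite big_seq1.
Qed.

(** G-invariance of [phi], applied to the universal point of G acting on the point [vp] of V over
    the fraction field of L[y]. The action multiplies y_i by the character [wt i], so comparing
    coefficients of each character shows that [PR p] is proportional to [PR g ^+ e] weight by
    weight, with the same factor z. *)
Lemma weight_components b p e : represents g phi b p e ->
  exists m0 U V, [/\ PR p * V = U * PR g ^+ e, concentrated M0 m0 U, concentrated M0 m0 V
                   & mmap jL lam V != 0].
Proof.
move=> rep; have [[g0 reg] _ inva _ _] := tq.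
pose Fy := {fraction {mpoly L[N]}}.
have [ty [tyE ty_inj]] : exists ty : {rmorphism {mpoly L[N]} -> Fy},
    (forall q, tofrac q = ty q) /\ injective ty.
  by exists (@tofrac _); split=> // x y /eqP; rewrite tofrac_eq => /eqP.
pose RF : kalg L := KAlg (ty \o @mpolyC N L).
have [C [inc [ce [coef [h [[gh th] coefB coefE _ _]]]]]] :=
  universal_point fgM theta_char theta_nat theta_uni RF.
pose Ck := restrict_scalars C.
have incC c : inc (ty c%:MP) = kmap C c by rewrite -(khomE inc).
have PR0 q : q != 0 -> PR q != 0.
  by move/PR_inj; apply: contraNneq => ->; rewrite rmorph0.
have ty0 q : q != 0 -> ty q != 0.
  by apply: contraNneq => e0; apply/eqP/ty_inj; rewrite rmorph0.
have [PRK PRKE] : exists PRK : {rmorphism {fraction {mpoly k[d]}} -> Fy},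
    forall q, PRK (tofrac q) = ty (PR q).
  by apply: (@fraction_lift _ _ (ty \o PR)) => q q0; apply/ty0/PR0.
pose vp : 'cV[Ck]_d := \col_x inc (ty (PR 'X_x)).
pose wp : 'cV[Ck]_d := rho Ck h *m vp.
have pv q : peval (fun i => vp i 0) q = inc (ty (PR q)).
  have := @mpoly_rmorphism_eq d k C (mmap (kmap Ck) (fun i => vp i 0)) (inc \o (ty \o PR)).
  apply=> [c|i]; first by rewrite [LHS]mmapC -[RHS]/(inc (ty (PR _))) projectionC incC.
  by rewrite [LHS]mmapX mmap1U mxE.
have wpE x : wp x 0 = \sum_i kmap C (u i x 0) * (ce (wt i) * inc (ty 'X_i)).
  have vpE : vp = \sum_i inc (ty 'X_i) *: map_mx (kmap C) (u i).
    apply/colP => y; rewrite mxE projectionX !rmorph_sum summxE; apply: eq_bigr => i _.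
    by rewrite !rmorphM incC !mxE mulrC.
  rewrite /wp vpE mulmx_sumr summxE; apply: eq_bigr => i _.
  rewrite -scalemxAr (wt_u (R := C)) // th !mxE.
  by rewrite mulrCA mulrA mulrC.
pose twy : {rmorphism {mpoly L[N]} -> C} := mmap (kmap C) (fun i => ce (wt i) * inc (ty 'X_i)).
have pw q : peval (fun i => wp i 0) q = twy (PR q).
  have := @mpoly_rmorphism_eq d k C (mmap (kmap Ck) (fun i => wp i 0)) (twy \o PR).
  apply=> [c|i].
    by rewrite [LHS]mmapC -[RHS]/(twy (PR _)) projectionC; symmetry; apply: mmapC.
  rewrite [LHS]mmapX mmap1U wpE -[RHS]/(twy (PR _)) projectionX rmorph_sum.
  by apply: eq_bigr => j _; rewrite rmorphM /twy /= mmapC mmapX mmap1U.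
pose yf : {rmorphism X -> C} := inc \o (PRK \o phi).
have yk c : yf (kmap (coord_alg X) c) = kmap Ck c.
  by rewrite /yf /= (khomE phi) /= PRKE projectionC incC.
pose y : khom (coord_alg X) Ck := @KHom k (coord_alg X) Ck yf yk.
have gy0 r : ty (PR g) ^+ r != 0 by rewrite expf_neq0 // ty0 // PR0.
have repy b' q r : represents g phi b' q r -> ty (PR q) = PRK (phi b') * ty (PR g) ^+ r.
  by rewrite /represents => ->; rewrite rmorphM fmorphV rmorphXn !PRKE mulfVK.
have op : open_point g vp.
  exists (inc (ty (PR g))^-1); rewrite [peval _ _]pv -rmorphM divff ?rmorph1 //.
  by have := gy0 1%N; rewrite expr1.
have ov : Defs.over g phi vp y.
  by move=> b' q r rb; rewrite !pv (repy _ _ _ rb) rmorphM rmorphXn.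
have ow : Defs.over g phi wp y by exact: (inva Ck h vp y gh op ov).
have := ow b p e rep; rewrite !pw => tw.
pose z := PRK (phi b).
have [ce0 ceD] : ce 0 = 1 /\ forall m m', ce (m + m') = ce m * ce m'.
  by have [c0 cD] := theta_char gh; split=> [|m m']; rewrite -!th.
have ceX (m : M) r : ce (m *+ r) = ce m ^+ r.
  by elim: r => [|r IH]; rewrite ?mulr0n ?expr0 // mulrSr exprSr ceD IH.
have ceS (m : 'X_{1..N}) : ce (mnm_weight m) = \prod_i ce (wt i) ^+ m i.
  rewrite /mnm_weight (big_morph ce ceD ce0); apply: eq_bigr => i _; exact: ceX.
have twyE q : twy q = \sum_(m <- msupp q) inc (ty (q@_m *: 'X_[m])) * ce (mnm_weight m).
  rewrite /twy /= /mmap; apply: eq_bigr => m _.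
  rewrite -mul_mpolyC !rmorphM incC -mulrA; congr (_ * _).
  rewrite /mmap1 ceS mpolyXE_id !rmorph_prod -big_split; apply: eq_bigr => i _ /=.
  by rewrite exprMn !rmorphXn mulrC.
have coef_twy w x q : coef w (inc x * twy q) = x * ty (component w q).
  pose cm : {additive C -> RF} :=
    HB.pack (coef w) (GRing.isZmodMorphism.Build C RF (coef w) (coefB w)).
  rewrite twyE mulr_sumr -[coef w]/(cm : _ -> _) raddf_sum /= /component rmorph_sum mulr_sumr.
  rewrite [RHS]big_mkcond; apply: eq_bigr => m _.
  by rewrite mulrA -rmorphM coefE eq_sym.
have comp_eq w : ty (component w (PR p)) = z * ty (component w (PR g ^+ e)).
  rewrite -coef_twy -[LHS]mul1r -coef_twy rmorph1 mul1r tw rmorphXn.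
  by [].
(* The denominator does not vanish at [lam], so one of its weight components does not either; that
   component becomes V. *)
have [w Vw] : exists w, mmap jL lam (component w (PR g ^+ e)) != 0.
  apply: NNPP => no; have := PR_inj (expf_neq0 e g0); rewrite rmorphXn => /negP; apply.
  apply/eqP; rewrite [PR g ^+ e]component_sum rmorph_sum; apply: big1 => w _.
  by apply/eqP/negPn/negP => Vw; apply: no; exists w.
have V0 : component w (PR g ^+ e) != 0 by apply: contraNneq Vw => ->; rewrite rmorph0.
have [m0 m0V] : exists m0, m0 \in msupp (component w (PR g ^+ e)).
  by exists (mlead (component w (PR g ^+ e))); exact: mlead_supp.
(* Exponents of equal weight differ by one of weight zero, and those belong to M0. *)
have conc q : concentrated M0 m0 (component w q).
  move=> m /msupp_component mw; apply: M0_wt.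
  have := msupp_component m0V; rewrite -mw => e0.
  transitivity (mnm_weight m - mnm_weight m0); last by rewrite e0 subrr.
  rewrite /mnm_weight -sumrB; apply: eq_bigr => i _.
  by rewrite ffunE mulrzBr.
exists m0, (component w (PR p)), (component w (PR g ^+ e)); split=> //.
apply: ty_inj; rewrite !rmorphM (repy _ _ _ rep) comp_eq -/z -rmorphXn.
by rewrite -!mulrA; congr (_ * _); rewrite mulrC.
Qed.

End Components.

(** * Assembly: from p-retractions to a retraction *)

Section RetractOfFactorization.
Variables (k : fieldType) (L : fieldExtType k) (gd : galois_data L).
Local Notation act := (@gal_act _ _ gd).
Variables (X : affine_variety k).
Local Notation K := {fraction X}.
Let kK : {rmorphism k -> K} := @tofrac X \o @cmap k X.
Variables (Om : fieldType) (jK : {rmorphism K -> Om}) (jL : {rmorphism L -> Om}).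
Hypothesis compat : forall c : k, jK (kK c) = jL c%:A.
Variable S : gal_group gd -> {rmorphism Om -> Om}.
Hypothesis S_K : forall t x, S t (jK x) = jK x.
Hypothesis S_L : forall t x, S t (jL x) = jL (act t x).
Variables (N : nat) (a : gal_group gd -> {perm 'I_N}) (lam : 'I_N -> Om).
Hypothesis lam0 : forall i, lam i != 0.
Hypothesis S_lam : forall t i, S t (lam i) = lam (a t i).
Local Notation M0 := (descends jK jL lam).
Variable kap : lattice N -> 'I_(ldim L) -> K.
Hypothesis kapP : forall m, M0 m -> monomial_value lam m = tensor_value jK jL (kap m).
Variables (d : nat) (g : {mpoly k[d]}) (phi : rational_map d X).
Hypothesis reg : regular_on g phi.
Variable PR : {rmorphism {mpoly k[d]} -> {mpoly L[N]}}.
Hypothesis PR_act : forall t p, act_mpoly a t (PR p) = PR p.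
Hypothesis PR_g : mmap jL lam (PR g) != 0.
Hypothesis PR_ev : forall b p e, represents g phi b p e ->
  mmap jL lam (PR p) = jK (tofrac b) * mmap jL lam (PR g) ^+ e.
Hypothesis components : forall b p e, represents g phi b p e ->
  exists m0 U V, [/\ PR p * V = U * PR g ^+ e, concentrated M0 m0 U, concentrated M0 m0 V
                   & mmap jL lam V != 0].
Hypothesis PRC : forall c, PR c%:MP = (c%:A)%:MP.

(** The factorization is tested in the ring Om, where the value of t at m is the monomial with
    exponent m itself; this is the evaluation required by the construction of the retraction. *)
Lemma retract_of_factorization :
  power_factors kK (lattice_act a) M0 kap idfun 1 -> retract_rational X.
Proof.
move=> [n [s [P [Q [PQ_hom PQ_act PQ_uni]]]]].
have [jn jnE] := extend_scalars L n.
have [Sx SxE] := galois_action gd n.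
have [ev evE] : exists ev : {rmorphism {mpoly L[n]} -> Om},
    forall p, ev p = mmap jL (jK \o s) p by exists (mmap jL (jK \o s)).
have [evk evkE] : exists evk : {rmorphism {mpoly k[n]} -> K},
    forall p, evk p = @peval k (function_field X) n s p.
  by exists (mmap (kmap (function_field X)) s).
have M0D m m' : M0 m -> M0 m' -> M0 (m + m').
  move=> h h'; rewrite -[m']opprK; apply: (descendsB compat S_K S_L lam0) => //.
  rewrite -[- m']add0r; apply: (descendsB compat S_K S_L lam0) => //.
  exact: (descends0 compat).
have [tx [txE tx_inj]] : exists tx : {rmorphism {mpoly L[n]} -> {fraction {mpoly L[n]}}},
    (forall q, tofrac q = tx q) /\ injective tx.
  by exists (@tofrac _); split=> // x y /eqP; rewrite tofrac_eq => /eqP.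
have [kx kxE] : exists kx : {rmorphism {mpoly k[n]} -> {fraction {mpoly L[n]}}},
    forall p, kx p = tx (map_mpoly (in_alg L) p) by exists (tx \o map_mpoly (in_alg L)).
apply: (@pullback_retract k L gd X Om jK jL S S_K S_L N a lam lam0 S_lam M0
  (descends0 compat lam) M0D (descends_act compat S_K S_L S_lam) n s P Q PQ_hom PQ_act
  ev _ _ _ _ tx tx_inj Sx _ kx kxE evk _ d g phi reg PR PR_act PR_g PR_ev components PRC
  jn _ evkE).
- by move=> c; rewrite evE mmapC.
- by move=> i; rewrite evE mmapX mmap1U.
- move=> m Mm; have [[y Qy] e] := PQ_uni Om jK jL compat m Mm.
  rewrite !evE e mulr1z kapP //; split=> //.
  by apply/eqP => Q0; move/eqP: Qy; rewrite Q0 mul0r eq_sym oner_eq0.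
- by move=> t p; rewrite -!txE; exact: SxE.
- move=> p; have := @mpoly_rmorphism_eq n k Om (jK \o evk) (ev \o map_mpoly (in_alg L)).
  apply=> [c|i] /=.
    by rewrite evkE /peval mmapC map_mpolyC evE mmapC; exact: compat.
  by rewrite evkE /peval mmapX mmap1U map_mpolyX evE mmapX mmap1U.
- by move=> p; rewrite kxE -txE; exact: jnE.
Qed.

End RetractOfFactorization.

(** For each prime p, a p-retraction of degree d factors t over k(X') with exponent 1; its norm to K
    has exponent d, which is prime to p. *)
Lemma power_factors_of_p_retractions (k : fieldType) (L : fieldExtType k) (gd : galois_data L)
    (X : affine_variety k) (Lam : zmodType) (aL : gal_group gd -> Lam -> Lam)
    (M0 : Lam -> Prop) (kap : Lam -> 'I_(ldim L) -> {fraction X})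
    (kK := (@tofrac X \o @cmap k X) : {rmorphism k -> {fraction X}}) :
  (forall t, zmod_morphism (aL t)) -> M0 0 ->
  (forall m m', M0 m -> M0 m' -> M0 (m - m')) ->
  kap 0 =1 tensor_one kK ->
  (forall m m', M0 m -> M0 m' -> kap (m + m') =1 tensor_mul kK (kap m) (kap m')) ->
  (forall t m, M0 m -> kap (aL t m) =1 tensor_act kK t (kap m)) ->
  (forall p, prime p -> p_retract_rational p X) ->
  power_factors kK aL M0 kap idfun 1.
Proof.
move=> aLB M00 M0B kap0 kapD kap_act hX.
apply: (power_factors_bezout aLB M00 M0B kapD) => p pp.
have [n [X' [f [s [phi [_ f_inj [d [F [e [FE basis]]] pd] comp]]]]]] := hX p pp.
exists d; split=> //; rewrite -[d%:Z]mul1r.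
apply: (power_factors_degree M00 M0B kap0 kapD (e := e) basis).
exact: (power_factors_initial kapD kap_act f_inj comp FE).
Qed.

Section Quotient.
Variables (k : fieldType) (L : fieldExtType k) (G : lin_alg_group k).
Variables (M : zmodType)
  (theta : forall R : kalg L, 'M[restrict_scalars R]_(gdim G) -> M -> R).
Hypothesis fgM : fg_group M.
Hypothesis theta_char : forall (R : kalg L) (g : 'M[restrict_scalars R]_(gdim G)),
  gpoint g -> character_point (theta g).
Hypothesis thetaM : forall (R : kalg L) (g h : 'M[restrict_scalars R]_(gdim G)),
  gpoint g -> gpoint h -> forall m, theta (g *m h) m = theta g m * theta h m.
Hypothesis theta_nat : forall (R S : kalg L) (j : khom R S)
    (g : 'M[restrict_scalars R]_(gdim G)), gpoint g ->
  forall m, theta (R := S) (map_mx j g : 'M[restrict_scalars S]_(gdim G)) m = j (theta g m).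
Hypothesis theta_uni : forall (R : kalg L) (chi : M -> R), character_point chi ->
  exists! g : 'M[restrict_scalars R]_(gdim G), gpoint g /\ forall m, theta g m = chi m.
Variable gd : galois_data L.
Variables (d : nat) (rho : representation G d) (g : {mpoly k[d]}) (X : affine_variety k)
  (phi : rational_map d X).
Hypothesis tq : torsor_quotient rho g phi.

Lemma quotient_retract_rational :
  (forall p, prime p -> p_retract_rational p X) -> retract_rational X.
Proof.
move=> hX.
have [N [a0 [l [u [wt [a0_bij equiv l0 ul wtP]]]]]] :=
  weight_system fgM theta_char thetaM theta_nat theta_uni rho gd.
pose a t : {perm 'I_N} := perm (bij_inj (a0_bij t)).
have aE t i : a t i = a0 t i by rewrite permE.
have [phiK phiKE] : exists phiK : {rmorphism {fraction X} -> {fraction {mpoly k[d]}}},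
    forall b, phiK (tofrac b) = phi b.
  apply: fraction_lift => b b0; apply: contra b0 => /eqP e.
  by apply/eqP/(torsor_injective tq).
have [jV jVE] := extend_scalars L d.
have [S SE] := galois_action gd d.
pose Om := {fraction {mpoly L[d]}}.
pose jK : {rmorphism {fraction X} -> Om} := jV \o phiK.
pose jL := scalar_fun L d.
pose lam i : Om := tofrac (linear_form (l i)).
have compat := compat_K jVE phiKE.
have S_K t x : S t (jK x) = jK x by exact: (S_extend jVE SE).
have S_L t x : S t (jL x) = jL (@gal_act _ _ gd t x) by exact: (S_scalar SE).
have lam0 i : lam i != 0 by rewrite tofrac_eq0 linear_form_neq0.
have S_lam t i : S t (lam i) = lam (a t i).
  rewrite /lam SE aE (equiv t i).1; congr tofrac.
  rewrite /linear_form rmorph_sum; apply: eq_bigr => b _.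
  by rewrite /= map_mpolyZ map_mpolyX mxE.
have [kap [kapP kap0 kapD kap_act]] :=
  monomial_coordinates compat (@tensor_K_inj _ _ _ _ _ jVE phiK) S_K S_L lam0 S_lam.
have [regg _ _ _ _] := tq; have [g0 _] := regg.
have [tL tLE] : exists tL : {rmorphism {mpoly L[d]} -> Om}, forall q, tofrac q = tL q.
  by exists (@tofrac _).
(* Since the products [u i *m l i] add up to the identity, substituting the forms l_i for the y_i
   undoes the projection. *)
have evPR p : mmap jL lam (projection u p) = jV (tofrac p).
  have := @mpoly_rmorphism_eq d k Om (mmap jL lam \o projection u) (jV \o @tofrac _).
  apply=> [c|b].
    by rewrite /= mmapC /= mmapC; apply: esym; exact: (jV_scalar jVE).
  rewrite [LHS]/= -[mmap _ _ 'X_b]/(projection u 'X_b) projectionX rmorph_sum.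
  rewrite [RHS]/= jVE map_mpolyX tLE.
  have -> : 'X_b = \sum_i (u i b 0)%:MP * linear_form (l i) :> {mpoly L[d]}.
    transitivity (\sum_c (\sum_i u i *m l i) b c *: 'X_c : {mpoly L[d]}).
      rewrite ul (bigD1 b) //= mxE eqxx scale1r big1 ?addr0 // => c ne.
      by rewrite mxE eq_sym (negbTE ne) scale0r.
    under eq_bigr => c _ do rewrite summxE scaler_suml.
    rewrite exchange_big; apply: eq_bigr => i _; rewrite /linear_form mulr_sumr.
    by apply: eq_bigr => c _; rewrite mxE big_ord1 mul_mpolyC scalerA.
  rewrite rmorph_sum; apply: eq_bigr => i _.
  apply: etrans (rmorphM (mmap jL lam) _ _) _; rewrite [RHS]rmorphM -!tLE.
  by congr (_ * _); [exact: mmapC | apply: etrans (mmapX _ _ _) _; exact: mmap1U].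
have evPR0 p : p != 0 -> mmap jL lam (projection u p) != 0.
  by move=> p0; rewrite evPR fmorph_eq0 tofrac_eq0.
apply: (retract_of_factorization compat S_K S_L lam0 S_lam kapP regg (PR := projection u)).
- move=> t p; have := @mpoly_rmorphism_eq d k _ (act_mpoly a t \o projection u) (projection u).
  apply=> [c|b] /=.
    rewrite -[mmap _ _ c%:MP]/(projection u c%:MP) projectionC.
    by rewrite /act_mpoly /= mmapC /= gal_actk.
  rewrite -[mmap _ _ 'X_b]/(projection u 'X_b) projectionX rmorph_sum.
  rewrite [RHS](reindex_inj (@perm_inj _ (a t))); apply: eq_bigr => i _.
  by rewrite rmorphM /act_mpoly /= mmapC mmapX mmap1U aE (equiv t i).2 mxE.
- exact: evPR0.
- move=> b p e rep; rewrite !evPR.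
  have e0 : (tofrac g ^+ e : {fraction {mpoly k[d]}}) != 0 by rewrite expf_neq0 // tofrac_eq0.
  have e1 : tofrac p = phiK (tofrac b) * tofrac g ^+ e :> {fraction {mpoly k[d]}}.
    by rewrite phiKE rep; symmetry; exact: mulfVK.
  apply: etrans (congr1 jV e1) _; apply: etrans (rmorphM jV _ _) _.
  by congr (_ * _); exact: rmorphXn.
- apply: (weight_components fgM theta_char theta_nat theta_uni tq _ _ evPR0 (wt := wt)).
    by move=> R h i gh; exact: (wtP R h i gh).2.
  move=> m; apply: (weight_zero_descends theta_char tq l0 _ jVE SE phiKE).
  by move=> R h i gh; exact: (wtP R h i gh).1.
- exact: projectionC.
apply: power_factors_of_p_retractions => //.
- exact: lattice_actB.
- exact: (descends0 compat).
- exact: (descendsB compat S_K S_L lam0).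
Qed.

End Quotient.

Theorem corollary1p2 (k : fieldType) (G : lin_alg_group k)
  (hG : multiplicative_type G) :
  (forall p : nat, prime p -> BG_p_retract_rational p G) ->
  BG_retract_rational G.
Proof.
move=> hp d rho g X phi tq; have [L0 sep diag] := hG.
(* The field splitting G is only separable over k; G stays diagonalizable over its Galois
   closure. *)
have [L [i [[gd] iE]]] := galois_closure_data sep.
have [M [theta [fgM th_char thM th_nat th_uni]]] := diagonalizable_over_pull iE diag.
apply: (quotient_retract_rational fgM th_char thM th_nat th_uni gd tq) => p pp.
exact: (hp p pp d rho g X phi tq).
Qed.
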